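(* Let $\alpha\in(0,1)$, $T>0$, let $\Omega\subset\mathbb{R}^d$ ($d\in\{1,2,3\}$) be a bounded Lipschitz domain, and let $$\mathcal{L}u:=\sum_{k=1}^d\Bigl\{-a_k(x)\,\partial_{x_k}^2u+b_k(x)\,\partial_{x_k}u\Bigr\}+c(x)\,u$$ with sufficiently smooth coefficients $\{a_k\}$, $\{b_k\}$ and $c$ in $C(\bar\Omega)$ such that $a_k>0$ in $\bar\Omega$ and $c\ge\lambda\ge0$ for a constant $\lambda$. Consider the problem $$D_t^\alpha u+\mathcal{L}u=f(x,t)\ \text{ for }(x,t)\in\Omega\times(0,T],\qquad u(\cdot,0)=u_0\ \text{ in }\Omega,\qquad u=0\ \text{ on }\partial\Omega\text{ for }t>0 .$$ Let a unique solution $u$ of this problem and its approximation $u_h$ be in $C(\bar\Omega\times[0,t])\cap W^{1,\infty}(\epsilon,t;L_\infty(\Omega))$ for any $0<\epsilon<t\le T$, and also in $C^2(\Omega)$ for any $t>0$, with $u_h(\cdot,0)=u_0$ and $u_h=u$ on $\partial\Omega$. Let $R_h(\cdot,t)=(D_t^\alpha+\mathcal{L})u_h(\cdot,t)-f(\cdot,t)$ for $t>0$. Then the following hold. (i) $\|(u_h-u)(\cdot,t)\|_{L_\infty(\Omega)}\le(D_t^\alpha+\lambda)^{-1}\|R_h(\cdot,t)\|_{L_\infty(\Omega)}$ for $0<t\le T$. (ii) If $\|R_h(\cdot,t)\|_{L_\infty(\Omega)}\le(D_t^\alpha+\lambda)\mathcal{E}(t)$ for all $0<t\le T$ for some barrier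 function $\mathcal{E}$ with $\mathcal{E}(t)\ge0$ for all $0\le t\le T$, then $\|(u_h-u)(\cdot,t)\|_{L_\infty(\Omega)}\le\mathcal{E}(t)$ for all $0\le t\le T$. (iii) For any $\tau>0$ and all $0<t\le T$, the error $e=u_h-u$ satisfies $$\|e(\cdot,t)\|_{L_\infty(\Omega)}\le\sup_{0<s\le t}\left\{\frac{\|R_h(\cdot,s)\|_{L_\infty(\Omega)}}{\mathcal{R}_0(s)}\right\},\qquad \|e(\cdot,t)\|_{L_\infty(\Omega)}\le t^{\alpha-1}\sup_{0<s\le t}\left\{\frac{\|R_h(\cdot,s)\|_{L_\infty(\Omega)}}{\mathcal{R}_1(s)}\right\},$$ and in the second bound $t^{\alpha-1}$ can be replaced by $\mathcal{E}_1(t)$, where, with $\beta:=1-\alpha$, $$\mathcal{R}_0(t):=\{\Gamma(1-\alpha)\}^{-1}t^{-\alpha}+\lambda,\qquad \mathcal{R}_1(t):=\{\Gamma(1-\alpha)\}^{-1}t^{-1}\rho(\tau/t)+\lambda\,\mathcal{E}_1(t),$$ $$\mathcal{E}_1(t):=\max\{\tau,t\}^{\alpha-1},\qquad \rho(s):=s^{-\beta}\bigl[1-((1-s)^+)^\beta\bigr].$$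
   Context: $v^+:=\max\{0,v\}$. For a scalar function $v$ and $t>0$, $(D_t^\alpha+\lambda)^{-1}v(t):=\int_0^t (t-s)^{\alpha-1}E_{\alpha,\alpha}(-\lambda[t-s]^\alpha)\,v(s)\,ds$, where $E_{\alpha,\beta}(s)=\sum_{k=0}^\infty \{\Gamma(\alpha k+\beta)\}^{-1}s^k$ is the generalized Mittag-Leffler function. $D_t^\alpha$ is the Caputo derivative of order $\alpha$ in time: $D_t^\alpha v(\cdot,t):=\frac1{\Gamma(1-\alpha)}\int_0^t(t-s)^{-\alpha}\,\partial_s v(\cdot,s)\,ds$ for $t>0$. For the less smooth functions considered here (bounded on $(0,t)$ and Lipschitz in time on $[\epsilon,t]$ for each $0<\epsilon<t$, possibly discontinuous at $t=0$), it is understood via the formula obtained by integration by parts: $$\Gamma(1-\alpha)\,D_t^\alpha v(\cdot,t)=t^{-\alpha}\{v(\cdot,t)-v(\cdot,0)\}+\int_0^t\alpha(t-s)^{-\alpha-1}\{v(\cdot,t)-v(\cdot,s)\}\,ds .$$ The barrier $\mathcal{E}:[0,T]\to[0,\infty)$ in (ii) is a scalar function of this class (bounded, Lipschitz on $[\epsilon,T]$ for each $\epsilon>0$, possibly discontinuous at $t=0$), so that $D_t^\alpha\mathcal{E}(t)$ is defined for $t>0$. No coercivity condition $\langle\mathcal{L}v,v\rangle\ge\lambda\|v\|^2$ is assumed. *)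

(* Defs.v *)
From HB Require Import structures.
From mathcomp Require Import all_boot all_order all_algebra.
From mathcomp Require Import all_classical all_reals all_analysis.

Set Implicit Arguments.
Unset Strict Implicit.
Unset Printing Implicit Defensive.
Import Order.TTheory GRing.Theory Num.Theory.
Import numFieldNormedType.Exports.

Local Open Scope classical_set_scope.
Local Open Scope ring_scope.

Section FractionalCalculus.
Context {R : realType}.
Implicit Types (al be lam tau s t z : R).

Local Notation mu := (@lebesgue_measure R).

(* Meaningful for 0 < z only. *)
Definition Gamma z : R :=
  \int[mu]_(x in `]0, +oo[) (x `^ (z - 1) * expR (- x)).

Definition mittag_leffler al be s : R :=
  limn (series (fun k : nat => (Gamma (al * k%:R + be))^-1 * s ^+ k)).

(* The Caputo derivative in the form obtained from
   Gamma(1-al)^-1 * \int_0^t (t-s)^(-al) v'(s) ds by integration by parts; it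
   makes sense for t > 0 when v is bounded on (0,t), Lipschitz on [eps,t] for
   every 0 < eps < t, and possibly discontinuous at 0. *)
Definition caputo al (v : R -> R) t : R :=
  (Gamma (1 - al))^-1 *
  (t `^ (- al) * (v t - v 0) +
   \int[mu]_(s in `]0, t[) (al * (t - s) `^ (- al - 1) * (v t - v s))).

(* (D_t^al + lam)^-1 v (t), extended-real valued because it is applied to
   L_oo norms, which may be infinite or not integrable in time. *)
Definition caputo_resolvent al lam (v : R -> \bar R) t : \bar R :=
  (\int[mu]_(s in `]0%R, t[)
     (((t - s) `^ (al - 1) *
       mittag_leffler al al (- lam * (t - s) `^ al))%:E * v s))%E.

Definition barrier_class (T : R) (E : R -> R) : Prop :=
  [bounded E t | t in `[0, T]] /\
  forall eps, 0 < eps -> [lipschitz E t | t in `[eps, T]].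

Definition pospart (x : R) : R := Num.max 0 x.

(* be = 1 - al below. *)
Definition rho al s : R :=
  s `^ (- (1 - al)) * (1 - (pospart (1 - s)) `^ (1 - al)).

Definition barrier1 al tau t : R := (Num.max tau t) `^ (al - 1).

Definition residual0 al lam t : R := (Gamma (1 - al))^-1 * t `^ (- al) + lam.

Definition residual1 al lam tau t : R :=
  (Gamma (1 - al))^-1 * t^-1 * rho al (tau / t) + lam * barrier1 al tau t.

End FractionalCalculus.

Section SpaceNorm.
Context {R : realType} {d : nat}.
Implicit Types (Omega A : set 'rV[R]_d) (v : 'rV[R]_d -> R).

Definition box (lo hi : 'rV[R]_d) : set 'rV[R]_d :=
  [set x | forall i, lo 0 i <= x 0 i <= hi 0 i].

Definition box_volume (lo hi : 'rV[R]_d) : R :=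
  \prod_(i < d) Num.max 0 (hi 0 i - lo 0 i).

(* d-dimensional Lebesgue outer measure. *)
Definition lebesgue_outer A : \bar R :=
  ereal_inf [set m | exists lo hi : nat -> 'rV[R]_d,
    A `<=` \bigcup_k box (lo k) (hi k) /\
    m = (\sum_(0 <= k <oo) (box_volume (lo k) (hi k))%:E)%E].

(* Essential supremum of |v| over Omega; +oo if v is not essentially bounded. *)
Definition Linfty Omega v : \bar R :=
  ereal_inf [set M%:E | M in
    [set M : R | 0 <= M /\
       lebesgue_outer [set x | Omega x /\ M < `|v x|] = 0%E]].

End SpaceNorm.

Section Problem.
Context {R : realType} {d : nat}.
Implicit Types (Omega : set 'rV[R]_d) (u v : 'rV[R]_d -> R -> R).
Implicit Types (a b : 'I_d -> 'rV[R]_d -> R) (c w : 'rV[R]_d -> R).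

Definition boundary Omega : set 'rV[R]_d := closure Omega `\` interior Omega.

(* Near each boundary point, after a rotation or reflection Q, Omega is the
   part of space above the graph of a Lipschitz function gam of the d-1
   coordinates other than the k-th. *)
Definition lipschitz_boundary Omega : Prop :=
  forall x, boundary Omega x ->
  exists (Q : 'M[R]_d) (k : 'I_d) (gam : 'rV[R]_d.-1 -> R),
    [/\ Q *m Q^T = 1%:M,
        [lipschitz gam z | z in setT] &
        \forall y \near x,
          Omega y <-> gam (col' k (y *m Q)) < (y *m Q) 0 k].

Definition bounded_lipschitz_domain Omega : Prop :=
  [/\ Omega !=set0, open Omega, connected Omega, bounded_set Omega &
      lipschitz_boundary Omega].

Definition partial (k : 'I_d) w : 'rV[R]_d -> R :=
  'D_(delta_mx 0 k : 'rV[R]_d) w.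

Definition has_partial (k : 'I_d) w (x : 'rV[R]_d) : Prop :=
  derivable w x (delta_mx 0 k : 'rV[R]_d).

Definition C2_on Omega w : Prop :=
  forall x, Omega x ->
    {for x, continuous w} /\
    forall i, [/\ has_partial i w x,
                  {for x, continuous (partial i w)} &
                  forall j, has_partial j (partial i w) x /\
                            {for x, continuous (partial j (partial i w))}].

Definition elliptic a b c w (x : 'rV[R]_d) : R :=
  \sum_(k < d) (- a k x * partial k (partial k w) x + b k x * partial k w x)
  + c x * w x.

(* C(closure Omega x [0,t]) and W^{1,oo}(eps,t; L_oo(Omega)) for all
   0 < eps < t <= T, and C^2(Omega) for each t in (0,T]; the Sobolev
   regularity in time is expressed as Lipschitz continuity of the
   L_oo(Omega)-valued function t |-> u(.,t) on [eps,t]. *)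
Definition regularity Omega (T : R) u : Prop :=
  (forall eps t : R, 0 < eps -> eps < t -> t <= T ->
     {within closure Omega `*` `[0, t]%classic,
        continuous (fun p : 'rV[R]_d * R => u p.1 p.2)} /\
     exists K : R, forall s1 s2 : R,
       s1 \in `[eps, t] -> s2 \in `[eps, t] ->
       (Linfty Omega (fun x => u x s1 - u x s2)%R <= (K * `|s1 - s2|)%:E)%E) /\
  (forall t : R, 0 < t -> t <= T -> C2_on Omega (u ^~ t)).

Definition is_solution (al T : R) Omega a b c
    (f : 'rV[R]_d -> R -> R) (u0 : 'rV[R]_d -> R) u : Prop :=
  [/\ forall x t, Omega x -> 0 < t -> t <= T ->
        caputo al (u x) t + elliptic a b c (u ^~ t) x = f x t,
      forall x, Omega x -> u x 0 = u0 x &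
      forall x t, boundary Omega x -> 0 < t -> t <= T -> u x t = 0].

(* Uniqueness is among functions of the same regularity; values outside
   closure Omega x [0,T] are immaterial. *)
Definition is_unique_solution (al T : R) Omega a b c
    (f : 'rV[R]_d -> R -> R) (u0 : 'rV[R]_d -> R) u : Prop :=
  [/\ regularity Omega T u,
      is_solution al T Omega a b c f u0 u &
      forall v, regularity Omega T v -> is_solution al T Omega a b c f u0 v ->
        forall x t, closure Omega x -> 0 <= t -> t <= T -> v x t = u x t].

Definition residual al a b c (f : 'rV[R]_d -> R -> R) uh
    (x : 'rV[R]_d) (t : R) : R :=
  caputo al (uh x) t + elliptic a b c (uh ^~ t) x - f x t.

End Problem.

(* Main.v *)
(* Let [e = uh - u] and [N(t) = sup |e(.,t)|].  At a time where [N > 0] the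
   supremum is attained at an interior point [x], and there maximality in space
   gives [lam |e| <= +-(L e)(x,t)], while maximality against the past gives
   [D_t^al N(t) <= +-D_t^al e(x,t)], because [N(t) - N(s) <= |e(x,t)| - |e(x,s)|].
   Hence [(D_t^al + lam) N <= ||R_h||].

   Comparison with a barrier is the one-dimensional maximum principle for the
   Caputo derivative, and (iii) follows with the barriers [S] and [S E_1] for
   [t > 0], set to 0 at [t = 0], whose Caputo derivatives are explicit.

   For (i) let [G(t) = t^(al-1) E_{al,al}(-lam t^al)].  It satisfies the Volterra
   equation [G = g_al - lam g_al * G] with [g_p(t) = t^(p-1) / Gamma p], whence
   [(g_(1-al) + lam) * G = 1]; the log-convexity of [g_al] makes [G] positive.  A
   nondecreasing continuous [w] with [w(0) = 0] has
   [D_t^al w(t) = \int_0^t g_(1-al)(t-y) dw(y)] as a Stieltjes integral, so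
   Tonelli's theorem turns the identity into [G * (D_t^al + lam) w = w].  A
   Lipschitz function is a difference of two such [w], and positivity of [G]
   yields (i). *)

Require Import Defs.
From HB Require Import structures.
From mathcomp Require Import all_boot all_order all_algebra.
From mathcomp Require Import all_classical all_reals all_analysis.
From mathcomp Require Import measurable_realfun.
From mathcomp Require Import ring lra.

Set Implicit Arguments.
Unset Strict Implicit.
Unset Printing Implicit Defensive.
Import Order.TTheory GRing.Theory Num.Theory.
Import numFieldNormedType.Exports.

Local Open Scope classical_set_scope.
Local Open Scope ring_scope.

(** * Substitutions and explicit integrals *)

(** Three obstacles shape the proof. [N] is only continuous at 0, whereas the Stieltjes
    representation wants a Lipschitz function and the comparison principle wants a sign near 0; so
    the argument runs with [Nd delta], the positive part of [N - delta], which vanishes near 0, and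
    [delta] is removed at the end. Next, the maximum principle evaluates the residual at a single
    point, while its norm is an essential supremum; this forces continuity of the residual in space,
    including its nonlocal term, hence an estimate of the Caputo derivative that is uniform up to
    the singularity. Finally, measurability in time of the norm of the residual is never
    established, so (i) first integrates a measurable function below it and then compares integrals
    through their definition by simple functions.

    Positivity of G is obtained without complete monotonicity of Mittag-Leffler functions:
    log-convexity of g_al enters only as g_al(t0-s) / g_al(t-s) <= g_al(t0) / g_al(t) for 0 < s < t
    < t0, which makes G stay positive at a putative first zero t0. *)

Section AffineSubstitution.
Context {R : realType}.
Local Notation mu := (@lebesgue_measure R).
Implicit Types (k c : R) (D : set R).

Lemma measurable_affine k c (A : set R) :
  measurable_fun A (fun x : R => k * x + c).
Proof. by apply: measurable_realfun.measurable_funD => //. Qed.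

(** Lebesgue measure is determined by its values on intervals ]a, b]. A negative [k] pulls such an
    interval back to one of the form [a', b'[, which has the same length up to the factor [|k|]. *)
Lemma lebesgue_measure_affine k c D : k != 0 -> measurable D ->
  pushforward (mscale (NngNum (normr_ge0 k)) mu)
    ((fun x : R => k * x + c) : _ -> measurableTypeR R) D = mu D.
Proof.
move=> k0 mD; apply/esym/lebesgue_measure_unique => //.
  exact: measurable_affine.
move=> mphi _ [[a b] _ <-].
rewrite /= /mscale/= /pushforward /=.
have [ab|ba] := ltP a b; last first.
  by rewrite set_itv_ge ?preimage_set0 ?measure0 ?mule0// -leNgt.
have kgt0 : 0 < `|k| by rewrite normr_gt0.
have [kp|kn] := ltP 0 k.
  have -> : (fun x : R => k * x + c) @^-1` [set` `]a, b]] =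
      [set` `](a - c) / k, (b - c) / k]].
    apply/seteqP; split => x /=; rewrite !in_itv/= ltr_pdivrMr// ler_pdivlMr//;
      by rewrite ltrBlDr lerBrDr [x * k]mulrC.
  rewrite !lebesgue_measure_itv/= !lte_fin ltr_pM2r ?invr_gt0// ltrD2r ab.
  rewrite -!EFinB -EFinM gtr0_norm//; congr EFin.
  by field; rewrite gt_eqF.
have kn0 : k < 0 by rewrite lt_neqAle k0.
have -> : (fun x : R => k * x + c) @^-1` [set` `]a, b]] =
    [set` `[(b - c) / k, (a - c) / k[].
  apply/seteqP; split => x /=; rewrite !in_itv/= ltr_ndivlMr// ler_ndivrMr//;
    by rewrite ltrBlDr lerBrDr [x * k]mulrC// andbC.
rewrite !lebesgue_measure_itv/= !lte_fin ltr_nM2r ?invr_lt0// ltrD2r ab.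
rewrite -!EFinB -EFinM ltr0_norm//; congr EFin.
by field; rewrite k0.
Qed.

Lemma ge0_integral_affine k c D (f : R -> \bar R) : k != 0 ->
  measurable D -> measurable_fun D f -> (forall x, D x -> (0 <= f x)%E) ->
  (\int[mu]_(x in D) f x =
   `|k|%:E * \int[mu]_(x in (fun x : R => k * x + c)%R @^-1` D) f (k * x + c)%R)%E.
Proof.
move=> k0 mD mf f0.
have mphi : measurable_fun [set: measurableTypeR R]
    ((fun x : R => k * x + c) : _ -> measurableTypeR R).
  exact: measurable_affine.
pose nk := NngNum (normr_ge0 k).
transitivity (\int[pushforward (mscale nk mu)
    ((fun x : R => k * x + c)%R : _ -> measurableTypeR R)]_(x in D) f x)%E.
  by apply: eq_measure_integral => A mA _; exact/esym/lebesgue_measure_affine.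
rewrite ge0_integral_pushforward//; last by move=> x; rewrite inE => /f0.
have mphiD : measurable ((fun x : R => k * x + c) @^-1` D).
  by rewrite -[X in measurable X]setTI; exact: mphi.
rewrite ge0_integral_mscale//.
- apply: (measurable_comp mD) => //; last exact: measurable_affine.
  by move=> _ [x Dx <-].
- by move=> x Dx; exact: f0.
Qed.

Lemma ge0_integral_shift c (a b : R) (f : R -> \bar R) :
  measurable_fun `]a, b[ f -> (forall x, `]a, b[%classic x -> (0 <= f x)%E) ->
  (\int[mu]_(x in `]a, b[) f x = \int[mu]_(x in `](a - c)%R, (b - c)%R[) f (x + c)%R)%E.
Proof.
move=> mf f0; rewrite (@ge0_integral_affine 1 c)//= ?oner_eq0//.
rewrite normr1 mul1e.
have -> : (fun x : R => 1 * x + c) @^-1` `]a, b[ = `](a - c)%R, (b - c)%R[%classic.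
  by apply/seteqP; split=> x /=; rewrite !in_itv/= mul1r ltrBlDr ltrBrDr.
by apply: eq_integral => x _; rewrite mul1r.
Qed.

Lemma ge0_integral_reflect (t : R) (f : R -> \bar R) :
  measurable_fun `]0, t[ f -> (forall x, `]0, t[%classic x -> (0 <= f x)%E) ->
  (\int[mu]_(x in `]0%R, t[) f x = \int[mu]_(x in `]0%R, t[) f (t - x)%R)%E.
Proof.
move=> mf f0; rewrite (@ge0_integral_affine (-1) t)//= ?oppr_eq0 ?oner_eq0//.
rewrite normrN1 mul1e.
have -> : (fun x : R => -1 * x + t) @^-1` `]0, t[ = `]0, t[%classic.
  apply/seteqP; split=> x /=; rewrite !in_itv/= mulN1r; lra.
by apply: eq_integral => x _; rewrite mulN1r addrC.
Qed.

Lemma ge0_integral_scale (k t : R) (f : R -> \bar R) : 0 < k ->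
  measurable_fun `]0, k * t[ f -> (forall x, `]0, k * t[%classic x -> (0 <= f x)%E) ->
  (\int[mu]_(x in `]0%R, (k * t)%R[) f x =
   k%:E * \int[mu]_(x in `]0%R, t[) f (k * x)%R)%E.
Proof.
move=> k0 mf f0; rewrite (@ge0_integral_affine k 0)//= ?gt_eqF//.
rewrite gtr0_norm//; congr (_ * _)%E.
have -> : (fun x : R => k * x + 0) @^-1` `]0, k * t[ = `]0, t[%classic.
  by apply/seteqP; split=> x /=; rewrite !in_itv/= addr0 pmulr_rgt0// ltr_pM2l.
by apply: eq_integral => x _; rewrite addr0.
Qed.

End AffineSubstitution.

(** * Monotonicity of integrals, improper integrals and powers *)

Section IntegralTools.
Context {R : realType}.
Local Notation mu := (@lebesgue_measure R).

(** The integral of a nonnegative function is the supremum over the simple functions below it, so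
    monotonicity holds for arbitrary functions. This is how the norm of the residual gets into an
    integral bound. *)
Lemma ge0_le_integral_nomeas d (T : measurableType d) (nu : {measure set T -> \bar R})
    (D : set T) (f g : T -> \bar R) :
  (forall x, D x -> (0 <= f x)%E) -> (forall x, D x -> (f x <= g x)%E) ->
  (\int[nu]_(x in D) f x <= \int[nu]_(x in D) g x)%E.
Proof.
move=> f0 fg.
have g0 x : D x -> (0 <= g x)%E by move=> Dx; exact: le_trans (f0 _ Dx) (fg _ Dx).
rewrite !ge0_integralE//; apply: le_ereal_sup => _ /= [h hf <-].
exists h => // x; apply: le_trans (hf x) _.
rewrite !patchE; case: ifPn => // /set_mem; exact: fg.
Qed.

(** The open interval is exhausted by compact ones, on which the usual theorem applies; monotone
    convergence and the one-sided limits of [F] give the result for integrands singular at the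
    endpoints. *)
Lemma ge0_integral_itvoo_FTC (f F : R -> R) (a b Fa Fb : R) : a < b ->
  (forall x, x \in `]a, b[ -> 0 <= f x) ->
  {in `]a, b[, continuous f} ->
  (forall x, x \in `]a, b[ -> derivable F x 1 /\ 'D_1 F x = f x) ->
  F x @[x --> a^'+] --> Fa -> F x @[x --> b^'-] --> Fb ->
  (\int[mu]_(x in `]a, b[) (f x)%:E = (Fb - Fa)%:E)%E.
Proof.
move=> ab f0 cf dF Fla Flb.
(* The factor 1/3 keeps the interval nondegenerate already for n = 0. *)
pose e (n : nat) : R := (b - a) / 3 * n.+1%:R^-1.
have ba : 0 < (b - a) / 3 by apply: divr_gt0 => //; rewrite subr_gt0.
have e0 n : 0 < e n by rewrite mulr_gt0.
have le3 n : e n <= (b - a) / 3.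
  by rewrite /e ler_piMr ?(ltW ba)// invf_le1 ?ltr0n// ler1n.
have eab n : a + e n < b - e n by have := le3 n; lra.
have ecvg : e n @[n --> \oo] --> 0.
  rewrite -(mulr0 ((b - a) / 3)); apply: cvgMr; exact: cvg_harmonic.
pose I n := `[a + e n, b - e n]%classic.
have sub n : [set` `[a + e n, b - e n]] `<=` [set` `]a, b[].
  move=> x /=; rewrite !in_itv/= => /andP[ax xb]; have := e0 n => ?; lra.
have IU : `]a, b[%classic = \bigcup_n I n.
  apply/seteqP; split => [x /=|x [n _]]; last exact: sub.
  rewrite in_itv/= => /andP[ax xb].
  have [N _ HN] : \forall n \near \oo, e n < Num.min (x - a) (b - x).
    have m0 : 0 < Num.min (x - a) (b - x) by rewrite lt_min !subr_gt0 ax.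
    by move/cvgr_lt : ecvg; apply.
  exists N => //; have := HN N (leqnn _).
  rewrite /I /= lt_min in_itv/= => /andP[? ?]; apply/andP; split; lra.
have mf n : measurable_fun (I n) (EFin \o f).
  apply/measurable_EFinP; apply: subspace_continuous_measurable_fun; first exact: measurable_itv.
  apply: continuous_in_subspaceT => x /set_mem /sub /=; exact: cf.
have ndI : nondecreasing_seq I.
  move=> m n mn; apply/subsetPset => x; rewrite /I /= !in_itv/=.
  have : e n <= e m.
    by rewrite /e ler_wpM2l ?(ltW ba)// lef_pV2 ?posrE ?ltr0n// ler_nat.
  lra.
have H1 := @ge0_nondecreasing_set_cvg_integral _ (measurableTypeR R) R I
  (EFin \o f) mu ndI (fun=> measurable_itv _) mf _.
rewrite IU; apply: (cvg_unique _ (H1 _)) => //.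
  by move=> n x /sub /f0; rewrite lee_fin.
have H2 n : (\int[mu]_(x in I n) (f x)%:E = (F (b - e n) - F (a + e n))%:E)%E.
  have dFx x : x \in `[a + e n, b - e n] -> derivable F x 1.
    by move=> /sub /dF[].
  have cF x : x \in `[a + e n, b - e n] -> {for x, continuous F}.
    by move=> /dFx /derivable1_diffP; exact: differentiable_continuous.
  rewrite (@continuous_FTC2 _ f F)//.
  - by apply: continuous_in_subspaceT => x /set_mem /sub; exact: cf.
  - split.
    + by move=> x /subset_itv_oo_cc; exact: dFx.
    + by apply: cvg_at_right_filter; apply: cF; rewrite in_itv/= lexx ltW.
    + by apply: cvg_at_left_filter; apply: cF; rewrite in_itv/= lexx ltW.
  - by move=> x /subset_itv_oo_cc /sub /dF[_ <-]; rewrite derive1E.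
rewrite (_ : (fun _ => _) = fun n => (F (b - e n) - F (a + e n))%:E); last first.
  by apply/funext => n; exact: H2.
apply: cvg_EFin; first exact: nearW.
rewrite /comp /=; apply: cvgB.
- move/cvg_at_leftP : Flb; apply; split.
    by move=> n; rewrite gtrBl.
  by rewrite -[X in _ --> X]subr0; apply: cvgB => //; exact: cvg_cst.
- move/cvg_at_rightP : Fla; apply; split.
    by move=> n; rewrite ltrDl.
  by rewrite -[X in _ --> X]addr0; apply: cvgD => //; exact: cvg_cst.
Qed.

Lemma cvg_subr_at_left (t : R) : (t - s) @[s --> t^'-] --> 0^'+.
Proof.
move=> A [e /= e0 He]; exists e => //= s /= ste st.
apply: He; last by rewrite subr_gt0.
by rewrite /= sub0r opprB distrC; move: ste; rewrite distrC.
Qed.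

Lemma cvg_powR_subr_at_left (t p : R) : 0 < p ->
  (t - s) `^ p @[s --> t^'-] --> 0.
Proof. by move=> p0; exact: cvg_comp (@cvg_subr_at_left t) (powR_cvg0 p0). Qed.

Lemma is_derive_powR_subr (t p s : R) : s < t ->
  is_derive s 1 (fun s => (t - s) `^ p) (- (p * (t - s) `^ (p - 1))).
Proof.
move=> st; have ts : 0 < t - s by rewrite subr_gt0.
have H1 := is_derive1_powR p ts.
have H2 : is_derive s 1 (fun s : R => t - s) (- 1).
  have H : is_derive s 1 (cst t - id) (0 - 1) by apply: is_deriveB.
  by rewrite sub0r in H.
have := @is_derive1_comp _ (fun x => x `^ p) (fun s : R => t - s) s _ _ H1 H2.
by rewrite mulrN1.
Qed.

Lemma continuous_powR_subr (t p s : R) : s < t ->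
  {for s, continuous (fun s => (t - s) `^ p)}.
Proof.
move=> st; apply: differentiable_continuous; apply/derivable1_diffP.
by have := is_derive_powR_subr p st => ?; exact: ex_derive.
Qed.

Lemma continuous_powR (p s : R) : 0 < s -> {for s, continuous (fun s => s `^ p)}.
Proof.
move=> st; apply: differentiable_continuous; apply/derivable1_diffP.
by have := is_derive1_powR p st => ?; exact: ex_derive.
Qed.

Lemma integral_powR_subr (p t a : R) : 0 < p -> a < t ->
  (\int[mu]_(s in `]a, t[) ((t - s) `^ (p - 1))%:E = ((t - a) `^ p / p)%:E)%E.
Proof.
move=> p0 ta.
rewrite (@ge0_integral_itvoo_FTC _ (fun s => - ((t - s) `^ p / p)) a t
   (- ((t - a) `^ p / p)) 0)//.
- by rewrite sub0r opprK.
- by move=> x _; exact: powR_ge0.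
- by move=> x; rewrite in_itv/= => /andP[_ xt]; exact: continuous_powR_subr.
- move=> x; rewrite in_itv/= => /andP[_ xt].
  have := is_derive_powR_subr p xt => H.
  have := @is_deriveZ _ _ _ _ (- p^-1) _ _ _ H.
  rewrite /GRing.scale/= mulrNN mulKf ?gt_eqF// => {}H.
  rewrite (_ : (fun s => - ((t - s) `^ p / p)) = (fun y => - p^-1 * (t - y) `^ p)); last first.
    by apply/funext => y; rewrite mulNr mulrC.
  by split; [exact: ex_derive|rewrite derive_val].
- apply: cvgN; apply: cvgMl; apply: cvg_at_right_filter.
  exact: continuous_powR_subr.
- rewrite -oppr0; apply: cvgN; rewrite -(mul0r (p^-1)); apply: cvgMl.
  exact: cvg_powR_subr_at_left.
Qed.

(** The interval stays away from the singularity at [t], so negative exponents are allowed; the case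
    used is [p = - al]. *)
Lemma integral_powR_subr_itv (p t a b : R) : p != 0 -> a < b -> b < t ->
  (\int[mu]_(s in `]a, b[) ((t - s) `^ (p - 1))%:E =
   (((t - a) `^ p - (t - b) `^ p) / p)%:E)%E.
Proof.
move=> p0 ab bt.
rewrite (@ge0_integral_itvoo_FTC _ (fun s => - ((t - s) `^ p / p)) a b
   (- ((t - a) `^ p / p)) (- ((t - b) `^ p / p)))//.
- by rewrite opprK addrC -mulrBl.
- by move=> x _; exact: powR_ge0.
- move=> x; rewrite in_itv/= => /andP[_ xt].
  by apply: continuous_powR_subr; exact: lt_trans bt.
- move=> x; rewrite in_itv/= => /andP[_ xt].
  have := is_derive_powR_subr p (lt_trans xt bt) => H.
  have := @is_deriveZ _ _ _ _ (- p^-1) _ _ _ H.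
  rewrite /GRing.scale/= mulrNN mulKf// => {}H.
  rewrite (_ : (fun s => - ((t - s) `^ p / p)) = (fun y => - p^-1 * (t - y) `^ p)); last first.
    by apply/funext => y; rewrite mulNr mulrC.
  by split; [exact: ex_derive|rewrite derive_val].
- apply: cvgN; apply: cvgMl; apply: cvg_at_right_filter.
  by apply: continuous_powR_subr; exact: lt_trans bt.
- apply: cvgN; apply: cvgMl; apply: cvg_at_left_filter.
  exact: continuous_powR_subr.
Qed.

Lemma measurable_powR_subr (t p : R) (D : set R) :
  measurable_fun D (fun s => (t - s) `^ p).
Proof.
apply: measurable_funTS; apply: (measurableT_comp (@measurable_powR R p)).
exact: measurable_funB.
Qed.

End IntegralTools.

(** * Gamma and Beta integrals *)

Section TriangleTonelli.
Context {R : realType}.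
Variables m1 m2 : {sigma_finite_measure set (measurableTypeR R) -> \bar R}.

Variables (b : itv_bound R) (f : measurableTypeR R * measurableTypeR R -> \bar R).
Hypotheses (mf : measurable_fun setT f) (f0 : forall p, (0 <= f p)%E).

(** The triangle 0 < y < z with z below [b]. Extending [f] by zero off it turns both iterated
    integrals into integrals over the plane. *)
Let A : set (measurableTypeR R * measurableTypeR R) :=
  [set p | (0 < (p.1 : R)) && ((p.1 : R) < p.2)] `&`
  (snd @^-1` [set` Interval (BRight 0%R) b]).

Let mA : measurable A.
Proof.
apply: measurableI.
  rewrite -[X in measurable X]setTI.
  by apply: (measurable_and (measurable_fun_ltr (measurable_cst _) measurable_fst)
    (measurable_fun_ltr measurable_fst measurable_snd)).
rewrite -[X in measurable X]setTI.
by apply: measurable_snd => //; exact: measurable_itv.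
Qed.

Let h := f \_ A.

Let mh : measurable_fun setT h.
Proof. by apply/(measurable_restrictT f) => //; exact: measurable_funTS. Qed.

Let h0 p : (0 <= h p)%E. Proof. by rewrite /h patchE; case: ifP. Qed.

Let inA y z : ((y, z) \in A) = [&& 0 < y, y < z & z \in Interval (BRight 0%R) b].
Proof.
rewrite /A in_setI; apply/idP/idP.
  by move=> /andP[/set_mem/=/andP[-> ->] /set_mem/= ->].
move=> /and3P[y0 yz zb]; apply/andP; split; first by apply/mem_set; rewrite /= y0.
exact/mem_set.
Qed.

Let sliceE z : z \in Interval (BRight 0%R) b ->
  (\int[m1]_y h (y, z) = \int[m1]_(y in `]0%R, z[) f (y, z))%E.
Proof.
move=> zb; rewrite [in RHS]integral_mkcond; apply: eq_integral => y _.
by rewrite /h !patchE inA mem_setE zb andbT in_itv.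
Qed.

Lemma measurable_triangle : measurable_fun [set` Interval (BRight 0%R) b]
  (fun z => \int[m1]_(y in `]0%R, z[) f (y, z))%E.
Proof.
apply: (eq_measurable_fun (fun z => \int[m1]_y h (y, z))%E).
  by move=> z /set_mem/= zb; rewrite sliceE.
by apply: measurable_funTS; exact: (@measurable_fun_fubini_tonelli_G _ _ _ _ R m1 h mh h0).
Qed.

(** The right end [b] is abstract so as to cover the half-line, for the Gamma function, and ]0, t[,
    for convolutions; the two measures may differ, because a Lebesgue integral is later exchanged
    with a Stieltjes one. *)
Lemma tonelli_triangle :
  (\int[m1]_(y in [set` Interval (BRight 0%R) b])
     \int[m2]_(z in [set` Interval (BRight y) b]) f (y, z) =
   \int[m2]_(z in [set` Interval (BRight 0%R) b])
     \int[m1]_(y in `]0%R, z[) f (y, z))%E.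
Proof.
transitivity (\int[m1]_y \int[m2]_z h (y, z))%E.
  rewrite integral_mkcond; apply: eq_integral => y _; rewrite patchE.
  case: ifPn => [/set_mem/= yb|/negP yb].
    rewrite [in LHS]integral_mkcond; apply: eq_integral => z _.
    rewrite /h !patchE inA mem_setE.
    move: yb; rewrite !itv_boundlr !bnd_simp => /andP[y0 _].
    rewrite y0/=; case: ltP => //= yz.
    by rewrite (lt_trans y0 yz).
  rewrite integral0_eq// => z _; rewrite /h patchE inA; case: ifP => // /and3P[y0 yz zb].
  exfalso; apply: yb; apply/mem_set => /=.
  move: zb; rewrite !itv_boundlr !bnd_simp y0/= => /andP[_].
  by apply: le_trans; rewrite bnd_simp ltW.
rewrite (@fubini_tonelli _ _ _ _ R m1 m2 h mh h0).
rewrite [in RHS]integral_mkcond; apply: eq_integral => z _; rewrite patchE.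
case: ifPn => [/set_mem/= zb|/negP zb]; first exact: sliceE.
rewrite integral0_eq// => y _; rewrite /h patchE inA; case: ifP => // /and3P[y0 yz zb'].
by exfalso; apply: zb; exact/mem_set.
Qed.

End TriangleTonelli.

Section GammaBeta.
Context {R : realType}.
Local Notation mu := (@lebesgue_measure R).
Implicit Types (a b z t x y s M : R).

Let gam z x : R := x `^ (z - 1) * expR (- x).

Let gam_ge0 z x : 0 <= gam z x.
Proof. by rewrite mulr_ge0 ?powR_ge0 ?expR_ge0. Qed.

Let measurable_gam z D : measurable_fun D (gam z).
Proof.
apply: measurable_funTS; apply: measurable_realfun.measurable_funM => //.
by apply: measurableT_comp => //; exact: measurable_oppr.
Qed.

Lemma integral_powR_itv0 (p t : R) : 0 < p -> 0 < t ->
  (\int[mu]_(x in `]0%R, t[) (x `^ (p - 1))%:E = (t `^ p / p)%:E)%E.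
Proof.
move=> p0 t0; rewrite ge0_integral_reflect.
- by rewrite integral_powR_subr// subr0.
- by apply/measurable_EFinP; apply: measurable_funTS.
- by move=> x _; rewrite lee_fin powR_ge0.
Qed.

Lemma integral_expRN (k : R) : 0 < k ->
  (\int[mu]_(x in `]0%R, +oo[) (k * expR (- k * x))%:E = 1)%E.
Proof.
move=> k0; rewrite -(integral_exponential_pdf k0).
rewrite integral_itv_obnd_cbnd; last first.
  apply/measurable_EFinP; apply: measurable_realfun.measurable_funM => //.
  by apply: measurableT_comp => //; exact: measurable_realfun.measurable_funM.
rewrite integral_mkcond; apply: eq_integral => x _.
by rewrite /exponential_pdf !patchE; case: ifP.
Qed.

(* [x^n <= n! 2^n e^(x/2)] makes the tail of the integral exponentially small. *)
Let gam_lty z : 0 < z -> (\int[mu]_(x in `]0%R, +oo[) (gam z x)%:E < +oo)%E.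
Proof.
move=> z0; pose n := Num.truncn z.
pose C : R := n.+1`!%:R * 2 ^+ n.+1.
have C0 : 0 <= C by rewrite mulr_ge0// exprn_ge0.
have -> : `]0, +oo[%classic = `]0, 1[%classic `|` `[1, +oo[%classic :> set R.
  apply/seteqP; split => x /=; rewrite !in_itv/= !andbT.
    by move=> x0; case: (ltP x 1) => x1; [left; rewrite x0|right].
  by move=> [/andP[]//|]; exact: lt_le_trans.
rewrite ge0_integral_setU//=; last 3 first.
- by apply/measurable_EFinP; exact: measurable_gam.
- by move=> x _; rewrite lee_fin gam_ge0.
- apply/disj_setPS => x [/=]; rewrite !in_itv/= => /andP[_ x1]; lra.
apply: lte_add_pinfty.
  apply: (@le_lt_trans _ _ (\int[mu]_(x in `]0%R, 1%R[) (x `^ (z - 1))%:E)%E).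
    apply: ge0_le_integral_nomeas => x; rewrite /= in_itv/= => /andP[x0 x1].
      by rewrite lee_fin gam_ge0.
    rewrite lee_fin /gam ler_piMr ?powR_ge0// -expR0 ler_expR; lra.
  by rewrite integral_powR_itv0// ltry.
apply: (@le_lt_trans _ _ (\int[mu]_(x in `]0%R, +oo[) (2 * C * (2^-1 * expR (- 2^-1 * x)))%:E)%E).
  apply: (@le_trans _ _ (\int[mu]_(x in `[1%R, +oo[) (2 * C * (2^-1 * expR (- 2^-1 * x)))%:E)%E).
    apply: ge0_le_integral_nomeas => x; rewrite /= in_itv/= andbT => x1.
      by rewrite lee_fin gam_ge0.
    have x0 : 0 < x by lra.
    rewrite lee_fin (_ : 2 * C * (2^-1 * _) = C * expR (- 2^-1 * x)); last by field.
    rewrite /gam.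
    have -> : expR (- x) = expR (- 2^-1 * x) * expR (- 2^-1 * x).
      by rewrite -expRD; congr expR; field.
    rewrite mulrA ler_wpM2r ?expR_ge0//.
    have xn : x `^ (z - 1) <= x ^+ n.+1.
      rewrite -powR_mulrn ?(ltW x0)//; apply: ler_powR => //.
      by have := truncnS_gt z; rewrite -/n; lra.
    apply: (@le_trans _ _ (x ^+ n.+1 * expR (- 2^-1 * x))).
      by rewrite ler_wpM2r ?expR_ge0.
    have x20 : 0 <= x / 2 by rewrite divr_ge0// ltW.
    have := expR_ge1Dxn n x20 => E.
    rewrite mulNr expRN ler_pdivrMr ?expR_gt0//.
    have : (x / 2) ^+ n.+1 / n.+1`!%:R <= expR (x / 2) by apply: le_trans E; rewrite lerDr.
    rewrite ler_pdivrMr ?ltr0n ?fact_gt0// expr_div_n ler_pdivrMr ?exprn_gt0//.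
    by move=> /le_trans; apply; rewrite /C [2^-1 * x]mulrC; lra.
  apply: ge0_subset_integral => //=.
  - apply/measurable_EFinP; apply: measurable_funTS.
    do 2 apply: measurable_realfun.measurable_funM => //.
    by apply: measurableT_comp => //; exact: measurable_realfun.measurable_funM.
  - by move=> x _; rewrite lee_fin !mulr_ge0 ?expR_ge0.
  - by move=> x /=; rewrite !in_itv/= !andbT; lra.
under eq_integral do rewrite EFinM.
rewrite ge0_integralZl//=.
- by rewrite integral_expRN ?invr_gt0// mule1 ltry.
- apply/measurable_EFinP; apply: measurable_funTS.
  apply: measurable_realfun.measurable_funM => //.
  by apply: measurableT_comp => //; exact: measurable_realfun.measurable_funM.
- by rewrite lee_fin mulr_ge0.
Qed.

Lemma EFin_Gamma z : 0 < z ->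
  ((Gamma z)%:E = \int[mu]_(x in `]0%R, +oo[) (x `^ (z - 1) * expR (- x))%:E)%E.
Proof.
move=> z0; rewrite /Gamma /Rintegral fineK// ge0_fin_numE ?gam_lty//.
by apply: integral_ge0 => x _; rewrite lee_fin gam_ge0.
Qed.

(** Keep only the part of the integral over ]M, M + 1[, of length 1. With M = 1 this yields
    positivity, with large M the fast growth that makes the Mittag-Leffler series entire. *)
Lemma Gamma_ge z M c : 0 < z -> 0 <= M -> 0 <= c ->
  (forall x, M < x -> x < M + 1 -> c <= x `^ (z - 1)) ->
  c * expR (- (M + 1)) <= Gamma z.
Proof.
move=> z0 M0 c0 Hc; rewrite -lee_fin EFin_Gamma//.
apply: (@le_trans _ _ (\int[mu]_(x in `]M, (M + 1)%R[) (c * expR (- (M + 1)))%:E)%E).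
  rewrite integral_cst//= lebesgue_measure_itv/= lte_fin ltrDl ltr01.
  by rewrite -EFinB addrAC subrr add0r mule1.
apply: (@le_trans _ _ (\int[mu]_(x in `]M, (M + 1)%R[) (gam z x)%:E)%E).
  apply: ge0_le_integral_nomeas => x; rewrite /= in_itv/= => /andP[x0 x1].
    by rewrite lee_fin mulr_ge0 ?expR_ge0.
  rewrite lee_fin /gam ler_pM ?expR_ge0 ?Hc// ler_expR; lra.
apply: ge0_subset_integral => //=.
- by apply/measurable_EFinP; exact: measurable_gam.
- by move=> x _; rewrite lee_fin gam_ge0.
- by move=> x /=; rewrite !in_itv/= andbT; lra.
Qed.

Lemma Gamma_gt0 z : 0 < z -> 0 < Gamma z.
Proof.
(* On ]1, 2[ the power is at least 1 when z >= 1, and at least its value at 2 otherwise. *)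
move=> z0; have := @Gamma_ge z 1 (Num.min 1 (2 `^ (z - 1))) z0 ler01.
have m0 : 0 < Num.min 1 (2 `^ (z - 1)) :> R by rewrite lt_min ltr01 powR_gt0.
move=> /(_ (ltW m0)) H; apply: lt_le_trans (H _); first by rewrite mulr_gt0 ?expR_gt0.
move=> x x1 x2; have [z1|z1] := leP 1 z.
  rewrite ge_min; apply/orP; left; rewrite -[X in X <= _](powRr0 x); apply: ler_powR; lra.
rewrite ge_min; apply/orP; right.
have x0 : 0 < x by lra.
rewrite (_ : z - 1 = - (1 - z)); last by ring.
rewrite !powRN lef_pV2 ?posrE ?powR_gt0//.
by apply: ge0_ler_powR; rewrite ?nnegrE; lra.
Qed.

Lemma Gamma1 : Gamma 1 = 1 :> R.
Proof.
apply: EFin_inj; rewrite EFin_Gamma// -(integral_expRN (@ltr01 R)).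
by apply: eq_integral => x _; rewrite subrr powRr0 !mul1r mulN1r.
Qed.

Let measurable_beta (t a b : R) D : measurable_fun D
  (fun s => (t - s) `^ (a - 1) * s `^ (b - 1)).
Proof.
apply: measurable_realfun.measurable_funM; first exact: measurable_powR_subr.
exact: measurable_funTS.
Qed.

Let beta_scale (a b t : R) : 0 < t ->
  (\int[mu]_(s in `]0%R, t[) ((t - s) `^ (a - 1) * s `^ (b - 1))%:E =
   (t `^ (a + b - 1))%:E *
   \int[mu]_(s in `]0%R, 1%R[) ((1 - s) `^ (a - 1) * s `^ (b - 1))%:E)%E.
Proof.
move=> t0.
have := @ge0_integral_scale R t 1
  (fun s => ((t - s) `^ (a - 1) * s `^ (b - 1))%:E) t0.
rewrite mulr1 => ->; last 2 first.
- by apply/measurable_EFinP; exact: measurable_beta.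
- by move=> x _; rewrite lee_fin mulr_ge0 ?powR_ge0.
have -> : t `^ (a + b - 1) = t * (t `^ (a - 1) * t `^ (b - 1)).
  have tn : t != 0 by rewrite gt_eqF.
  rewrite (_ : a + b - 1 = 1 + ((a - 1) + (b - 1))); last by ring.
  by rewrite (@powRD _ t 1) ?tn ?implybT// (@powRD _ t (a - 1)) ?tn ?implybT// (powRr1 (ltW t0)).
rewrite EFinM -muleA; congr (_ * _)%E.
rewrite -ge0_integralZl//; last 3 first.
- by apply/measurable_EFinP; exact: measurable_beta.
- by move=> x _; rewrite lee_fin mulr_ge0 ?powR_ge0.
- by rewrite lee_fin mulr_ge0 ?powR_ge0.
apply: eq_integral => x /set_mem/=; rewrite in_itv/= => /andP[x0 x1].
rewrite -EFinM; congr EFin.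
have -> : t - t * x = t * (1 - x) by ring.
rewrite !powRM ?(ltW t0) ?(ltW x0)//; last lra.
by ring.
Qed.

(** Write the product as a double integral and substitute z = x + y, so that the exponentials merge
    into exp(-z). After exchanging the order over 0 < y < z, the inner integral is a Beta integral
    on ]0, z[, which scales like z^(a+b-1). *)
Let GammaM (a b : R) : 0 < a -> 0 < b ->
  ((Gamma a * Gamma b)%:E = (Gamma (a + b))%:E *
   \int[mu]_(s in `]0%R, 1%R[) ((1 - s) `^ (a - 1) * s `^ (b - 1))%:E)%E.
Proof.
move=> a0 b0; have ab0 : 0 < a + b by rewrite addr_gt0.
pose f (p : measurableTypeR R * measurableTypeR R) : \bar R :=
  ((p.1 : R) `^ (b - 1) * ((p.2 : R) - p.1) `^ (a - 1) * expR (- (p.2 : R)))%:E.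
have mf : measurable_fun setT f.
  apply/measurable_EFinP; apply: measurable_realfun.measurable_funM.
    apply: measurable_realfun.measurable_funM.
      by apply: (measurableT_comp (@measurable_powR R _)).
    apply: (measurableT_comp (@measurable_powR R _)).
    exact: measurable_realfun.measurable_funB.
  apply: measurableT_comp => //.
  by apply: measurableT_comp => //; exact: measurable_oppr.
have f0 p : (0 <= f p)%E by rewrite lee_fin !mulr_ge0 ?powR_ge0 ?expR_ge0.
have := @tonelli_triangle R mu mu +oo%O f mf f0.
have -> : (\int[mu]_(y in `]0%R, +oo[) \int[mu]_(z in `]y, +oo[) f (y, z) =
    (Gamma a * Gamma b)%:E)%E.
  transitivity (\int[mu]_(y in `]0%R, +oo[) ((Gamma a)%:E * (gam b y)%:E))%E.
    apply: eq_integral => y /set_mem/=; rewrite in_itv/= andbT => y0.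
    rewrite (@ge0_integral_affine _ 1 y)//=; last first.
      have mp : measurable_fun setT (fun z : R => (y, z) : measurableTypeR R * measurableTypeR R).
        by apply: measurable_fun_pair.
      by apply: measurable_funTS; exact: (measurableT_comp mf mp).
    rewrite normr1 mul1e.
    have -> : (fun x : R => 1 * x + y) @^-1` `]y, +oo[ = `]0, +oo[%classic.
      by apply/seteqP; split=> x /=; rewrite !in_itv/= !andbT mul1r ltrDr.
    rewrite muleC EFin_Gamma// -ge0_integralZl//; last 3 first.
    - by apply/measurable_EFinP; exact: measurable_gam.
    - by move=> x _; rewrite lee_fin gam_ge0.
    - by rewrite lee_fin gam_ge0.
    apply: eq_integral => x _; rewrite /f/= mul1r addrK opprD expRD -EFinM.
    by congr EFin; rewrite /gam; ring.
  rewrite ge0_integralZl//; last 3 first.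
  - by apply/measurable_EFinP; exact: measurable_gam.
  - by move=> x _; rewrite lee_fin gam_ge0.
  - by rewrite lee_fin ltW// Gamma_gt0.
  by rewrite -EFin_Gamma// -EFinM.
move=> ->.
set B := (\int[mu]_(s in `]0%R, 1%R[) _)%E.
have B0 : (0 <= B)%E by apply: integral_ge0 => x _; rewrite lee_fin mulr_ge0 ?powR_ge0.
transitivity (\int[mu]_(z in `]0%R, +oo[) (B * (gam (a + b) z)%:E))%E.
  apply: eq_integral => z /set_mem/=; rewrite in_itv/= andbT => z0.
  transitivity (\int[mu]_(y in `]0%R, z[) ((expR (- z))%:E *
      ((z - y) `^ (a - 1) * y `^ (b - 1))%:E))%E.
    by apply: eq_integral => y _; rewrite /f/= -EFinM; congr EFin; ring.
  rewrite ge0_integralZl//; last 2 first.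
  - by apply/measurable_EFinP; exact: measurable_beta.
  - by move=> x _; rewrite lee_fin mulr_ge0 ?powR_ge0.
  by rewrite beta_scale// -/B muleA muleC /gam EFinM [((expR _)%:E * _)%E]muleC.
rewrite ge0_integralZl//; last 2 first.
- by apply/measurable_EFinP; exact: measurable_gam.
- by move=> x _; rewrite lee_fin gam_ge0.
by rewrite muleC -EFin_Gamma.
Qed.

Lemma integral_beta (a b t : R) : 0 < a -> 0 < b -> 0 < t ->
  (\int[mu]_(s in `]0%R, t[) ((t - s) `^ (a - 1) * s `^ (b - 1))%:E =
   (t `^ (a + b - 1) * (Gamma a * Gamma b / Gamma (a + b)))%:E)%E.
Proof.
move=> a0 b0 t0; have G0 : 0 < Gamma (a + b) by rewrite Gamma_gt0// addr_gt0.
rewrite beta_scale// EFinM; congr (_ * _)%E.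
have /esym := GammaM a0 b0.
set B := (\int[mu]_(s in `]0%R, 1%R[) _)%E => E.
by rewrite mulrC EFinM -E muleA -EFinM mulVf ?mul1e// gt_eqF.
Qed.

End GammaBeta.

(** * The L_oo norm of a continuous function *)

Section BoxCovering.
Context {R : realType}.
Local Notation mu := (@lebesgue_measure R).

Let rcons0 d (x0 : R) (y : 'rV[R]_d) : 'rV[R]_d.+1 :=
  \row_i oapp (fun j => y 0 j) x0 (unlift ord0 i).

Let tail d (x : 'rV[R]_d.+1) : 'rV[R]_d := \row_j x 0 (lift ord0 j).

Let box_volumeS d (lo hi : 'rV[R]_d.+1) : box_volume lo hi =
  Num.max 0 (hi 0 ord0 - lo 0 ord0) * box_volume (tail lo) (tail hi).
Proof.
rewrite /box_volume big_ord_recl; congr (_ * _).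
by apply: eq_bigr => i _; rewrite !mxE.
Qed.

Let box_rcons0 d (lo hi : 'rV[R]_d.+1) x0 y : box lo hi (rcons0 x0 y) <->
  (lo 0 ord0 <= x0 <= hi 0 ord0 /\ box (tail lo) (tail hi) y).
Proof.
split => [H|[H0 H1] i].
  split; first by have := H ord0; rewrite !mxE unlift_none.
  by move=> j; have := H (lift ord0 j); rewrite !mxE liftK.
rewrite !mxE; case: unliftP => [j ->|->] //=.
by have := H1 j; rewrite !mxE.
Qed.

Lemma box_volume_ge0 d (lo hi : 'rV[R]_d) : 0 <= box_volume lo hi.
Proof. by apply: prodr_ge0 => i _; rewrite le_max lexx. Qed.

(* Slicing in the first coordinate: every slice of the box is covered by the
   slices of those boxes whose first side meets it; integrate over the slices. *)
Lemma box_volume_cover d (lo hi : 'rV[R]_d) (l h : nat -> 'rV[R]_d) (P : pred nat) :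
  (forall i, lo 0 i <= hi 0 i) ->
  box lo hi `<=` \bigcup_(k in [set k | P k]) box (l k) (h k) ->
  ((box_volume lo hi)%:E <=
   \sum_(0 <= k <oo) ((P k)%:R * box_volume (l k) (h k))%:E)%E.
Proof.
have nn d' (l' h' : nat -> 'rV[R]_d') (Q : pred nat) k :
    (0 <= ((Q k)%:R * box_volume (l' k) (h' k))%:E)%E.
  by rewrite lee_fin mulr_ge0// box_volume_ge0.
elim: d lo hi l h P => [|d IH] lo hi l h P lohi cov.
  (* In dimension 0 every box has volume 1, an empty product, so a single selected box is enough. *)
  have [k Pk _] : (\bigcup_(k in [set k | P k]) box (l k) (h k)) 0.
    by apply: cov => -[].
  have volE (a b : 'rV[R]_0) : box_volume a b = 1 by rewrite /box_volume big_ord0.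
  apply: (@le_trans _ _ (\sum_(0 <= i < k.+1)
      ((P i)%:R * box_volume (l i) (h i))%:E)%E).
    rewrite big_nat_recr//= Pk !volE mul1r leeDr// sume_ge0// => i _; exact: nn.
  by apply: nneseries_lim_ge => i _ _; exact: nn.
pose I k := `[l k 0 ord0, h k 0 ord0]%classic.
pose V k := box_volume (tail (l k)) (tail (h k)).
have V0 k : 0 <= V k by exact: box_volume_ge0.
pose D := `[lo 0 ord0, hi 0 ord0]%classic.
pose g k (x : R) := (((P k)%:R * V k) * \1_(I k) x)%:E.
have mg k : measurable_fun D (g k).
  apply/measurable_EFinP; apply: measurable_realfun.measurable_funM => //.
  by apply: measurable_funTS; apply: measurable_indic; exact: measurable_itv.
have g0 k x : D x -> (0 <= g k x)%E.
  by move=> _; rewrite lee_fin !mulr_ge0.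
have slice x : D x -> ((box_volume (tail lo) (tail hi))%:E <= \sum_(0 <= k <oo) g k x)%E.
  rewrite /D /= in_itv/= => Dx.
  apply: le_trans (IH (tail lo) (tail hi) (fun k => tail (l k))
    (fun k => tail (h k)) (fun k => P k && (x \in I k)) _ _) _.
  - by move=> i; rewrite !mxE.
  - move=> y By; have /cov [k Pk] : box lo hi (rcons0 x y) by apply/box_rcons0.
    move=> /box_rcons0[xk yk]; exists k => //=.
    by rewrite Pk /= mem_set// /I /= in_itv.
  - apply: lee_nneseries => [k _ _|k _].
      exact: (nn _ (tail (d:=d) \o l) (tail (d:=d) \o h) (fun k => P k && (x \in I k))).
    rewrite lee_fin /g indicE -/(V k).
    by case: (P k); case: (x \in I k); rewrite /= !(mul1r, mul0r, mulr1, mulr0).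
have step1 : ((box_volume lo hi)%:E =
    \int[mu]_(x in D) (box_volume (tail lo) (tail hi))%:E)%E.
  rewrite integral_cst//; last exact: measurable_itv.
  rewrite box_volumeS mulrC EFinM; congr (_ * _)%E.
  apply: esym; transitivity (mu D) => //.
  rewrite /D lebesgue_measure_itv/= lte_fin -EFinB.
  have := lohi ord0; rewrite le_eqVlt => /orP[/eqP ->|lh].
    by rewrite subrr maxxx ltxx.
  by rewrite lh max_r// subr_ge0 ltW.
rewrite step1.
apply: (@le_trans _ _ (\int[mu]_(x in D) \sum_(0 <= k <oo) g k x)%E).
  by apply: ge0_le_integral_nomeas => x Dx; [rewrite lee_fin box_volume_ge0|exact: slice].
rewrite integral_nneseries//; last exact: measurable_itv.
apply: lee_nneseries => [k _ _|k _]; first by apply: integral_ge0 => x /g0.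
have mI : measurable (I k) by exact: measurable_itv.
have mD : measurable D by exact: measurable_itv.
under eq_integral do rewrite /g EFinM.
rewrite ge0_integralZl//; last 2 first.
- apply/measurable_EFinP; apply: measurable_funTS.
  by apply: measurable_indic; exact: measurable_itv.
- by rewrite lee_fin mulr_ge0.
rewrite integral_indic// box_volumeS -/(V k) [X in (_ <= (_ * X)%:E)%E]mulrC mulrA.
rewrite [leRHS]EFinM; apply: lee_wpmul2l; first by rewrite lee_fin mulr_ge0.
apply: (@le_trans _ _ (mu (I k))).
  by apply: le_measure; rewrite ?inE//; exact: measurableI.
rewrite /I lebesgue_measure_itv/= lte_fin -EFinB.
by case: ltP => [lh|_]; rewrite lee_fin le_max lexx// orbT.
Qed.

Lemma box_volume_le_outer d (lo hi : 'rV[R]_d) (A : set 'rV[R]_d) :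
  (forall i, lo 0 i <= hi 0 i) -> box lo hi `<=` A ->
  ((box_volume lo hi)%:E <= lebesgue_outer A)%E.
Proof.
move=> lohi boxA; apply: le_ereal_inf_tmp => _ [l [h [cov ->]]].
have := @box_volume_cover d lo hi l h xpredT lohi.
under eq_eseriesr do rewrite mul1r.
apply => x /boxA /cov [k _ xk]; by exists k.
Qed.

End BoxCovering.

(** * Essential supremum against pointwise values *)

Section LinftyContinuous.
Context {R : realType} {d : nat}.
Implicit Types (Omega : set 'rV[R]_d) (v : 'rV[R]_d -> R).

(** If [|v x|] exceeded an essential bound [M], then by continuity so would [|v|] on a whole box
    around [x]; a box of positive volume has positive outer measure. *)
Lemma norm_le_Linfty Omega v x : open Omega ->
  (forall y, Omega y -> {for y, continuous v}) -> Omega x ->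
  (`|v x|%:E <= Linfty Omega v)%E.
Proof.
move=> oO cv Ox; apply: le_ereal_inf_tmp => _ [M [M0 HM] <-].
rewrite lee_fin leNgt; apply/negP => Mvx.
have : \forall y \near x, Omega y /\ M < `|v y|.
  apply: filterI; first exact: open_nbhs_nbhs.
  have /cvg_norm := cv _ Ox.
  by move=> /cvgr_gt; apply.
move=> /nbhs_ballP[e /= e0 He].
pose lo : 'rV[R]_d := \row_i (x 0 i - e / 2).
pose hi : 'rV[R]_d := \row_i (x 0 i + e / 2).
have e20 : 0 < e / 2 by rewrite divr_gt0.
have lohi i : lo 0 i <= hi 0 i by rewrite !mxE; lra.
have sub : box lo hi `<=` [set y | Omega y /\ M < `|v y|].
  move=> y By; apply: He; split => // i j; rewrite ord1.
  have := By j; rewrite !mxE => /andP[y1 y2].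
  by rewrite /ball/= ltr_norml; apply/andP; split; lra.
have := box_volume_le_outer lohi sub; rewrite HM lee_fin leNgt => /negP; apply.
by apply: prodr_gt0 => i _; rewrite lt_max !mxE; apply/orP; right; lra.
Qed.

(** A cover always consists of infinitely many boxes, and in dimension 0 each of them has volume 1;
    for [0 < d] boxes reduced to a point cost nothing. *)
Lemma lebesgue_outer_set0 : (0 < d)%N -> lebesgue_outer (@set0 'rV[R]_d) = 0%E.
Proof.
move=> d0; apply/eqP; rewrite eq_le; apply/andP; split; last first.
  apply: le_ereal_inf_tmp => _ [l [h [_ ->]]].
  by apply: nneseries_ge0 => k _ _; rewrite lee_fin box_volume_ge0.
apply: ereal_inf_lbound; exists (fun=> 0), (fun=> 0); split => //.
rewrite eseries0// => k _ _; congr EFin.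
by rewrite /box_volume (bigD1 (Ordinal d0))//= !mxE subrr maxxx mul0r.
Qed.

Lemma Linfty_le Omega v (M : R) : (0 < d)%N -> 0 <= M ->
  (forall x, Omega x -> `|v x| <= M) -> (Linfty Omega v <= M%:E)%E.
Proof.
move=> d0 M0 HM; apply: ereal_inf_lbound; exists M => //; split => //.
rewrite (_ : [set _ | _] = set0) ?lebesgue_outer_set0//.
apply/seteqP; split => // x [/HM]; rewrite leNgt => /negP + ?; exact.
Qed.

Lemma Linfty_ge0 Omega v : (0 <= Linfty Omega v)%E.
Proof. by apply: le_ereal_inf_tmp => _ [M [M0 _] <-]; rewrite lee_fin. Qed.

End LinftyContinuous.

(** * Elliptic operators at a spatial maximum *)

(** If [D > 0], then [psi], which vanishes at 0, is positive just to the right of 0, and the mean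
    value theorem lifts [phi] above its maximum. *)
Lemma derive2_at_max (R : realType) (phi psi : R -> R) (r D : R) : 0 < r ->
  (forall h : R, `|h| < r -> is_derive h 1 phi (psi h)) ->
  is_derive (0 : R) 1 psi D -> (forall h : R, `|h| < r -> phi h <= phi 0) ->
  psi 0 = 0 /\ D <= 0.
Proof.
move=> r0 dphi dpsi phimax.
have in0 : (0 : R) \in `](- r), r[ by rewrite in_itv/= oppr_lt0 r0.
have inr (h : R) : h \in `](- r), r[ -> `|h| < r by rewrite in_itv/= ltr_norml.
have rr : - r <= r by rewrite ge0_cp// ltW.
have d1 : psi 0 = 0.
  have H1 : {in `](- r), r[, forall t, derivable phi t 1}.
    by move=> h /inr /dphi => ?; exact: ex_derive.
  have H2 t : t \in `](- r), r[ -> phi t <= phi 0 by move=> /inr /phimax.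
  have [_ H3] := derive1_at_max rr H1 in0 H2.
  have H4 := dphi 0; rewrite normr0 in H4.
  by have [_ <-] := H4 r0.
split => //.
rewrite leNgt; apply/negP => D2.
have [cpsi Dpsi] := dpsi.
have : (h^-1 *: (psi (h *: 1 + 0) - psi 0)) @[h --> (0 : R)^'] --> D.
  by rewrite -Dpsi; exact: cpsi.
move=> /cvgr_gt /(_ _ D2) /nbhs_ballP[e /= e0 He].
(* Both the sign of the difference quotient of [psi] and the derivative of [phi] are available up to
   [h0]. *)
pose h0 := Num.min (e / 2) (r / 2).
have h00 : 0 < h0 by rewrite lt_min !divr_gt0.
have h0r : h0 < r by rewrite gt_min; apply/orP; right; lra.
have h0e : h0 < e by rewrite gt_min; apply/orP; left; lra.
have [||c] := @MVT _ phi psi 0 h0 h00.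
- move=> h; rewrite in_itv/= => /andP[h1 h2]; apply: dphi.
  by rewrite gtr0_norm// (lt_trans h2).
- apply: derivable_within_continuous => h; rewrite in_itv/= => /andP[h1 h2].
  have hr : `|h| < r by rewrite ger0_norm// (le_lt_trans h2).
  by have := dphi _ hr => ?; exact: ex_derive.
rewrite in_itv/= subr0 => /andP[c0 ch] E.
have : 0 < c^-1 *: (psi (c *: 1 + 0) - psi 0).
  apply: He => /=; last by rewrite gt_eqF.
  by rewrite /ball/= sub0r normrN gtr0_norm// (lt_trans ch).
rewrite d1 subr0 addr0 /GRing.scale/= mulr1 pmulr_rgt0 ?invr_gt0// => psic.
have : 0 < phi h0 - phi 0 by rewrite E mulr_gt0.
rewrite subr_gt0 ltNge => /negP; apply; apply: phimax.
by rewrite gtr0_norm.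
Qed.

Section SpatialMaximum.
Context {R : realType} {d : nat}.
Implicit Types (Omega : set 'rV[R]_d) (w : 'rV[R]_d -> R) (x y v : 'rV[R]_d).

Let dir (k : 'I_d) : 'rV[R]_d := delta_mx 0 k.

Lemma is_derive_line w x v (h : R) : derivable w (h *: v + x) v ->
  is_derive h 1 (fun h : R => w (h *: v + x)) ('D_v w (h *: v + x)).
Proof.
move=> dw; pose q := fun k : R => k^-1 *: (w (k *: v + (h *: v + x)) - w (h *: v + x)).
have qE : (fun k : R => k^-1 *: (((fun h : R => w (h *: v + x)) \o shift h) (k *: 1)
    - w (h *: v + x))) = q.
  apply/funext => k; rewrite /q /=.
  have -> : k%:A = k :> R by rewrite /GRing.scale/= mulr1.
  by rewrite scalerDl addrA.
split; first by rewrite /derivable qE.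
by rewrite /derive qE.
Qed.

Lemma cvg_line x v : (h *: v + x) @[h --> (0 : R)] --> x.
Proof.
have : (h *: v + x) @[h --> (0 : R)] --> 0 *: v + x.
  by apply: cvgD; [apply: cvgZr_tmp; exact: cvg_id|exact: cvg_cst].
by rewrite scale0r add0r.
Qed.

Lemma nbhs_line (P : set 'rV[R]_d) x v : nbhs x P ->
  exists2 r : R, 0 < r & forall h, `|h| < r -> P (h *: v + x).
Proof.
move=> /(cvg_line v) /nbhs_ballP[r /= r0 Hr]; exists r => // h hr.
by apply: Hr; rewrite /ball/= sub0r normrN.
Qed.

Lemma partial_at_max Omega w x k : open Omega -> C2_on Omega w -> Omega x ->
  (forall y, Omega y -> w y <= w x) ->
  partial k w x = 0 /\ partial k (partial k w) x <= 0.
Proof.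
move=> oO C2 Ox wmax.
have [r r0 Hr] := nbhs_line (dir k) (open_nbhs_nbhs (conj oO Ox)).
have [dphi1 dphi2] := C2 _ Ox.
have H := @derive2_at_max R (fun h : R => w (h *: dir k + x))
  (fun h : R => partial k w (h *: dir k + x)) r (partial k (partial k w) x) r0.
have E : 0 *: dir k + x = x by rewrite scale0r add0r.
rewrite E in H; apply: H.
- by move=> h /Hr /C2[_ /(_ k)[hp _ _]]; exact: is_derive_line.
- have := dphi2 k => -[_ _ /(_ k)[hp _]].
  by have := @is_derive_line (partial k w) x (dir k) 0; rewrite E; apply.
- by move=> h /Hr/wmax.
Qed.

(** At the maximum the drift terms vanish and the diffusion terms are nonnegative, which leaves the
    zeroth-order term. *)
Lemma elliptic_at_max Omega (a b : 'I_d -> 'rV[R]_d -> R) c w x (lam : R) :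
  open Omega -> C2_on Omega w -> Omega x -> (forall y, Omega y -> w y <= w x) ->
  (forall k, 0 < a k x) -> lam <= c x -> 0 <= w x ->
  lam * w x <= elliptic a b c w x.
Proof.
move=> oO C2 Ox wmax a0 lc w0; rewrite /elliptic -[leLHS]add0r.
apply: lerD; last exact: ler_wpM2r.
apply: sumr_ge0 => k _; have [-> D2] := partial_at_max k oO C2 Ox wmax.
by rewrite mulr0 addr0 mulNr -mulrN mulr_ge0 ?(ltW (a0 k))// oppr_ge0.
Qed.

Lemma partial_lin (q : R) w1 w2 k x : has_partial k w1 x -> has_partial k w2 x ->
  has_partial k (fun y => q * w1 y + w2 y) x /\
  partial k (fun y => q * w1 y + w2 y) x = q * partial k w1 x + partial k w2 x.
Proof.
move=> h1 h2.
have h3 : derivable (q *: w1) x (dir k) by exact: (@derivableZ _ _ _ w1 q x (dir k) h1).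
have H := deriveD h3 h2; have H1 := @deriveZ _ _ _ w1 q x (dir k) h1.
split; first exact: (derivableD h3 h2).
by rewrite H1 in H; exact: H.
Qed.

Lemma partial_near k w1 w2 x : (\forall y \near x, w1 y = w2 y) ->
  has_partial k w1 x ->
  has_partial k w2 x /\ partial k w2 x = partial k w1 x.
Proof.
move=> w12 h1.
split; first exact: (near_eq_derivable w12 h1).
by apply/esym; exact: near_eq_derive w12.
Qed.

(** [Omega] being open, the formula for first derivatives holds near each point, and can therefore
    be differentiated once more. *)
Lemma C2_on_lin Omega (q : R) w1 w2 : open Omega ->
  C2_on Omega w1 -> C2_on Omega w2 ->
  C2_on Omega (fun y => q * w1 y + w2 y) /\
  forall k x, Omega x ->
    partial k (fun y => q * w1 y + w2 y) x = q * partial k w1 x + partial k w2 x /\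
    forall j, partial j (partial k (fun y => q * w1 y + w2 y)) x =
      q * partial j (partial k w1) x + partial j (partial k w2) x.
Proof.
move=> oO C1 C2.
pose w3 := fun y => q * w1 y + w2 y; rewrite -/w3.
have p1 k x : Omega x -> has_partial k w3 x /\
    partial k w3 x = q * partial k w1 x + partial k w2 x.
  by move=> Ox; have [_ /(_ k)[? _ _]] := C1 _ Ox; have [_ /(_ k)[? _ _]] := C2 _ Ox;
    exact: partial_lin.
have near1 k x : Omega x ->
    \forall y \near x, q * partial k w1 y + partial k w2 y = partial k w3 y.
  move=> Ox; apply: filterS (open_nbhs_nbhs (conj oO Ox)) => y Oy.
  by have [_ ->] := p1 k y Oy.
have p2 k j x : Omega x -> has_partial j (partial k w3) x /\
    partial j (partial k w3) x = q * partial j (partial k w1) x + partial j (partial k w2) x.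
  move=> Ox; have [_ /(_ k)[_ _ /(_ j)[h1 _]]] := C1 _ Ox.
  have [_ /(_ k)[_ _ /(_ j)[h2 _]]] := C2 _ Ox.
  have [h3 <-] := partial_lin q h1 h2.
  exact: (partial_near (near1 k x Ox) h3).
have near2 k j x : Omega x -> \forall y \near x,
    q * partial j (partial k w1) y + partial j (partial k w2) y = partial j (partial k w3) y.
  move=> Ox; apply: filterS (open_nbhs_nbhs (conj oO Ox)) => y Oy.
  by have [_ ->] := p2 k j y Oy.
have clin (f1 f2 f3 : 'rV[R]_d -> R) x : (\forall y \near x, q * f1 y + f2 y = f3 y) ->
    {for x, continuous f1} -> {for x, continuous f2} -> {for x, continuous f3}.
  move=> n3 c1 c2; rewrite /prop_for /continuous_at -(nbhs_singleton n3).
  exact: (cvg_trans (near_eq_cvg n3) (cvgD (cvgM (cvg_cst q) c1) c2)).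
split => [x Ox|k x Ox]; last first.
  by split => [|j]; [have [] := p1 k x Ox|have [] := p2 k j x Ox].
have [c1 H1] := C1 _ Ox; have [c2 H2] := C2 _ Ox.
have n0 : \forall y \near x, q * w1 y + w2 y = w3 y.
  by apply: filterS (open_nbhs_nbhs (conj oO Ox)) => y _.
split; first exact: (clin _ _ _ _ n0 c1 c2).
move=> k; have [_ c1k H1k] := H1 k; have [_ c2k H2k] := H2 k.
split; [by have [] := p1 k x Ox|exact: (clin _ _ _ _ (near1 k x Ox))|].
move=> j; have [_ c1j] := H1k j; have [_ c2j] := H2k j.
by split; [have [] := p2 k j x Ox|exact: (clin _ _ _ _ (near2 k j x Ox))].
Qed.

Lemma elliptic_lin Omega (a b : 'I_d -> 'rV[R]_d -> R) c (q : R) w1 w2 x :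
  open Omega -> C2_on Omega w1 -> C2_on Omega w2 -> Omega x ->
  elliptic a b c (fun y => q * w1 y + w2 y) x =
  q * elliptic a b c w1 x + elliptic a b c w2 x.
Proof.
move=> oO C1 C2 Ox.
have [_ P] := C2_on_lin q oO C1 C2.
rewrite /elliptic [in RHS]mulrDr [in RHS]addrACA mulr_sumr -big_split/=; congr (_ + _); last by ring.
apply: eq_bigr => k _; have [-> /(_ k) ->] := P k x Ox.
move: (partial k (partial k w1) x) (partial k (partial k w2) x)
  (partial k w1 x) (partial k w2 x) => p1 p2 p3 p4.
by ring.
Qed.

Lemma ellipticB Omega (a b : 'I_d -> 'rV[R]_d -> R) c w1 w2 x : open Omega ->
  C2_on Omega w1 -> C2_on Omega w2 -> Omega x ->
  elliptic a b c (fun y => w1 y - w2 y) x = elliptic a b c w1 x - elliptic a b c w2 x.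
Proof.
move=> oO C1 C2 Ox.
have -> : (fun y => w1 y - w2 y) = (fun y => -1 * w2 y + w1 y).
  by apply/funext => y; rewrite mulN1r addrC.
by rewrite (elliptic_lin _ _ _ _ oO C2 C1 Ox) mulN1r addrC.
Qed.

Lemma ellipticN Omega (a b : 'I_d -> 'rV[R]_d -> R) c w x : open Omega ->
  C2_on Omega w -> Omega x ->
  elliptic a b c (fun y => - w y) x = - elliptic a b c w x.
Proof.
move=> oO C2 Ox.
(* This makes negation an instance of the linear-combination lemma with [w] as its only function. *)
have -> : (fun y => - w y) = (fun y => (-2) * w y + w y).
  by apply/funext => y; ring.
by rewrite (elliptic_lin _ _ _ _ oO C2 C2 Ox); ring.
Qed.

Lemma C2_onB Omega w1 w2 : open Omega -> C2_on Omega w1 -> C2_on Omega w2 ->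
  C2_on Omega (fun y => w1 y - w2 y).
Proof.
move=> oO C1 C2.
have -> : (fun y => w1 y - w2 y) = (fun y => -1 * w2 y + w1 y).
  by apply/funext => y; rewrite mulN1r addrC.
by have [] := C2_on_lin (-1) oO C2 C1.
Qed.

Lemma C2_onN Omega w : open Omega -> C2_on Omega w -> C2_on Omega (fun y => - w y).
Proof.
move=> oO C2.
have -> : (fun y => - w y) = (fun y => (-2) * w y + w y).
  by apply/funext => y; ring.
by have [] := C2_on_lin (-2) oO C2 C2.
Qed.

Lemma continuous_elliptic Omega (a b : 'I_d -> 'rV[R]_d -> R) c w x :
  open Omega -> C2_on Omega w -> Omega x ->
  (forall k, {within closure Omega, continuous (a k)}) ->
  (forall k, {within closure Omega, continuous (b k)}) ->
  {within closure Omega, continuous c} ->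
  {for x, continuous (elliptic a b c w)}.
Proof.
move=> oO C2 Ox ha hb hc.
have cO (g : 'rV[R]_d -> R) : {within closure Omega, continuous g} -> {for x, continuous g}.
  move=> /(continuous_subspaceW (@subset_closure _ Omega)).
  by rewrite continuous_open_subspace// => /(_ x (mem_set Ox)).
have contM (f g : 'rV[R]_d -> R) : {for x, continuous f} -> {for x, continuous g} ->
    {for x, continuous (fun y => f y * g y)} by move=> cf cg; exact: (cvgM cf cg).
have contD (f g : 'rV[R]_d -> R) : {for x, continuous f} -> {for x, continuous g} ->
    {for x, continuous (fun y => f y + g y)} by move=> cf cg; exact: (cvgD cf cg).
have contN (f : 'rV[R]_d -> R) : {for x, continuous f} ->
    {for x, continuous (fun y => - f y)} by move=> cf; exact: (cvgN cf).
have [cw H] := C2 _ Ox.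
apply: (contD); last by apply: (contM) => //; exact: cO.
pose F k y := - a k y * partial k (partial k w) y + b k y * partial k w y.
have cF : forall k, {for x, continuous (F k)}.
  move=> k; have [_ ck /(_ k)[_ ckk]] := H k.
  by apply: (contD); apply: (contM) => //; [apply: (contN)|]; exact: cO.
change ({for x, continuous (fun y => \sum_(k < d) F k y)}).
move: F cF => F cF; elim: (index_enum _) => [|k s IH].
  rewrite (_ : (fun y => _) = fun=> 0); first exact: cst_continuous.
  by apply/funext => y; rewrite big_nil.
rewrite (_ : (fun y => _) = fun y => F k y + \sum_(i <- s) F i y); first exact: contD.
by apply/funext => y; rewrite big_cons.
Qed.

End SpatialMaximum.

(** * The Caputo derivative *)

Local Opaque Gamma.

Section CaputoCalculus.
Context {R : realType}.
Local Notation mu := (@lebesgue_measure R).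
Variables (al : R) (hal0 : 0 < al) (hal1 : al < 1).
Implicit Types (v w z : R -> R) (t T K M N s x y e eps k p : R).

Lemma integrable_EFinZl (D : set R) k (f : R -> R) : measurable D ->
  mu.-integrable D (EFin \o f) -> mu.-integrable D (EFin \o (fun x => k * f x)).
Proof.
move=> mD fi; rewrite (_ : _ \o _ = (fun x => k%:E * (EFin \o f) x)%E)//.
exact: integrableZl.
Qed.

(** The one-sided Lipschitz bound at the endpoint [t] makes the integrand of [caputo] of order
    (t-s)^(-al), which is integrable. *)
Definition caputo_at v t : Prop :=
  measurable_fun `]0, t[ v /\
  exists K, forall s, 0 < s -> s < t -> `|v t - v s| <= K * (t - s).

Definition caputo_class T v : Prop :=
  (exists M, forall t, 0 <= t -> t <= T -> `|v t| <= M) /\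
  forall eps, 0 < eps -> exists K, forall s1 s2,
    eps <= s1 -> s1 <= T -> eps <= s2 -> s2 <= T ->
    `|v s1 - v s2| <= K * `|s1 - s2|.

Let Gal0 : 0 < (Gamma (1 - al))^-1.
Proof. by rewrite invr_gt0 Gamma_gt0// subr_gt0. Qed.

Let ker t s := al * (t - s) `^ (- al - 1).

Let ker_ge0 t s : 0 <= ker t s.
Proof. by rewrite mulr_ge0 ?powR_ge0 ?ltW. Qed.

Let kerM t s p : s < t -> ker t s * (t - s) `^ p = al * (t - s) `^ (p - al - 1).
Proof.
move=> st; rewrite -mulrA -powRD; first by congr (_ * _ `^ _); ring.
by rewrite subr_eq0 (gt_eqF st) implybT.
Qed.

Let measurable_ker t v : measurable_fun `]0, t[ v ->
  measurable_fun `]0, t[ (fun s => ker t s * (v t - v s)).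
Proof.
move=> mv; apply: measurable_realfun.measurable_funM.
  by apply: measurable_realfun.measurable_funM => //; exact: measurable_powR_subr.
exact: measurable_funB.
Qed.

Lemma integrable_powR_subr (t p : R) : 0 < p -> 0 < t ->
  mu.-integrable `]0, t[ (EFin \o (fun s => (t - s) `^ (p - 1))).
Proof.
move=> p0 t0; apply/integrableP; split.
  by apply/measurable_EFinP; exact: measurable_powR_subr.
under eq_integral => s _ do rewrite /= ger0_norm ?powR_ge0//.
by rewrite integral_powR_subr// ltry.
Qed.

Lemma Rintegral_powR_subr (t p : R) : 0 < p -> 0 < t ->
  \int[mu]_(s in `]0, t[) (t - s) `^ (p - 1) = t `^ p / p.
Proof. by move=> p0 t0; rewrite /Rintegral integral_powR_subr// subr0. Qed.

Lemma caputo_integrable v t : 0 < t -> caputo_at v t ->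
  mu.-integrable `]0, t[ (EFin \o (fun s => al * (t - s) `^ (- al - 1) * (v t - v s))).
Proof.
move=> t0 [mv [K HK]].
have al1 : 0 < 1 - al by rewrite subr_gt0.
have : mu.-integrable `]0, t[
    (EFin \o (fun s => al * K * (t - s) `^ (1 - al - 1))).
  by apply: integrable_EFinZl; [exact: measurable_itv|exact: integrable_powR_subr].
apply: le_integrable; first exact: measurable_itv.
- by apply/measurable_EFinP; exact: measurable_ker.
- move=> s; rewrite /= in_itv/= => /andP[s0 st].
  rewrite lee_fin normrM (ger0_norm (ker_ge0 t s)) [leRHS]ger0_norm; last first.
    rewrite !mulr_ge0 ?powR_ge0 ?(ltW hal0)//.
    have := le_trans (normr_ge0 _) (HK _ s0 st).
    by rewrite pmulr_lge0// subr_gt0.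
  apply: le_trans (ler_wpM2l (ker_ge0 t s) (HK _ s0 st)) _.
  have ts0 : 0 <= t - s by rewrite subr_ge0 ltW.
  rewrite mulrCA -[X in _ * (_ * X) <= _](powRr1 ts0) kerM//.
  by rewrite mulrA [K * al]mulrC.
Qed.

Lemma caputo_at_lin k v w t : caputo_at v t -> caputo_at w t ->
  caputo_at (fun s => k * v s + w s) t.
Proof.
move=> [mv [K HK]] [mw [L HL]]; split.
  by apply: measurable_realfun.measurable_funD => //; exact: measurable_realfun.measurable_funM.
exists (`|k| * K + L) => s s0 st.
rewrite opprD addrACA -mulrBr mulrDl; apply: le_trans (ler_normD _ _) _.
by rewrite lerD ?HL// normrM -mulrA ler_wpM2l ?HK.
Qed.

Lemma caputo_lin k v w t : 0 < t -> caputo_at v t -> caputo_at w t ->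
  caputo al (fun s => k * v s + w s) t = k * caputo al v t + caputo al w t.
Proof.
move=> t0 hv hw; rewrite /caputo.
have iv := caputo_integrable t0 hv; have iw := caputo_integrable t0 hw.
rewrite (_ : \int[mu]_(s in `]0, t[) _ =
    k * (\int[mu]_(s in `]0, t[) (al * (t - s) `^ (- al - 1) * (v t - v s))) +
    \int[mu]_(s in `]0, t[) (al * (t - s) `^ (- al - 1) * (w t - w s))).
  by ring.
have mI : measurable `]0, t[%classic by exact: measurable_itv.
transitivity (\int[mu]_(s in `]0, t[) (k * (al * (t - s) `^ (- al - 1) * (v t - v s)) +
    al * (t - s) `^ (- al - 1) * (w t - w s))).
  by apply: eq_Rintegral => s _; ring.
have ikv : mu.-integrable `]0, t[
    (EFin \o (fun s => k * (al * (t - s) `^ (- al - 1) * (v t - v s)))).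
  exact: integrable_EFinZl.
by rewrite RintegralD// RintegralZl.
Qed.

Lemma caputoB v w t : 0 < t -> caputo_at v t -> caputo_at w t ->
  caputo al (fun s => v s - w s) t = caputo al v t - caputo al w t.
Proof.
move=> t0 hv hw; rewrite addrC -mulN1r -caputo_lin//.
by congr (caputo _ _ _); apply/funext => s; rewrite mulN1r addrC.
Qed.

(** The Caputo derivative puts nonnegative weights on the increments from the past to [t]. *)
Lemma le_caputo v w t : 0 < t -> caputo_at v t -> caputo_at w t ->
  (forall s, 0 <= s -> s < t -> v t - v s <= w t - w s) ->
  caputo al v t <= caputo al w t.
Proof.
move=> t0 hv hw vw; rewrite /caputo (ler_pM2l Gal0).
apply: lerD; first by rewrite ler_wpM2l ?powR_ge0// vw.
apply: le_Rintegral.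
- exact: measurable_itv.
- exact: caputo_integrable.
- exact: caputo_integrable.
- move=> s; rewrite /= in_itv/= => /andP[s0 st].
  by apply: ler_wpM2l; [exact: ker_ge0|apply: vw => //; exact: ltW].
Qed.

(** At a maximum over the past the integral part is nonnegative. The surviving boundary term gives
    strict positivity as soon as v 0 < v t. *)
Lemma caputo_ge v t : 0 < t -> (forall s, 0 <= s -> s < t -> v s <= v t) ->
  (Gamma (1 - al))^-1 * (t `^ (- al) * (v t - v 0)) <= caputo al v t.
Proof.
move=> t0 vmax; rewrite /caputo (ler_pM2l Gal0).
rewrite lerDl; apply: Rintegral_ge0 => s; rewrite /= in_itv/= => /andP[s0 st].
by apply: mulr_ge0; [exact: ker_ge0|rewrite subr_ge0 vmax// ltW].
Qed.

Lemma caputo_class_continuous T v x : caputo_class T v -> 0 < x -> x < T ->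
  {for x, continuous v}.
Proof.
move=> [_ H] x0 xT.
have x20 : 0 < x / 2 by rewrite divr_gt0.
have [K HK] := H _ x20.
apply/cvgrPdist_le => e e0; near=> y.
have y1 : x / 2 <= y by apply: ltW; near: y; apply: lt_nbhsr; lra.
have y2 : y <= T by apply: ltW; near: y; exact: lt_nbhsl.
apply: (@le_trans _ _ ((`|K| + 1) * `|x - y|)).
  apply: le_trans (HK _ _ _ _ _ _) _ => //; [lra|exact: ltW|].
  by rewrite ler_wpM2r// (le_trans (ler_norm K))// lerDl.
rewrite mulrC -ler_pdivlMr; last by rewrite ltr_wpDl.
by near: y; apply: cvgr_dist_le; [exact: cvg_id|rewrite divr_gt0// ltr_wpDl].
Unshelve. all: by end_near. Qed.

Lemma caputo_class_at T v t : caputo_class T v -> 0 < t -> t <= T -> caputo_at v t.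
Proof.
move=> hv t0 tT; split.
  apply: open_continuous_measurable_fun; first exact: interval_open.
  move=> x /set_mem/=; rewrite in_itv/= => /andP[x0 xt].
  by apply: (caputo_class_continuous hv) => //; exact: lt_le_trans tT.
have [[M HM] H] := hv.
have t20 : 0 < t / 2 by rewrite divr_gt0.
have [K HK] := H _ t20.
(* For s >= t/2 use the Lipschitz constant on [t/2, T]. For s < t/2 the increment is at most 2M
   while t - s > t/2, whence 4M/t. *)
exists (`|K| + 4 * M / t) => s s0 st.
have M0 : 0 <= M by apply: le_trans (normr_ge0 _) (HM t _ _) => //; exact: ltW.
have [st2|st2] := leP (t / 2) s.
  apply: le_trans (HK _ _ _ _ _ _) _ => //; try lra.
  rewrite ger0_norm; last lra.
  rewrite ler_wpM2r ?subr_ge0 ?(ltW st)// (le_trans (ler_norm K))// lerDl.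
  by rewrite divr_ge0 ?mulr_ge0// ltW.
apply: (@le_trans _ _ (2 * M)).
  apply: le_trans (ler_normB _ _) _; rewrite mulr_natl mulr2n.
  by apply: lerD; apply: HM; lra.
rewrite [leRHS]mulrDl; apply: (@le_trans _ _ (4 * M / t * (t / 2))).
  by rewrite le_eqVlt; apply/orP; left; apply/eqP; field; rewrite gt_eqF.
apply: (@le_trans _ _ (4 * M / t * (t - s))).
  by rewrite ler_wpM2l ?divr_ge0 ?mulr_ge0 ?(ltW t0)//; lra.
by rewrite lerDr mulr_ge0// subr_ge0 ltW.
Qed.

Lemma caputo_class_lin k T v w : caputo_class T v -> caputo_class T w ->
  caputo_class T (fun s => k * v s + w s).
Proof.
move=> [[M HM] Hv] [[N HN] Hw]; split.
  exists (`|k| * M + N) => t t0 tT; apply: le_trans (ler_normD _ _) _.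
  by rewrite lerD ?HN// normrM ler_wpM2l// HM.
move=> eps e0; have [K HK] := Hv _ e0; have [L HL] := Hw _ e0.
exists (`|k| * K + L) => s1 s2 ? ? ? ?.
rewrite opprD addrACA -mulrBr mulrDl; apply: le_trans (ler_normD _ _) _.
by rewrite lerD ?HL// normrM -mulrA ler_wpM2l ?HK.
Qed.

Lemma caputo_classW T T' v : T' <= T -> caputo_class T v -> caputo_class T' v.
Proof.
move=> TT [[M HM] H]; split.
  by exists M => t t0 tT; apply: HM => //; exact: le_trans TT.
move=> eps /H[K HK]; exists K => s1 s2 ? ? ? ?.
by apply: HK => //; exact: le_trans TT.
Qed.

(** For a <= b this is the 1-Lipschitz retraction onto [a, b]; composing with it makes a function
    that is Lipschitz on [a, b] globally Lipschitz. *)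
Definition clamp (a b x : R) := Num.max a (Num.min b x).

Lemma clamp_id a b x : a <= x -> x <= b -> clamp a b x = x.
Proof. by move=> ax xb; rewrite /clamp (min_idPr xb) (max_idPr ax). Qed.

Lemma clamp_ge a b x : a <= clamp a b x.
Proof. by rewrite /clamp le_max lexx. Qed.

Lemma clamp_le a b x : a <= b -> clamp a b x <= b.
Proof. by move=> ab; rewrite /clamp ge_max ab ge_min lexx. Qed.

Lemma clamp_nd a b : {homo clamp a b : x y / x <= y}.
Proof.
move=> x y xy; rewrite /clamp.
case: (leP b x) => ?; case: (leP b y) => ?;
  case: (leP a b) => ?; case: (leP a x) => ?; case: (leP a y) => ?; lra.
Qed.

Lemma clamp_dist a b x y : `|clamp a b x - clamp a b y| <= `|x - y|.
Proof.
wlog xy : x y / x <= y => [hw|].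
  by have [/hw//|/ltW/hw] := leP x y; rewrite distrC [leRHS]distrC.
have := clamp_nd a b xy => cxy.
rewrite distrC [leRHS]distrC !ger0_norm ?subr_ge0//.
move: cxy; rewrite /clamp.
case: (leP b x) => ?; case: (leP b y) => ?;
  case: (leP a b) => ?; case: (leP a x) => ?; case: (leP a y) => ?; lra.
Qed.

Lemma lipschitz_continuous (f : R -> R) K :
  (forall x y, `|f x - f y| <= K * `|x - y|) -> continuous f.
Proof.
move=> HK x; apply/cvgrPdist_le => e e0; near=> y.
apply: (@le_trans _ _ ((`|K| + 1) * `|x - y|)).
  apply: le_trans (HK _ _) _.
  by rewrite ler_wpM2r// (le_trans (ler_norm K))// lerDl.
rewrite mulrC -ler_pdivlMr; last by rewrite ltr_wpDl.
by near: y; apply: cvgr_dist_le; [exact: cvg_id|rewrite divr_gt0// ltr_wpDl].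
Unshelve. all: by end_near. Qed.

(** A positive value of [z] would give a positive maximum on [e/2, T]. As z <= 0 before [e], it is a
    maximum over the whole past, and [caputo_ge] makes the left-hand side strictly positive there.
    The sign condition before [e] stands in for continuity at 0, where [z] may jump. *)
Lemma caputo_comparison T lam z e : caputo_class T z -> 0 <= lam -> 0 < e ->
  (forall t, 0 <= t -> t < e -> z t <= 0) ->
  (forall t, 0 < t -> t <= T -> 0 < z t -> caputo al z t + lam * z t <= 0) ->
  forall t, 0 <= t -> t <= T -> z t <= 0.
Proof.
move=> hz lam0 e0 ze cz t1 t10 t1T; rewrite leNgt; apply/negP => zt1.
have et1 : e <= t1 by rewrite leNgt; apply/negP => /(ze _ t10); lra.
have e20 : 0 < e / 2 by rewrite divr_gt0.
have eT : e / 2 <= T by lra.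
have [_ /(_ _ e20)[K HK]] := hz.
pose zc x := z (clamp (e / 2) T x).
have czc : continuous zc.
  apply: (@lipschitz_continuous _ `|K|) => x y.
  apply: le_trans (HK _ _ _ _ _ _) _; rewrite ?clamp_ge ?clamp_le//.
  apply: le_trans (ler_wpM2r _ (ler_norm K)) _ => //.
  by rewrite ler_wpM2l// clamp_dist.
have [c cI cmax] := @EVT_max _ zc (e / 2) T eT (continuous_subspaceT czc).
move: cI; rewrite in_itv/= => /andP[ec cT].
have zcE x : e / 2 <= x -> x <= T -> zc x = z x.
  by move=> ? ?; rewrite /zc clamp_id.
have cM x : e / 2 <= x -> x <= T -> z x <= z c.
  by move=> ? ?; have := cmax x; rewrite in_itv/= !zcE//; apply; apply/andP.
have zc0 : 0 < z c by apply: (lt_le_trans zt1); apply: cM; lra.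
have c0 : 0 < c by lra.
have := cz _ c0 cT zc0; apply/negP; rewrite -ltNge.
apply: ltr_wpDr; first by rewrite mulr_ge0// ltW.
apply: lt_le_trans (caputo_ge c0 _); last first.
  move=> s s0 sc; have [se|se] := ltP s e; last by apply: cM; lra.
  by apply: le_trans (ze _ s0 se) _; exact: ltW.
rewrite mulr_gt0 ?invr_gt0 ?Gamma_gt0 ?subr_gt0// mulr_gt0 ?powR_gt0//.
by rewrite subr_gt0; apply: le_lt_trans zc0; exact: ze.
Qed.

(* Interpolation [min(eta, K r) <= eta^(1-th) (K r)^th] with [al < th < 1] keeps
   the singular kernel integrable while gaining a power of [eta]. *)
Lemma caputo_small t K e : 0 < t -> 0 <= K -> 0 < e ->
  exists2 eta, 0 < eta & forall w, measurable_fun `]0, t[ w ->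
    (forall s, 0 <= s -> s < t -> `|w t - w s| <= eta /\ `|w t - w s| <= K * (t - s)) ->
    `|caputo al w t| <= e.
Proof.
move=> t0 K0 e0.
pose th := (1 + al) / 2.
have th0 : 0 < th by rewrite /th; have := hal0; have := hal1; lra.
have th1 : 0 < 1 - th by rewrite /th; have := hal0; have := hal1; lra.
have tha : 0 < th - al by rewrite /th; have := hal0; have := hal1; lra.
pose G := (Gamma (1 - al))^-1.
have G0 : 0 < G by rewrite invr_gt0 Gamma_gt0 ?subr_gt0.
pose A := t `^ (- al); pose B := al * K `^ th * (t `^ (th - al) / (th - al)).
have A0 : 0 <= A by exact: powR_ge0.
have B0 : 0 <= B.
  by rewrite !mulr_ge0 ?powR_ge0 ?ltW// invr_gt0.
pose C := G * (A + B) + 1.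
have C0 : 0 < C by rewrite ltr_wpDl// mulr_ge0 ?addr_ge0// ltW.
(* This gives eta^(1-th) <= e/C. Moreover eta <= 1 gives eta <= eta^(1-th), so the boundary term
   obeys the same bound as the integral. *)
pose eta := Num.min 1 ((e / C) `^ (1 - th)^-1).
have eC : 0 < e / C by rewrite divr_gt0.
have eta0 : 0 < eta by rewrite lt_min ltr01 powR_gt0.
have eta1 : eta <= 1 by rewrite ge_min lexx.
have etaC : eta `^ (1 - th) <= e / C.
  apply: (@le_trans _ _ (((e / C) `^ (1 - th)^-1) `^ (1 - th))).
    by rewrite ge0_ler_powR ?(ltW th1)// ?nnegrE ?(ltW eta0) ?powR_ge0// ge_min lexx orbT.
  by rewrite -powRrM mulVf ?gt_eqF// powRr1// ltW.
exists eta => // w mw Hw.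
have cw : caputo_at w t.
  by split => //; exists K => s s0 st; case: (Hw s (ltW s0) st).
have iw := caputo_integrable t0 cw.
have ibound : `|\int[mu]_(s in `]0, t[) (al * (t - s) `^ (- al - 1) * (w t - w s))|
    <= B * eta `^ (1 - th).
  apply: le_trans (le_normr_Rintegral _ iw) _; first exact: measurable_itv.
  have -> : B * eta `^ (1 - th) = \int[mu]_(s in `]0, t[)
      ((al * K `^ th * eta `^ (1 - th)) * (t - s) `^ (th - al - 1)).
    rewrite RintegralZl; last 2 first.
    - exact: measurable_itv.
    - exact: integrable_powR_subr.
    by rewrite Rintegral_powR_subr// /B; ring.
  apply: le_Rintegral.
  - exact: measurable_itv.
  - exact: integrable_norm.
  - by apply: integrable_EFinZl; [exact: measurable_itv|exact: integrable_powR_subr].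
  - move=> s; rewrite /= in_itv/= => /andP[s0 st].
    rewrite normrM (ger0_norm (ker_ge0 t s)).
    have [h1 h2] := Hw s (ltW s0) st.
    have ts0 : 0 <= t - s by rewrite subr_ge0 ltW.
    have d0 := normr_ge0 (w t - w s).
    have -> : al * K `^ th * eta `^ (1 - th) * (t - s) `^ (th - al - 1) =
        ker t s * (eta `^ (1 - th) * (K * (t - s)) `^ th).
      rewrite powRM//; transitivity (eta `^ (1 - th) * K `^ th * (ker t s * (t - s) `^ th)).
        by rewrite kerM//; ring.
      by ring.
    apply: ler_wpM2l; first exact: ker_ge0.
    have {1}-> : `|w t - w s| = `|w t - w s| `^ (1 - th) * `|w t - w s| `^ th.
      have [->|n0] := eqVneq `|w t - w s| 0; first by rewrite !powR0 ?mulr0 ?gt_eqF.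
      rewrite -powRD; last by rewrite n0 implybT.
      by rewrite subrK powRr1.
    have KP : 0 <= K * (t - s) by exact: mulr_ge0.
    have p1 : `|w t - w s| `^ (1 - th) <= eta `^ (1 - th).
      by apply: (ge0_ler_powR (ltW th1)); rewrite ?nnegrE//; exact: ltW.
    have p2 : `|w t - w s| `^ th <= (K * (t - s)) `^ th.
      by apply: (ge0_ler_powR (ltW th0)); rewrite ?nnegrE.
    by apply: ler_pM => //; exact: powR_ge0.
rewrite /caputo -/G normrM gtr0_norm//.
apply: (@le_trans _ _ (G * ((A + B) * eta `^ (1 - th)))).
  rewrite ler_pM2l//; apply: le_trans (ler_normD _ _) _.
  rewrite mulrDl; apply: lerD => //.
  rewrite normrM ger0_norm ?powR_ge0// ler_wpM2l//.
  have [h1 _] := Hw 0 (lexx _) t0; apply: le_trans h1 _.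
  rewrite ger1_powR// ?eta0//; by rewrite /th; have := hal0; have := hal1; lra.
rewrite mulrA; apply: (@le_trans _ _ (C * (e / C))).
  apply: ler_pM => //; rewrite ?powR_ge0// ?lerDl//.
  by rewrite mulr_ge0 ?addr_ge0// ltW.
by rewrite mulrCA divff ?mulr1// gt_eqF.
Qed.

End CaputoCalculus.

(** * The Mittag-Leffler kernel *)

Section MittagLeffler.
Context {R : realType}.
Local Notation mu := (@lebesgue_measure R).
Implicit Types (c : nat -> R) (r x t s K C : R).

(** Decay faster than every geometric rate, that is, infinite radius of convergence; this form
    passes easily to the differentiated series. *)
Definition entire_coef c : Prop :=
  forall r, 0 < r -> exists2 C, 0 <= C & forall k, `|c k| <= C * r ^+ k.

(** The factor k + 1 <= 2^k is absorbed by using the decay at rate r/2. *)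
Lemma entire_coef_diffs c : entire_coef c -> entire_coef (pseries_diffs c).
Proof.
move=> Hc r r0; have r20 : 0 < r / 2 by rewrite divr_gt0.
have [C C0 HC] := Hc _ r20; exists (C * (r / 2)); first by rewrite mulr_ge0// ltW.
move=> k; rewrite /pseries_diffs normrM normr_nat.
apply: (@le_trans _ _ (2 ^+ k * (C * (r / 2) ^+ k.+1))).
  apply: ler_pM => //; rewrite -natrX ler_nat; exact: ltn_expl.
rewrite exprS mulrCA [2 ^+ k * _]mulrCA -exprMn_comm; last exact: mulrC.
rewrite (_ : 2 * (r / 2) = r); last by field.
by rewrite mulrA.
Qed.

Lemma entire_coef_norm_cvg c K : entire_coef c -> cvgn (series (fun k => `|c k * K ^+ k|)).
Proof.
(* With this rate r |K| <= 1/2, so the terms are dominated by C 2^(-k). *)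
move=> Hc; pose r := (2 * (`|K| + 1))^-1.
have K0 : 0 < 2 * (`|K| + 1) by rewrite mulr_gt0// ltr_wpDl.
have r0 : 0 < r by rewrite invr_gt0.
have [C C0 HC] := Hc _ r0.
apply: (@series_le_cvg _ _ (geometric C (2^-1))) => [k|k|k|].
- exact: normr_ge0.
- by rewrite /geometric/= mulr_ge0// exprn_ge0.
- rewrite /geometric/= normrM normrX.
  apply: (@le_trans _ _ (C * r ^+ k * `|K| ^+ k)).
    by rewrite ler_wpM2r// exprn_ge0.
  rewrite -mulrA ler_wpM2l// -exprMn; apply: lerXn2r; rewrite ?nnegrE//.
    by rewrite mulr_ge0// ltW.
  by rewrite /r mulrC ler_pdivrMr// mulrA mulVf// mul1r lerDl.
- apply: is_cvg_geometric_series; rewrite ger0_norm//; lra.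
Qed.

Lemma entire_coef_cvg c K : entire_coef c -> cvgn (pseries c K).
Proof. by move=> Hc; apply: normed_cvg; exact: entire_coef_norm_cvg. Qed.

Lemma entire_coef_continuous c : entire_coef c -> continuous (fun x : R => limn (pseries c x)).
Proof.
move=> Hc x; apply: differentiable_continuous; apply/derivable1_diffP.
have H := @pseries_snd_diffs R c (`|x| + 1) x (@entire_coef_cvg _ _ Hc)
  (@entire_coef_cvg _ _ (entire_coef_diffs Hc))
  (@entire_coef_cvg _ _ (entire_coef_diffs (entire_coef_diffs Hc))).
have xK : `|x| < `| `|x| + 1 | by rewrite [ltRHS]ger0_norm ?addr_ge0// ltrDl.
by have := H xK => ?; exact: ex_derive.
Qed.

Variable al : R.
Hypothesis (hal0 : 0 < al).

Definition ml_coef (k : nat) : R := (Gamma (al * k%:R + al))^-1.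

Lemma ml_index_gt0 (k : nat) : 0 < al * k%:R + al.
Proof. by rewrite ltr_wpDl// mulr_ge0// ltW. Qed.

Lemma ml_coef_gt0 k : 0 < ml_coef k.
Proof. by rewrite invr_gt0 Gamma_gt0// ml_index_gt0. Qed.

(* [Gamma z >= M^(z-1) e^(-M-1) / 2] with [M^(-al) <= r]. *)
Lemma entire_ml_coef : entire_coef ml_coef.
Proof.
move=> r r0; pose M := Num.max 1 (r `^ (- al^-1)).
have M1 : 1 <= M by rewrite le_max lexx.
have M0 : 0 < M by lra.
have Mr : M `^ (- al) <= r.
  rewrite powRN invf_ple ?posrE ?powR_gt0//.
  apply: (@le_trans _ _ ((r `^ (- al^-1)) `^ al)).
    by rewrite -powRrM mulNr mulVf ?gt_eqF// powR_inv1// ltW.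
  apply: (ge0_ler_powR (ltW hal0)); rewrite ?nnegrE ?powR_ge0 ?(ltW M0)//.
  by rewrite le_max lexx orbT.
have lb z : 0 < z -> M `^ (z - 1) / 2 * expR (- (M + 1)) <= Gamma z.
  move=> z0; apply: Gamma_ge => //; [exact: ltW|by rewrite divr_ge0// powR_ge0|].
  move=> x Mx xM; have x0 : 0 < x by lra.
  have [z1|z1] := leP 1 z.
    have : M `^ (z - 1) <= x `^ (z - 1).
      apply: ge0_ler_powR; rewrite ?nnegrE; lra.
    have := powR_ge0 M (z - 1); lra.
  have z10 : 0 <= 1 - z by lra.
  rewrite (_ : z - 1 = - (1 - z)); last by ring.
  rewrite !powRN -invfM lef_pV2 ?posrE ?mulr_gt0 ?powR_gt0//.
  apply: (@le_trans _ _ ((2 * M) `^ (1 - z))).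
    apply: (ge0_ler_powR z10); rewrite ?nnegrE; lra.
  rewrite powRM ?(ltW M0)// mulrC ler_wpM2l ?powR_ge0//.
  by rewrite -[leRHS]powRr1//; apply: ler_powR; lra.
exists (2 * expR (M + 1) * M `^ (1 - al)).
  by rewrite !mulr_ge0 ?expR_ge0 ?powR_ge0.
move=> k; rewrite gtr0_norm ?ml_coef_gt0//.
apply: (@le_trans _ _ (2 * expR (M + 1) * M `^ (1 - al) * (M `^ (- al)) ^+ k)); last first.
  rewrite ler_wpM2l ?mulr_ge0 ?expR_ge0 ?powR_ge0//.
  by apply: lerXn2r; rewrite ?nnegrE ?powR_ge0// ltW.
have := lb _ (ml_index_gt0 k).
have P0 : 0 < M `^ (al * k%:R + al - 1) / 2 * expR (- (M + 1)).
  by rewrite mulr_gt0 ?expR_gt0// divr_gt0 ?powR_gt0.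
rewrite -lef_pV2 ?posrE ?Gamma_gt0 ?ml_index_gt0// => /le_trans; apply.
rewrite le_eqVlt; apply/orP; left; apply/eqP.
rewrite !invfM invrK -powRN -expRN opprK.
rewrite -powR_mulrn ?powR_ge0// -powRrM.
rewrite (_ : - (al * k%:R + al - 1) = (1 - al) + (- al * k%:R)); last by ring.
rewrite powRD; last by rewrite (gt_eqF M0) implybT.
by ring.
Qed.

Lemma ml_cvg x : cvgn (pseries ml_coef x).
Proof. exact: entire_coef_cvg entire_ml_coef. Qed.

Lemma ml_continuous : continuous (mittag_leffler al al).
Proof. exact: entire_coef_continuous entire_ml_coef. Qed.

(** The coefficients are positive, so the full sum at [y] bounds every partial sum at [x]. It is the
    majorant, independent of [n], for dominated convergence in [volterra]. *)
Lemma ml_partial_le (n : nat) x y : `|x| <= y ->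
  `|pseries ml_coef x n| <= mittag_leffler al al y.
Proof.
move=> xy; have y0 : 0 <= y by exact: le_trans xy.
apply: (@le_trans _ _ (pseries ml_coef y n)).
  rewrite /pseries /series/=; apply: le_trans (ler_norm_sum _ _ _) _.
  apply: ler_sum => k _; rewrite normrM (gtr0_norm (ml_coef_gt0 k)) normrX.
  rewrite ler_wpM2l ?(ltW (ml_coef_gt0 k))//.
  by apply: lerXn2r; rewrite ?nnegrE.
rewrite -[mittag_leffler al al y]/(limn (pseries ml_coef y)).
apply: nondecreasing_cvgn_le; last exact: ml_cvg.
apply: nondecreasing_series => k _ _.
by rewrite mulr_ge0 ?exprn_ge0// ltW// ml_coef_gt0.
Qed.

Lemma ml0 : mittag_leffler al al 0 = (Gamma al)^-1.
Proof.
rewrite /mittag_leffler; apply/cvg_lim => //.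
apply: cvg_trans (_ : (fun n : nat => (Gamma al)^-1) @ \oo --> _); last exact: cvg_cst.
apply: near_eq_cvg; exists 1%N => // -[//|n] _; rewrite /series/=.
rewrite big_nat_recl// big1 => [|k _]; last by rewrite expr0n/= mulr0.
by rewrite expr0 mulr1 addr0 mulr0 add0r.
Qed.

End MittagLeffler.

(** * The resolvent kernel: Volterra equation, positivity, normalization *)

Section ResolventKernel.
Context {R : realType}.
Local Notation mu := (@lebesgue_measure R).
Implicit Types (a b r s t x y p : R).

Definition frac_kernel p t : R := t `^ (p - 1) / Gamma p.

Lemma frac_kernel_ge0 p t : 0 < p -> 0 <= frac_kernel p t.
Proof. by move=> p0; rewrite divr_ge0 ?powR_ge0// ltW// Gamma_gt0. Qed.

Lemma measurable_frac_kernel p D : measurable_fun D (frac_kernel p).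
Proof. by apply: measurable_funTS; apply: measurable_realfun.measurable_funM. Qed.

Lemma measurable_frac_kernel_subr p t D : measurable_fun D (fun s => frac_kernel p (t - s)).
Proof. by apply: measurable_realfun.measurable_funM => //; exact: measurable_powR_subr. Qed.

(** The semigroup law g_a * g_b = g_(a+b) of fractional integration, equivalent to the Beta
    integral. *)
Lemma integral_frac_kernel a b x : 0 < a -> 0 < b -> 0 < x ->
  (\int[mu]_(s in `]0%R, x[) (frac_kernel a (x - s) * frac_kernel b s)%:E =
   (frac_kernel (a + b) x)%:E)%E.
Proof.
move=> a0 b0 x0; have Ga := Gamma_gt0 a0; have Gb := Gamma_gt0 b0.
transitivity (\int[mu]_(s in `]0%R, x[) (((Gamma a * Gamma b)^-1)%:E *
    ((x - s) `^ (a - 1) * s `^ (b - 1))%:E))%E.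
  apply: eq_integral => s _; rewrite -EFinM /frac_kernel; congr EFin.
  rewrite invfM; move: (Gamma a)^-1 (Gamma b)^-1 => ga gb; ring.
rewrite ge0_integralZl//; last 3 first.
- apply/measurable_EFinP; apply: measurable_realfun.measurable_funM.
    exact: measurable_powR_subr.
  exact: measurable_funTS.
- by move=> s _; rewrite lee_fin mulr_ge0 ?powR_ge0.
- by rewrite lee_fin invr_ge0; exact: mulr_ge0 (ltW Ga) (ltW Gb).
rewrite integral_beta// -EFinM; congr EFin; rewrite /frac_kernel.
rewrite [LHS]mulrC -!mulrA; congr (_ * _).
have ga : Gamma a != 0 by rewrite gt_eqF.
have gb : Gamma b != 0 by rewrite gt_eqF.
move: (Gamma a) (Gamma b) (Gamma (a + b))^-1 ga gb => A B G ga gb.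
by field; rewrite ga gb.
Qed.

Lemma integrable_frac_kernel a b x : 0 < a -> 0 < b -> 0 < x ->
  mu.-integrable `]0, x[ (EFin \o (fun s => frac_kernel a (x - s) * frac_kernel b s)).
Proof.
move=> a0 b0 x0; apply/integrableP; split.
  apply/measurable_EFinP; apply: measurable_realfun.measurable_funM.
    exact: measurable_frac_kernel_subr.
  exact: measurable_frac_kernel.
apply: (@le_lt_trans _ _ (\int[mu]_(s in `]0%R, x[)
    (frac_kernel a (x - s) * frac_kernel b s)%:E)%E).
  apply: ge0_le_integral_nomeas => s _; first exact: abse_ge0.
  by rewrite /= ger0_norm// mulr_ge0// frac_kernel_ge0.
by rewrite integral_frac_kernel// ltry.
Qed.

Variables (al lam : R).
Hypotheses (hal0 : 0 < al) (hal1 : al < 1) (hlam : 0 <= lam).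

Definition res_kernel t : R := t `^ (al - 1) * mittag_leffler al al (- lam * t `^ al).

(** So [res_kernel] is the Neumann series of its Volterra equation, the sum of (-lam)^k g_((k+1)
    al). *)
Let term s k : 0 < s -> s `^ (al - 1) * (ml_coef al k * (- lam * s `^ al) ^+ k) =
  (- lam) ^+ k * frac_kernel (al * k%:R + al) s.
Proof.
move=> s0; rewrite exprMn -[(s `^ al) ^+ k]powR_mulrn ?powR_ge0// -powRrM /frac_kernel /ml_coef.
rewrite (_ : al * k%:R + al - 1 = (al - 1) + al * k%:R); last by ring.
rewrite (@powRD _ s (al - 1) (al * k%:R)); last by rewrite (gt_eqF s0) implybT.
by move: (Gamma _)^-1 (s `^ (al - 1)) (s `^ (al * _)) ((- lam) ^+ k) => g p q r; ring.
Qed.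

Let partial_sum (n : nat) s := s `^ (al - 1) * pseries (ml_coef al) (- lam * s `^ al) n.

Let partial_sumE n s : 0 < s ->
  partial_sum n s = \sum_(0 <= k < n) (- lam) ^+ k * frac_kernel (al * k%:R + al) s.
Proof.
move=> s0; rewrite /partial_sum /pseries /series/= mulr_sumr.
by apply: eq_bigr => k _; exact: term.
Qed.

Let partial_sum_cvg s : partial_sum n s @[n --> \oo] --> res_kernel s.
Proof. by apply: cvgM; [exact: cvg_cst|exact: (ml_cvg hal0)]. Qed.

Lemma measurable_res_kernel D : measurable_fun D res_kernel.
Proof.
apply: measurable_funTS; apply: measurable_realfun.measurable_funM => //.
apply: measurableT_comp.
  by apply: continuous_measurable_fun; exact: ml_continuous.
exact: measurable_realfun.measurable_funM.
Qed.

Lemma continuous_res_kernel t : 0 < t -> {for t, continuous res_kernel}.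
Proof.
move=> t0; have c1 := @continuous_powR R (al - 1) t t0.
have c2 := @continuous_powR R al t t0.
apply: (cvgM c1).
apply: (@cvg_comp _ _ _ (fun s => - lam * s `^ al) (mittag_leffler al al)
  _ (nbhs (- lam * t `^ al))); last exact: ml_continuous.
exact: (cvgM (cvg_cst (- lam)) c2).
Qed.

Lemma res_kernel_gt0_near0 : exists2 e, 0 < e & forall t, 0 < t -> t < e -> 0 < res_kernel t.
Proof.
have ml00 : 0 < mittag_leffler al al 0 by rewrite ml0// invr_gt0 Gamma_gt0.
have : \forall t \near 0^'+, 0 < mittag_leffler al al (- lam * t `^ al).
  have H : mittag_leffler al al (- lam * t `^ al) @[t --> 0^'+] --> mittag_leffler al al 0.
    apply: (@cvg_comp _ _ _ (fun s => - lam * s `^ al) (mittag_leffler al al)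
      _ (nbhs (0 : R))); last exact: ml_continuous.
    have : - lam * s `^ al @[s --> 0^'+] --> - lam * 0.
      by apply: cvgM; [exact: cvg_cst|exact: powR_cvg0].
    by rewrite mulr0.
  by move/cvgr_gt : H; apply.
move=> [e /= e0 He]; exists e => // t t0 te.
rewrite mulr_gt0 ?powR_gt0//; apply: He => //=.
by rewrite sub0r normrN gtr0_norm.
Qed.

(** By the semigroup law, convolution with g_al raises the index of every term by [al], so lam times
    the convolved series is, up to sign, the series without its first term. The sum is interchanged
    with the integral by dominated convergence, the majorant being a multiple of g_al(x-s)
    g_al(s). *)
Lemma volterra x : 0 < x ->
  mu.-integrable `]0, x[ (EFin \o (fun s => frac_kernel al (x - s) * res_kernel s)) /\
  lam * \int[mu]_(s in `]0, x[) (frac_kernel al (x - s) * res_kernel s) =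
  frac_kernel al x - res_kernel x.
Proof.
move=> x0; have mI : measurable `]0, x[%classic by exact: measurable_itv.
pose A := mittag_leffler al al (lam * x `^ al).
pose f_ (n : nat) s := (frac_kernel al (x - s) * partial_sum n s)%:E.
pose f s := (frac_kernel al (x - s) * res_kernel s)%:E.
pose g := EFin \o (fun s => (A * Gamma al) * (frac_kernel al (x - s) * frac_kernel al s)).
have mf_ n : measurable_fun `]0, x[ (f_ n).
  apply/measurable_EFinP; apply: measurable_realfun.measurable_funM.
    exact: measurable_frac_kernel_subr.
  apply: (eq_measurable_fun (fun s => \sum_(0 <= k < n) (- lam) ^+ k * frac_kernel (al * k%:R + al) s)).
    by move=> s /set_mem/=; rewrite in_itv/= => /andP[s0 _]; rewrite partial_sumE.
  apply: measurable_sum => k.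
  by apply: measurable_realfun.measurable_funM => //; exact: measurable_frac_kernel.
have mf : measurable_fun `]0, x[ f.
  apply/measurable_EFinP; apply: measurable_realfun.measurable_funM.
    exact: measurable_frac_kernel_subr.
  exact: measurable_res_kernel.
have f_cvg s : f_ n s @[n --> \oo] --> f s.
  apply: cvg_EFin; first exact: nearW.
  by apply: cvgM; [exact: cvg_cst|exact: partial_sum_cvg].
have ig : mu.-integrable `]0, x[ g.
  by apply: integrable_EFinZl => //; exact: integrable_frac_kernel.
have bnd s n : `]0, x[%classic s -> (`|f_ n s| <= g s)%E.
  rewrite /= in_itv/= => /andP[s0 sx]; rewrite lee_fin.
  have -> : A * Gamma al * (frac_kernel al (x - s) * frac_kernel al s) =
      frac_kernel al (x - s) * (s `^ (al - 1) * A).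
    have : Gamma al != 0 by rewrite gt_eqF// Gamma_gt0.
    rewrite /frac_kernel; move: (Gamma al) (A) (s `^ _) ((x - s) `^ _) => ? ? ? ? ?.
    by field.
  rewrite normrM ger0_norm ?frac_kernel_ge0// ler_wpM2l ?frac_kernel_ge0//.
  rewrite normrM ger0_norm ?powR_ge0// ler_wpM2l ?powR_ge0//.
  apply: ml_partial_le => //; rewrite normrM normrN !ger0_norm ?powR_ge0//.
  rewrite ler_wpM2l//; apply: (ge0_ler_powR (ltW hal0)); rewrite ?nnegrE ?ltW//.
have [||if_ _ If_] := @dominated_convergence _ _ _ mu _ mI f_ f g mf_ mf _ ig _.
- by apply: aeW => s _; exact: f_cvg.
- by apply: aeW => s Ds n; exact: bnd.
split; first exact: if_.
have I_n n : (\int[mu]_(s in `]0%R, x[) f_ n s =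
    (\sum_(0 <= k < n) (- lam) ^+ k * frac_kernel (al * k%:R + al + al) x)%:E)%E.
  transitivity (\int[mu]_(s in `]0%R, x[) (\sum_(0 <= k < n)
      ((- lam) ^+ k * (frac_kernel al (x - s) * frac_kernel (al * k%:R + al) s))%:E))%E.
    apply: eq_integral => s /set_mem/=; rewrite in_itv/= => /andP[s0 sx].
    rewrite /f_ partial_sumE// mulr_sumr sumEFin; congr EFin.
    by apply: eq_bigr => k _; ring.
  have ik (k : nat) : mu.-integrable `]0, x[ (EFin \o (fun s =>
      (- lam) ^+ k * (frac_kernel al (x - s) * frac_kernel (al * k%:R + al) s))).
    by apply: integrable_EFinZl => //; apply: integrable_frac_kernel => //; exact: ml_index_gt0.
  rewrite integral_sum//= -sumEFin; apply: eq_bigr => k _.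
  transitivity (((- lam) ^+ k)%:E * \int[mu]_(s in `]0%R, x[)
      (frac_kernel al (x - s) * frac_kernel (al * k%:R + al) s)%:E)%E.
    rewrite -integralZl//; apply: integrable_frac_kernel => //; exact: ml_index_gt0.
  rewrite (integral_frac_kernel hal0 (ml_index_gt0 hal0 k) x0) -EFinM.
  congr (_ * frac_kernel _ _)%:E.
  by rewrite addrC.
have step n : lam * (\sum_(0 <= k < n) (- lam) ^+ k * frac_kernel (al * k%:R + al + al) x) =
    frac_kernel al x - partial_sum n.+1 x.
  rewrite partial_sumE// big_nat_recl// expr0 mul1r mulr0 add0r opprD addNKr.
  rewrite mulr_sumr -sumrN; apply: eq_bigr => k _.
  rewrite exprS (_ : al * k.+1%:R = al * k%:R + al); first by ring.
  by rewrite -natr1 mulrDr mulr1.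
have If : (\int[mu]_(s in `]0%R, x[) f s)%E =
    (\int[mu]_(s in `]0, x[) (frac_kernel al (x - s) * res_kernel s))%:E.
  by rewrite /Rintegral fineK//; apply: integrable_fin_num.
rewrite If in If_.
have lim1 : (lam * (\sum_(0 <= k < n) (- lam) ^+ k * frac_kernel (al * k%:R + al + al) x))
    @[n --> \oo] --> lam * \int[mu]_(s in `]0, x[) (frac_kernel al (x - s) * res_kernel s).
  apply: cvgM; first exact: cvg_cst.
  have H := fine_cvg If_.
  rewrite (_ : fine \o _ = (fun n => \sum_(0 <= k < n) (- lam) ^+ k *
    frac_kernel (al * k%:R + al + al) x)) in H; last first.
    by apply/funext => n /=; rewrite I_n.
  exact: H.
have lim2 : (frac_kernel al x - partial_sum n.+1 x) @[n --> \oo] -->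
    frac_kernel al x - res_kernel x.
  apply: cvgB; first exact: cvg_cst.
  by have := @partial_sum_cvg x; rewrite -cvg_shiftS.
apply: (cvg_unique _ lim1) => //.
rewrite (_ : (fun n => _) = (fun n => frac_kernel al x - partial_sum n.+1 x))//.
by apply/funext => n; exact: step.
Qed.

Let powR_comparison s t t0 : 0 < s -> s < t -> t < t0 ->
  (t0 - s) `^ (al - 1) <= (t0 / t) `^ (al - 1) * (t - s) `^ (al - 1).
Proof.
move=> s0 st tt0; have ts : 0 < t - s by lra.
have t_gt0 : 0 < t by lra.
have tq : 0 < t0 / t by rewrite divr_gt0//; lra.
have al1 : 0 <= 1 - al by rewrite subr_ge0 ltW.
rewrite -powRM ?(ltW tq) ?(ltW ts)//.
rewrite (_ : al - 1 = - (1 - al)); last by ring.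
have p1 : 0 < t0 - s by lra.
have p2 : 0 < t0 / t * (t - s) by exact: mulr_gt0.
rewrite !powRN lef_pV2 ?posrE ?powR_gt0//.
apply: (ge0_ler_powR al1); rewrite ?nnegrE ?(ltW p1) ?(ltW p2)//.
by rewrite mulrAC ler_pdivrMr//; nra.
Qed.

Let conv x : R := \int[mu]_(s in `]0, x[) (frac_kernel al (x - s) * res_kernel s).

Let EFin_conv x : 0 < x -> (conv x)%:E =
  (\int[mu]_(s in `]0%R, x[) (frac_kernel al (x - s) * res_kernel s)%:E)%E.
Proof.
move=> x0; rewrite /conv /Rintegral fineK//.
by apply: integrable_fin_num; [exact: measurable_itv|have [] := volterra x0].
Qed.

Let measurable_conv x D :
  measurable_fun D (fun s => (frac_kernel al (x - s) * res_kernel s)%:E).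
Proof.
apply/measurable_EFinP; apply: measurable_realfun.measurable_funM.
  exact: measurable_frac_kernel_subr.
exact: measurable_res_kernel.
Qed.

(* [(t0 - s) / (t - s) >= t0 / t] compares the kernels of the two convolutions. *)
Let conv_comparison t t0 g : 0 < t -> t < t0 ->
  (forall s, 0 < s -> s < t0 -> 0 < res_kernel s) ->
  (forall s, t <= s -> s < t0 -> res_kernel s <= g) -> 0 <= g ->
  conv t0 <= (t0 / t) `^ (al - 1) * conv t + g * ((t0 - t) `^ al / al / Gamma al).
Proof.
move=> t_gt0 tt0 pos gmax g0.
have t00 : 0 < t0 by exact: lt_trans tt0.
have Gal0 : 0 <= (Gamma al)^-1 by rewrite invr_ge0 ltW// Gamma_gt0.
pose F s := (frac_kernel al (t0 - s) * res_kernel s)%:E.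
have F0 s : 0 < s -> s < t0 -> (0 <= F s)%E.
  by move=> s0 st; rewrite lee_fin mulr_ge0 ?frac_kernel_ge0// ltW// pos.
have split01 : `]0, t0[%classic = `]0, t[%classic `|` `[t, t0[%classic :> set R.
  apply/seteqP; split => y /=; rewrite !in_itv/=.
    by move=> /andP[y0 yt]; case: (ltP y t) => yt'; [left; rewrite y0|right; rewrite yt].
  move=> [/andP[y0 yt]|/andP[y0 yt]]; first by rewrite y0 (lt_trans yt).
  by rewrite yt (lt_le_trans _ y0).
rewrite -lee_fin EFinD !EFinM !EFin_conv// split01 ge0_integral_setU//=; last 3 first.
- exact: measurable_conv.
- move=> s; rewrite -/(F s) /= !in_itv/= => -[/andP[y0 yt]|/andP[y0 yt]]; apply: F0 => //.
    exact: lt_trans yt tt0.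
  exact: lt_le_trans y0.
- apply/disj_setPS => y [/=]; rewrite !in_itv/= => /andP[_ y1] /andP[y2 _].
  by move: (lt_le_trans y1 y2); rewrite ltxx.
apply: leeD.
  rewrite -ge0_integralZl//; last 3 first.
  - exact: measurable_conv.
  - move=> s; rewrite /= in_itv/= => /andP[s0 st].
    by rewrite lee_fin mulr_ge0 ?frac_kernel_ge0// ltW// pos// (lt_trans st).
  - by rewrite lee_fin powR_ge0.
  apply: ge0_le_integral_nomeas => s; rewrite /= in_itv/= => /andP[s0 st].
    by apply: F0 => //; exact: lt_trans tt0.
  have rs : 0 < res_kernel s by apply: pos => //; exact: lt_trans tt0.
  rewrite -EFinM lee_fin [leRHS]mulrA (ler_pM2r rs) /frac_kernel [leRHS]mulrA.
  by rewrite ler_wpM2r// powR_comparison.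
apply: (@le_trans _ _ (\int[mu]_(s in `[t, t0[)
    ((g / Gamma al)%:E * ((t0 - s) `^ (al - 1))%:E))%E).
  apply: ge0_le_integral_nomeas => s; rewrite /= in_itv/= => /andP[s0 st].
    by apply: F0 => //; exact: lt_le_trans s0.
  rewrite -EFinM lee_fin [leLHS]mulrC /frac_kernel [_ / _]mulrC [leLHS]mulrA.
  apply: ler_wpM2r; first exact: powR_ge0.
  by apply: ler_wpM2r => //; exact: gmax.
rewrite ge0_integralZl//; last 3 first.
- by apply/measurable_EFinP; exact: measurable_powR_subr.
- by move=> s _; rewrite lee_fin powR_ge0.
- by rewrite lee_fin mulr_ge0.
rewrite -integral_itv_obnd_cbnd; last first.
  by apply/measurable_EFinP; exact: measurable_powR_subr.
rewrite integral_powR_subr// -EFinM lee_fin.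
by rewrite -!mulrA [(Gamma al)^-1 * _]mulrC !mulrA.
Qed.

(* At the first zero [t0], let [t] maximize the kernel over [t1, t0]; comparing
   the Volterra equations at [t] and [t0] gives
   [0 >= res_kernel t0 >= res_kernel t * (1/2 - 1/4)]. *)
Let res_kernel_first_zero t0 : 0 < t0 ->
  (forall t, 0 < t -> t < t0 -> 0 < res_kernel t) -> 0 < res_kernel t0.
Proof.
move=> t00 pos; rewrite ltNge; apply/negP => Gt0.
have Gal := Gamma_gt0 hal0.
(* [r] is chosen so that B (t0-t)^al <= 1/4 whenever t0 - t <= r, and t1 >= t0/2 so that
   (t0/t)^(al-1) >= 1/2. *)
pose B := lam / al / Gamma al.
have B0 : 0 <= B by rewrite !divr_ge0// ltW.
have B1 : 0 < B + 1 by rewrite ltr_wpDl.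
pose r := (4^-1 / (B + 1)) `^ al^-1.
have r0 : 0 < r by rewrite powR_gt0// divr_gt0.
have [t1 [t12 t1t0 t1r]] : exists t1, [/\ t0 / 2 <= t1, t1 < t0 & t0 - t1 <= r].
  exists (t0 - Num.min (t0 / 2) r).
  have m0 : 0 < Num.min (t0 / 2) r by rewrite lt_min r0 divr_gt0.
  have m1 : Num.min (t0 / 2) r <= t0 / 2 by rewrite ge_min lexx.
  have m2 : Num.min (t0 / 2) r <= r by rewrite ge_min lexx orbT.
  by move: (Num.min _ _) m0 m1 m2 => m ? ? ?; split; lra.
have t10 : 0 < t1 by apply: lt_le_trans t12; rewrite divr_gt0.
have [|t] := @EVT_max R res_kernel t1 t0 (ltW t1t0).
  apply: continuous_in_subspaceT => y /set_mem/=; rewrite in_itv/= => /andP[y1 _].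
  by apply: continuous_res_kernel; exact: lt_le_trans y1.
rewrite in_itv/= => /andP[t1t tt0] tmax.
have g0 : 0 < res_kernel t.
  apply: lt_le_trans (tmax t1 _); first exact: pos.
  by rewrite in_itv/= lexx ltW.
have tlt : t < t0.
  by rewrite lt_neqAle tt0 andbT; apply/eqP => E; move: g0; rewrite E ltNge Gt0.
have t_gt0 : 0 < t by exact: lt_le_trans t1t.
have q2 : 2^-1 <= (t0 / t) `^ (al - 1).
  have tt2 : t0 / t <= 2.
    rewrite ler_pdivrMr// mulrC -ler_pdivrMr//; exact: le_trans t1t.
  have al1 : 0 <= 1 - al by rewrite subr_ge0 ltW.
  have al2 : 1 - al <= 1 by rewrite gerBl ltW.
  rewrite (_ : al - 1 = - (1 - al)); last by rewrite opprB.
  rewrite powRN lef_pV2 ?posrE ?powR_gt0 ?divr_gt0//.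
  apply: (@le_trans _ _ (2 `^ (1 - al))).
    by apply: (ge0_ler_powR al1); rewrite ?nnegrE ?divr_ge0 ?(ltW t00) ?(ltW t_gt0).
  rewrite -[leRHS]powRr1//; apply: ler_powR => //.
  by rewrite ler1n.
have Bq : B * (t0 - t) `^ al <= 4^-1.
  have H : (t0 - t) `^ al <= 4^-1 / (B + 1).
    apply: (@le_trans _ _ (r `^ al)).
      apply: (ge0_ler_powR (ltW hal0)); rewrite ?nnegrE ?(ltW r0) ?subr_ge0//.
      by apply: le_trans t1r; rewrite lerB.
    by rewrite /r -powRrM mulVf ?gt_eqF// powRr1// divr_ge0// ltW.
  apply: le_trans (ler_wpM2l B0 H) _.
  by rewrite mulrA ler_pdivrMr// mulrC ler_wpM2l// lerDl.
have E := @conv_comparison t t0 (res_kernel t) t_gt0 tlt pos _ (ltW g0).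
have {}E : conv t0 <= (t0 / t) `^ (al - 1) * conv t +
    res_kernel t * ((t0 - t) `^ al / al / Gamma al).
  by apply: E => s ts st; apply: tmax; rewrite in_itv/= (le_trans t1t ts) ltW.
have qk : (t0 / t) `^ (al - 1) * frac_kernel al t = frac_kernel al t0.
  rewrite /frac_kernel mulrA -powRM ?divr_ge0 ?(ltW t00) ?(ltW t_gt0)//.
  by rewrite divfK// gt_eqF.
have [_ V0] := volterra t00; have [_ V1] := volterra t_gt0.
move: Bq qk V0 V1 E q2 g0 Gt0; rewrite -!/(conv _) /B.
move: (conv t0) (conv t) (frac_kernel al t0) (frac_kernel al t) ((t0 / t) `^ _)
  ((t0 - t) `^ al) (res_kernel t) (res_kernel t0) (Gamma al)^-1.
move=> c0 c k0 k q p g g' G Bq qk V0 V1 E q2 g0 Gt0.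
have E2 := ler_wpM2l hlam E.
have E3 : lam * (q * c + g * (p / al * G)) =
    q * (lam * c) + g * (lam / al * G * p) by ring.
rewrite E3 V0 V1 mulrBr qk in E2.
have h1 := ler_wpM2r (ltW g0) q2; have h2 := ler_wpM2l (ltW g0) Bq.
lra.
Qed.

(** The infimum of the times where the kernel is nonpositive would be positive, and the kernel would
    be positive before it. By [res_kernel_first_zero] it is then positive at the infimum too, hence
    by continuity around it, although such times accumulate there or include it. *)
Lemma res_kernel_gt0 t : 0 < t -> 0 < res_kernel t.
Proof.
move=> t_gt0; rewrite ltNge; apply/negP => Gt.
have [e e0 He] := res_kernel_gt0_near0.
pose P := [set s | 0 < s /\ res_kernel s <= 0].
have Pt : P t by [].
have Pe s : P s -> e <= s.
  by move=> [s0 Gs]; rewrite leNgt; apply/negP => /(He _ s0); rewrite ltNge Gs.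
have hiP : has_inf P by split; [exists t|exists e].
pose t0 := inf P.
have t0e : e <= t0 by apply: lb_le_inf => //; exists t.
have t00 : 0 < t0 by exact: lt_le_trans t0e.
have pos s : 0 < s -> s < t0 -> 0 < res_kernel s.
  move=> s0 st; rewrite ltNge; apply/negP => Gs.
  have : t0 <= s by apply: ge_inf; [exists e; exact: Pe|split].
  by rewrite leNgt st.
have G0 := res_kernel_first_zero t00 pos.
have /cvgr_gt/(_ _ G0)/nbhs_ballP[d /= d0 Hd] := continuous_res_kernel t00.
have [s Ps sd] := inf_adherent d0 hiP.
have st0 : t0 <= s by apply: ge_inf; [exists e|].
have := Hd s; case: Ps => _ Gs; rewrite ltNge Gs => /(_ _)/negP; apply => //.
by rewrite /ball/= distrC ger0_norm ?subr_ge0// ltrBlDl.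
Qed.

Lemma res_kernel_ge0 t : 0 <= res_kernel t.
Proof.
have [t0|t0|->] := ltrgt0P t; first by rewrite ltW// res_kernel_gt0.
  (* A negative base raised to any power is 1 by convention, so the kernel at a negative time takes
     its value at time 1. Nonnegativity everywhere is what Tonelli on the whole plane asks for. *)
  have := res_kernel_gt0 ltr01.
  by rewrite /res_kernel !(lt0_powR1 _ t0) !powR1 => /ltW.
by rewrite /res_kernel powR0 ?mul0r// subr_eq0 lt_eqF.
Qed.

(** Convolve the Volterra equation with g_(1-al): since g_(1-al) * g_al = 1, the integral of G
    equals that of g_(1-al)(x-s) against g_al * G, and [volterra] at each [s] turns the sum of both
    terms into g_(1-al) * g_al. *)
Lemma integral_res_kernel x : 0 < x ->
  (\int[mu]_(s in `]0%R, x[) ((frac_kernel (1 - al) (x - s) + lam) * res_kernel s)%:E = 1)%E.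
Proof.
move=> x0; have al1 : 0 < 1 - al by rewrite subr_gt0.
have kk y : 0 < y ->
    (\int[mu]_(s in `]0%R, y[) (frac_kernel (1 - al) (y - s) * frac_kernel al s)%:E = 1)%E.
  move=> y0; rewrite integral_frac_kernel// /frac_kernel subrK subrr powRr0 Gamma1.
  by rewrite divr1.
pose f (p : measurableTypeR R * measurableTypeR R) : \bar R :=
  (frac_kernel (1 - al) (x - (p.2 : R)) * frac_kernel al ((p.2 : R) - p.1) *
   res_kernel p.1)%:E.
have mf : measurable_fun setT f.
  apply/measurable_EFinP; apply: measurable_realfun.measurable_funM.
    apply: measurable_realfun.measurable_funM.
      apply: (measurableT_comp (@measurable_frac_kernel _ setT)).
      exact: measurable_realfun.measurable_funB.
    apply: (measurableT_comp (@measurable_frac_kernel _ setT)).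
    exact: measurable_realfun.measurable_funB.
  exact: (measurableT_comp (@measurable_res_kernel setT)).
have f0 (p : measurableTypeR R * measurableTypeR R) : (0 <= f p)%E.
  rewrite /f lee_fin; apply: mulr_ge0; last exact: res_kernel_ge0.
  by apply: mulr_ge0; exact: frac_kernel_ge0.
have E0 : (\int[mu]_(y in `]0%R, x[) \int[mu]_(z in `]y, x[) f (y, z) =
    \int[mu]_(y in `]0%R, x[) (res_kernel y)%:E)%E.
  apply: eq_integral => y /set_mem/=; rewrite in_itv/= => /andP[y0 yx].
  transitivity (\int[mu]_(z in `]y, x[) ((res_kernel y)%:E *
      (frac_kernel (1 - al) (x - z) * frac_kernel al (z - y))%:E))%E.
    by apply: eq_integral => z _; rewrite /f/= -EFinM mulrC.
  rewrite ge0_integralZl//; last 3 first.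
  - apply/measurable_EFinP; apply: measurable_realfun.measurable_funM.
      exact: measurable_frac_kernel_subr.
    apply: measurable_funTS; apply: (measurableT_comp (@measurable_frac_kernel _ setT)).
    exact: measurable_realfun.measurable_funB.
  - by move=> z _; rewrite lee_fin mulr_ge0 ?frac_kernel_ge0.
  - by rewrite lee_fin res_kernel_ge0.
  rewrite (ge0_integral_shift y); last 2 first.
  - apply/measurable_EFinP; apply: measurable_realfun.measurable_funM.
      exact: measurable_frac_kernel_subr.
    apply: measurable_funTS; apply: (measurableT_comp (@measurable_frac_kernel _ setT)).
    exact: measurable_realfun.measurable_funB.
  - by move=> z _; rewrite lee_fin mulr_ge0 ?frac_kernel_ge0.
  rewrite subrr -[RHS]mule1; congr (_ * _)%E.
  have xy : 0 < x - y by rewrite subr_gt0.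
  rewrite -(kk _ xy); apply: eq_integral => s _.
  by rewrite addrK opprD [- s - y]addrC addrA.
have E := etrans (esym E0) (@tonelli_triangle R mu mu (BLeft x) f mf f0).
have m1 : measurable_fun `]0, x[ (fun s => (frac_kernel (1 - al) (x - s) * res_kernel s)%:E).
  apply/measurable_EFinP; apply: measurable_realfun.measurable_funM.
    exact: measurable_frac_kernel_subr.
  exact: measurable_res_kernel.
transitivity (\int[mu]_(s in `]0%R, x[) ((frac_kernel (1 - al) (x - s) * res_kernel s)%:E +
    lam%:E * (res_kernel s)%:E))%E.
  by apply: eq_integral => s _; rewrite -EFinM -EFinD mulrDl.
rewrite ge0_integralD//; last 3 first.
- by move=> s _; rewrite lee_fin mulr_ge0 ?frac_kernel_ge0 ?res_kernel_ge0.
- by move=> s _; rewrite mule_ge0 ?lee_fin ?res_kernel_ge0.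
- by apply: measurable_funeM; apply/measurable_EFinP; exact: measurable_res_kernel.
rewrite ge0_integralZl//; last 2 first.
- by apply/measurable_EFinP; exact: measurable_res_kernel.
- by move=> s _; rewrite lee_fin res_kernel_ge0.
rewrite E -ge0_integralZl//; last 2 first.
- exact: (@measurable_triangle R mu (BLeft x) f mf f0).
- by move=> s _; apply: integral_ge0 => y _; exact: f0.
rewrite -(kk x x0) -ge0_integralD//; last 3 first.
- by move=> s _; rewrite lee_fin mulr_ge0 ?frac_kernel_ge0 ?res_kernel_ge0.
- by move=> s _; rewrite mule_ge0 ?lee_fin//; apply: integral_ge0 => y _; exact: f0.
- by apply: measurable_funeM; exact: (@measurable_triangle R mu (BLeft x) f mf f0).
apply: eq_integral => s /set_mem/=; rewrite in_itv/= => /andP[s0 sx].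
have [i1 V] := volterra s0.
have -> : (\int[mu]_(y in `]0%R, s[) f (y, s) = (frac_kernel (1 - al) (x - s))%:E *
    (\int[mu]_(y in `]0, s[) (frac_kernel al (s - y) * res_kernel y))%:E)%E.
  rewrite /Rintegral fineK; last exact: integrable_fin_num.
  rewrite -ge0_integralZl//.
  - by apply: eq_integral => y _; rewrite /f/= -EFinM; congr EFin; exact/esym/mulrA.
  - apply/measurable_EFinP; apply: measurable_realfun.measurable_funM.
      exact: measurable_frac_kernel_subr.
    exact: measurable_res_kernel.
  - by move=> y _; rewrite lee_fin mulr_ge0 ?frac_kernel_ge0 ?res_kernel_ge0.
  - by rewrite lee_fin frac_kernel_ge0.
rewrite -!EFinM -EFinD; congr EFin.
by rewrite [X in _ + X]mulrCA V mulrBr addrC subrK.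
Qed.

End ResolventKernel.

(** * Inversion of D_t^al + lam *)

Lemma stieltjes_itvoc {R : realType} (c : cumulative R R) (a b : R) : a <= b ->
  lebesgue_stieltjes_measure c `]a, b]%classic = (c b - c a)%:E.
Proof.
move=> ab; rewrite /lebesgue_stieltjes_measure/= /measure_extension/=.
rewrite measurable_mu_extE//; last exact: is_ocitv.
exact: wlength_itv_bnd.
Qed.

Section StieltjesRepresentation.
Context {R : realType}.
Local Notation mu := (@lebesgue_measure R).
Variables (w : R -> R) (nd_w : {homo w : x y / x <= y}) (cont_w : continuous w).

Let rc_w : right_continuous w.
Proof. exact: right_continuousW cont_w. Qed.

Let cumul_w : cumulative R R :=
  HB.pack w (isCumulative.Build R _ R w nd_w rc_w).

Let nu : {sigma_finite_measure set (measurableTypeR R) -> \bar R} :=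
  lebesgue_stieltjes_measure cumul_w.

Let nu_ocitv (a b : R) : a <= b -> nu `]a, b]%classic = (w b - w a)%:E.
Proof. exact: (stieltjes_itvoc cumul_w). Qed.

(** Continuity of [w] excludes an atom at [b]: approximate from inside by ]a, y] with [y] close to
    [b]. *)
Let nu_itvoo (a b : R) : a <= b -> nu `]a, b[%classic = (w b - w a)%:E.
Proof.
move=> ab; apply/eqP; rewrite eq_le; apply/andP; split.
  rewrite -nu_ocitv//; apply: le_measure; rewrite ?inE; try exact: measurable_itv.
  by apply: subset_itvl; rewrite bnd_simp.
have [->|anb] := eqVneq a b; first by rewrite subrr.
have altb : a < b by rewrite lt_neqAle anb.
apply/lee_addgt0Pr => e e0.
have /cvgrPdist_le/(_ _ e0) H : w y @[y --> b^'-] --> w b.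
  by apply: cvg_at_left_filter; exact: cont_w.
have : \forall y \near b^'-, a < y /\ w b - w y <= e.
  near=> y; split; first by near: y; exact: nbhs_left_gt.
  by apply: le_trans (ler_norm _) _; near: y; exact: H.
move=> [d /= d0 Hd].
pose y := b - Num.min (d / 2) ((b - a) / 2).
have ba : 0 < b - a by rewrite subr_gt0.
have m0 : 0 < Num.min (d / 2) ((b - a) / 2) by rewrite lt_min !divr_gt0.
have m1 : Num.min (d / 2) ((b - a) / 2) <= d / 2 by rewrite ge_min lexx.
have yb : y < b by rewrite /y gtrBl.
have [ay wy] : a < y /\ w b - w y <= e.
  apply: Hd => //=; rewrite /y opprB addrC subrK ger0_norm ?(ltW m0)//.
  by apply: le_lt_trans m1 _; rewrite ltr_pdivrMr// mulr_natr mulr2n ltrDl.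
apply: (@le_trans _ _ ((w y - w a)%:E + e%:E)%E).
  by rewrite -EFinD lee_fin; move: wy; move: (w b) (w y) (w a) => ? ? ?; lra.
rewrite leeD2r// -nu_ocitv ?(ltW ay)//.
apply: le_measure; rewrite ?inE; try exact: measurable_itv.
by move=> z /=; rewrite !in_itv/= => /andP[-> zy]; exact: le_lt_trans yb.
Unshelve. all: by end_near. Qed.

Variables (al lam : R).
Hypotheses (hal0 : 0 < al) (hal1 : al < 1) (hlam : 0 <= lam).

Let integral_nu_cst (k t : R) : 0 <= k -> 0 <= t ->
  (\int[nu]_(y in `]0%R, t[) k%:E = (k * (w t - w 0))%:E)%E.
Proof.
move=> k0 t0; rewrite integral_cst//=.
by rewrite EFinM; congr (_ * _)%E; exact: nu_itvoo.
Qed.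

(** Here w t - w s is the [nu]-mass of ]s, t[. After exchanging the integrals, the kernel integrated
    over ]0, y[ gives (t-y)^(-al) - t^(-al), and the boundary term of [caputo] cancels the
    subtracted constant. *)
Lemma EFin_caputo_stieltjes (t : R) : 0 < t -> caputo_at w t ->
  ((caputo al w t)%:E = \int[nu]_(y in `]0%R, t[) (frac_kernel (1 - al) (t - y))%:E)%E.
Proof.
move=> t0 wt; have Ga : 0 < Gamma (1 - al) by rewrite Gamma_gt0// subr_gt0.
have G0 : 0 <= (Gamma (1 - al))^-1 by rewrite invr_ge0 ltW.
pose k s := al * (t - s) `^ (- al - 1).
have k0 s : 0 <= k s by rewrite mulr_ge0 ?powR_ge0// ltW.
have mk D : measurable_fun D k.
  by apply: measurable_realfun.measurable_funM => //; exact: measurable_powR_subr.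
have tal0 : 0 <= t `^ (- al) by exact: powR_ge0.
rewrite /caputo EFinM EFinD.
rewrite {1}/Rintegral fineK; last first.
  by apply: integrable_fin_num; [exact: measurable_itv|exact: caputo_integrable].
pose f (p : measurableTypeR R * measurableTypeR R) : \bar R := (k (p.1 : R))%:E.
have mf : measurable_fun setT f.
  by apply/measurable_EFinP; exact: (measurableT_comp (mk setT)).
have f0 (p : measurableTypeR R * measurableTypeR R) : (0 <= f p)%E by rewrite lee_fin.
have -> : (\int[mu]_(s in `]0%R, t[) (al * (t - s) `^ (- al - 1) * (w t - w s))%:E =
    \int[nu]_(y in `]0%R, t[) ((t - y) `^ (- al) - t `^ (- al))%:E)%E.
  transitivity (\int[mu]_(s in `]0%R, t[) \int[nu]_(y in `]s, t[) f (s, y))%E.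
    apply: eq_integral => s /set_mem/=; rewrite in_itv/= => /andP[s0 st].
    rewrite /f/= integral_cst//=.
    by rewrite EFinM; congr (_ * _)%E; apply/esym/nu_itvoo; exact: ltW.
  rewrite (@tonelli_triangle R mu nu (BLeft t) f mf f0).
  apply: eq_integral => y /set_mem/=; rewrite in_itv/= => /andP[y0 yt].
  transitivity (al%:E * \int[mu]_(s in `]0%R, y[) ((t - s) `^ (- al - 1))%:E)%E.
    rewrite -ge0_integralZl//.
    - by apply/measurable_EFinP; exact: measurable_powR_subr.
    - by move=> s _; rewrite lee_fin powR_ge0.
    - by rewrite lee_fin ltW.
  rewrite integral_powR_subr_itv ?oppr_eq0 ?gt_eqF// -EFinM subr0; congr EFin.
  move: (t `^ _) ((t - y) `^ _) => p q.
  by field; rewrite gt_eqF.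
rewrite -(integral_nu_cst tal0 (ltW t0)).
have mt (D : set R) : measurable_fun D (fun y : R => ((t - y) `^ (- al))%:E).
  by apply/measurable_EFinP; exact: measurable_powR_subr.
rewrite -ge0_integralD//=.
- rewrite -ge0_integralZl//=.
  + apply: eq_integral => y _; rewrite -EFinD -EFinM [t `^ _ + _]addrC subrK /frac_kernel.
    by rewrite mulrC; congr (_ `^ _ / _)%:E; rewrite addrAC subrr add0r.
  + by apply: emeasurable_funD => //; apply/measurable_EFinP;
      apply: measurable_realfun.measurable_funB => //; exact: measurable_powR_subr.
  + move=> y; rewrite /= in_itv/= => /andP[y0 yt].
    by rewrite -EFinD addrC subrK lee_fin powR_ge0.
- move=> y; rewrite /= in_itv/= => /andP[y0 yt]; rewrite lee_fin subr_ge0.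
  have ty : 0 < t - y by rewrite subr_gt0.
  rewrite !powRN lef_pV2 ?posrE ?powR_gt0//.
  apply: (ge0_ler_powR (ltW hal0)); rewrite ?nnegrE ?(ltW t0) ?(ltW ty)//.
  by rewrite gerBl ltW.
- apply/measurable_EFinP; apply: measurable_realfun.measurable_funB => //.
  exact: measurable_powR_subr.
Qed.

Lemma EFin_caputo_lam (t : R) : 0 < t -> w 0 = 0 -> caputo_at w t ->
  ((caputo al w t + lam * w t)%:E =
   \int[nu]_(y in `]0%R, t[) (frac_kernel (1 - al) (t - y) + lam)%:E)%E.
Proof.
move=> t0 w0 wt; rewrite EFinD EFin_caputo_stieltjes//.
have -> : lam * w t = lam * (w t - w 0) by rewrite w0 subr0.
rewrite -integral_nu_cst ?(ltW t0)// -ge0_integralD//=.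
- by move=> y _; rewrite lee_fin frac_kernel_ge0// subr_gt0.
- by apply/measurable_EFinP; exact: measurable_frac_kernel_subr.
Qed.

Let measurable_res_kernel_subr (t : R) : measurable_fun setT
  (fun p : measurableTypeR R * measurableTypeR R => res_kernel al lam (t - (p.2 : R))).
Proof.
have m2 : measurable_fun setT
    (fun p : measurableTypeR R * measurableTypeR R => t - (p.2 : R)).
  exact: measurable_realfun.measurable_funB.
by apply: (measurableT_comp (@measurable_res_kernel R al lam hal0 setT)).
Qed.

Let f (t : R) (p : measurableTypeR R * measurableTypeR R) : \bar R :=
  ((frac_kernel (1 - al) ((p.2 : R) - p.1) + lam) * res_kernel al lam (t - (p.2 : R)))%:E.

Let mf t : measurable_fun setT (f t).
Proof.
apply/measurable_EFinP; apply: measurable_realfun.measurable_funM.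
  apply: measurable_realfun.measurable_funD => //.
  apply: (measurableT_comp (@measurable_frac_kernel _ _ setT)).
  exact: measurable_realfun.measurable_funB.
exact: measurable_res_kernel_subr.
Qed.

Let f0 t p : (0 <= f t p)%E.
Proof.
rewrite lee_fin mulr_ge0 ?res_kernel_ge0// addr_ge0// frac_kernel_ge0//.
by rewrite subr_gt0.
Qed.

(** Tonelli provides measurability in time of the Stieltjes form. *)
Lemma measurable_caputo_lam (T : R) : w 0 = 0 ->
  (forall t, 0 < t -> t < T -> caputo_at w t) ->
  measurable_fun `]0, T[ (fun t => caputo al w t + lam * w t).
Proof.
move=> w0 wt; apply/measurable_EFinP.
pose g (p : measurableTypeR R * measurableTypeR R) : \bar R :=
  (frac_kernel (1 - al) ((p.2 : R) - p.1) + lam)%:E.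
have mg : measurable_fun setT g.
  apply/measurable_EFinP; apply: measurable_realfun.measurable_funD => //.
  apply: (measurableT_comp (@measurable_frac_kernel _ _ setT)).
  exact: measurable_realfun.measurable_funB.
have g0 (p : measurableTypeR R * measurableTypeR R) : (0 <= g p)%E.
  by rewrite lee_fin addr_ge0// frac_kernel_ge0// subr_gt0.
apply: eq_measurable_fun (@measurable_triangle R nu (BLeft T) g mg g0).
by move=> t /set_mem/=; rewrite in_itv/= => /andP[t0 tT]; rewrite /= EFin_caputo_lam//; exact: wt.
Qed.

Lemma integral_res_kernel_caputo (t : R) : 0 < t -> w 0 = 0 ->
  (forall r, 0 < r -> r < t -> caputo_at w r) ->
  (\int[mu]_(r in `]0%R, t[) (res_kernel al lam (t - r) * (caputo al w r + lam * w r))%:E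
   = (w t)%:E)%E.
Proof.
move=> t0 w0 wt.
transitivity (\int[mu]_(r in `]0%R, t[) \int[nu]_(y in `]0%R, r[) f t (y, r))%E.
  apply: eq_integral => r /set_mem/=; rewrite in_itv/= => /andP[r0 rt].
  rewrite EFinM EFin_caputo_lam//; last exact: wt.
  rewrite -ge0_integralZl//=.
  - by apply: eq_integral => y _; rewrite /f/= -EFinM mulrC.
  - apply/measurable_EFinP; apply: measurable_realfun.measurable_funD => //.
    exact: measurable_frac_kernel_subr.
  - by move=> y _; rewrite lee_fin addr_ge0// frac_kernel_ge0// subr_gt0.
  - by rewrite lee_fin res_kernel_ge0.
rewrite -(@tonelli_triangle R nu mu (BLeft t) (f t) (mf t) (f0 t)).
have -> : (w t)%:E = (\int[nu]_(y in `]0%R, t[) 1%:E)%E.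
  by rewrite integral_nu_cst ?(ltW t0)// mul1r w0 subr0.
apply: eq_integral => y /set_mem/=; rewrite in_itv/= => /andP[y0 yt].
have ty : 0 < t - y by rewrite subr_gt0.
have mfy D : measurable_fun D (fun r => f t (y, r)).
  apply: measurable_funTS; apply: (measurableT_comp (mf t)).
  by apply: measurable_fun_pair.
(* Shifting and then reflecting the interval ]y, t[ gives the integral of [integral_res_kernel] on
   ]0, t - y[, which is 1; what remains is the [nu]-mass of ]0, t[. *)
rewrite (ge0_integral_shift y)//; last exact: mfy.
rewrite subrr (ge0_integral_reflect (t := t - y))//; last first.
  apply: measurable_funTS; apply: (measurableT_comp (mfy setT)).
  by apply: measurable_realfun.measurable_funD => //; exact: measurable_cst.
rewrite -?(integral_res_kernel hal0 hal1 hlam ty).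
apply: eq_integral => s _; rewrite /f/= addrK; congr ((_ + _) * res_kernel _ _ _)%:E.
by rewrite /=; ring.
Qed.

End StieltjesRepresentation.

(** * The resolvent inequality for Lipschitz functions *)

Section ResolventBound.
Context {R : realType}.
Local Notation mu := (@lebesgue_measure R).
Variables (al lam : R).
Hypotheses (hal0 : 0 < al) (hal1 : al < 1) (hlam : 0 <= lam).

(* Both [v + K id] and [K id] are nondecreasing, so they admit the
   representation of [integral_res_kernel_caputo]. *)
Lemma le_resolvent (v : R -> R) (K t : R) (h : R -> \bar R) : 0 < t ->
  (forall x y, `|v x - v y| <= K * `|x - y|) -> v 0 = 0 ->
  (forall r, 0 < r -> r < t -> (0 <= h r)%E /\
     ((caputo al v r + lam * v r)%:E <= h r)%E) ->
  ((v t)%:E <= \int[mu]_(r in `]0%R, t[) ((res_kernel al lam (t - r))%:E * h r))%E.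
Proof.
move=> t0 lip v0 Hh.
have K0 : 0 <= K.
  by have := lip 1 0; rewrite subr0 normr1 mulr1; exact: le_trans (normr_ge0 _).
pose w2 x : R := K * x.
pose w1 x : R := 1 * v x + w2 x.
have lip2 x y : `|w2 x - w2 y| <= K * `|x - y|.
  by rewrite -mulrBr normrM (ger0_norm K0).
have nd2 : {homo w2 : x y / x <= y} by move=> x y xy; rewrite ler_wpM2l.
have nd1 : {homo w1 : x y / x <= y}.
  move=> x y xy; have := lip x y; rewrite [`|x - y|]ler0_norm ?subr_le0// => H.
  by have := le_trans (ler_norm _) H; rewrite /w1 /w2; lra.
have cont_v := lipschitz_continuous lip.
have cont2 := lipschitz_continuous lip2.
have cont1 : continuous w1.
  by move=> x; apply: cvgD; [apply: cvgM; [exact: cvg_cst|exact: cont_v]|exact: cont2].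
have at_lip (u : R -> R) r : continuous u -> (forall x y, `|u x - u y| <= K * `|x - y|) ->
    caputo_at u r.
  move=> cu lu; split; first by apply: measurable_funTS; exact: continuous_measurable_fun.
  exists K => s s0 sr; apply: le_trans (lu _ _) _.
  by rewrite ger0_norm// subr_ge0 ltW.
have at_v r : caputo_at v r by exact: at_lip.
have at2 r : caputo_at w2 r by exact: at_lip.
have at1 r : caputo_at w1 r by exact: caputo_at_lin.
have w20 : w2 0 = 0 by rewrite /w2 mulr0.
have w10 : w1 0 = 0 by rewrite /w1 v0 w20 mulr0 addr0.
pose g1 r := caputo al w1 r + lam * w1 r.
pose g2 r := caputo al w2 r + lam * w2 r.
pose g r := caputo al v r + lam * v r.
have gE r : 0 < r -> g1 r = g r + g2 r.
  by move=> r0; rewrite /g1 /w1 caputo_lin// /g /g2; ring.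
have mg1 : measurable_fun `]0, t[ g1 by apply: measurable_caputo_lam.
have mg2 : measurable_fun `]0, t[ g2 by apply: measurable_caputo_lam.
have g20 r : 0 < r -> 0 <= g2 r.
  move=> r0; rewrite -lee_fin /g2 (EFin_caputo_lam nd2 cont2)//.
  by apply: integral_ge0 => y _; rewrite lee_fin addr_ge0// frac_kernel_ge0// subr_gt0.
have R1 := integral_res_kernel_caputo nd1 cont1 hal0 hal1 hlam t0 w10 (fun r _ _ => at1 r).
have R2 := integral_res_kernel_caputo nd2 cont2 hal0 hal1 hlam t0 w20 (fun r _ _ => at2 r).
pose G r := res_kernel al lam (t - r).
have G0 r : 0 <= G r by exact: res_kernel_ge0.
have mG : measurable_fun `]0, t[ G.
  have m2 : measurable_fun setT (fun r : R => t - r) by exact: measurable_realfun.measurable_funB.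
  by apply: measurable_funTS; apply: (measurableT_comp (@measurable_res_kernel R al lam hal0 setT)).
(* The bound g1 <= gp + g2 keeps all integrands nonnegative, and the finite integral of G g2, equal
   to w2 t, can be subtracted. Replacing [gp] by [h] is left to the end because [h] may fail to be
   measurable. *)
pose gp r := Num.max 0 (g1 r - g2 r).
have gp0 r : 0 <= gp r by rewrite le_max lexx.
have mgp : measurable_fun `]0, t[ gp.
  by apply: measurable_maxr => //; exact: measurable_realfun.measurable_funB.
have step : ((w1 t)%:E <= \int[mu]_(r in `]0%R, t[) (G r * gp r)%:E + (w2 t)%:E)%E.
  rewrite -R1 -R2 -ge0_integralD//=; last 4 first.
  - by move=> r _; rewrite lee_fin mulr_ge0.
  - by apply/measurable_EFinP; exact: measurable_realfun.measurable_funM.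
  - move=> r; rewrite /= in_itv/= => /andP[r0 _].
    by rewrite lee_fin; apply: mulr_ge0; [exact: G0|exact: g20].
  - by apply/measurable_EFinP; exact: measurable_realfun.measurable_funM.
  apply: ge0_le_integral_nomeas => r; rewrite /= in_itv/= => /andP[r0 rt].
    rewrite lee_fin; apply: mulr_ge0; first exact: G0.
    rewrite -lee_fin (EFin_caputo_lam nd1 cont1)//.
    by apply: integral_ge0 => y _; rewrite lee_fin addr_ge0// frac_kernel_ge0// subr_gt0.
  rewrite -EFinD lee_fin -mulrDr; apply: ler_wpM2l; first exact: G0.
  rewrite -/(g1 r) -/(g2 r) -lerBlDr /gp le_max lexx orbT//.
have {}step : ((v t)%:E <= \int[mu]_(r in `]0%R, t[) (G r * gp r)%:E)%E.
  by move: step; rewrite -leeBlDr// -EFinB /w1 mul1r addrK.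
apply: le_trans step _.
apply: ge0_le_integral_nomeas => r; rewrite /= in_itv/= => /andP[r0 rt].
  by rewrite lee_fin mulr_ge0.
have [h0 gh] := Hh r r0 rt.
rewrite EFinM; apply: lee_wpmul2l; first by rewrite lee_fin.
rewrite /gp gE// addrK; case: (leP 0 (g r)) => _ //.
Qed.

End ResolventBound.

(** * The error function *)

Lemma compact_closurclosure_itv_bounded (R : realType) n (A : set 'rV[R]_n) :
  bounded_set A -> compact (closure A).
Proof.
move=> bA; apply: bounded_closed_compact; last exact: closed_closure.
have [M [_ HM]] := bA; exists (M + 1); split; first exact: num_real.
move=> N MN x Ax; have {HM} AN := HM N (lt_trans _ MN); move: x Ax.
have cN : closed [set x : 'rV[R]_n | `|x| <= N].
  apply: (closed_comp (f := fun x : 'rV[R]_n => `|x|) (D := [set y | y <= N])).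
    by move=> x _; exact: norm_continuous.
  exact: closed_le.
move=> x Ax; apply: (cN x); apply: closureS Ax => y Ay.
by apply: AN => //; rewrite ltrDl.
Qed.

Section CaputoExtra.
Context {R : realType}.
Local Notation mu := (@lebesgue_measure R).
Variables (al : R) (hal0 : 0 < al) (hal1 : al < 1).

Lemma caputo_ext (v w : R -> R) t : 0 < t ->
  (forall s, 0 <= s -> s <= t -> v s = w s) -> caputo al v t = caputo al w t.
Proof.
move=> t0 vw; rewrite /caputo vw ?(ltW t0)// vw ?(ltW t0)//.
congr (_ * (_ + _)); apply: eq_Rintegral => s /set_mem/=.
by rewrite in_itv/= => /andP[s0 st]; rewrite (vw s) ?ltW.
Qed.

Lemma caputoN (v : R -> R) t : 0 < t -> caputo_at v t ->
  caputo al (fun s => - v s) t = - caputo al v t.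
Proof.
move=> t0 vt; have -> : (fun s => - v s) = (fun s => (-2) * v s + v s).
  by apply/funext => s; ring.
by rewrite caputo_lin//; ring.
Qed.

Lemma caputo_at_cst (k t : R) : caputo_at (fun=> k) t.
Proof.
split=> //; exists 0 => s _ _.
by rewrite subrr normr0 mul0r.
Qed.

Lemma caputo_cst (k t : R) : caputo al (fun=> k) t = 0.
Proof.
rewrite /caputo subrr mulr0 add0r; transitivity ((Gamma (1 - al))^-1 * \int[mu]_(s in `]0, t[) (0 : R)).
  by congr (_ * _); apply: eq_Rintegral => s _; rewrite mulr0.
by rewrite Rintegral_cst// mul0r mulr0.
Qed.

End CaputoExtra.

Section ErrorFunction.
Context {R : realType} {d : nat}.
Variables (al T lam : R) (Omega : set 'rV[R]_d).
Variables (a b : 'I_d -> 'rV[R]_d -> R) (c : 'rV[R]_d -> R) (e : 'rV[R]_d -> R -> R).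
Hypotheses (hal0 : 0 < al) (hal1 : al < 1) (T0 : 0 < T).
Hypotheses (O0 : Omega !=set0) (oO : open Omega) (bO : bounded_set Omega).
Hypothesis (a_cont : forall k, {within closure Omega, continuous (a k)}).
Hypothesis (b_cont : forall k, {within closure Omega, continuous (b k)}).
Hypothesis (c_cont : {within closure Omega, continuous c}).
Hypothesis (a_gt0 : forall k x, closure Omega x -> 0 < a k x).
Hypotheses (lam0 : 0 <= lam) (lam_c : forall x, closure Omega x -> lam <= c x).
Hypothesis (e_cont : {within closure Omega `*` `[0, T]%classic,
  continuous (fun p : 'rV[R]_d * R => e p.1 p.2)}).
Hypothesis (e_lip : forall eps, 0 < eps -> exists K, forall x s1 s2, Omega x ->
  eps <= s1 -> s1 <= T -> eps <= s2 -> s2 <= T -> `|e x s1 - e x s2| <= K * `|s1 - s2|).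
Hypothesis (e_C2 : forall t, 0 < t -> t <= T -> C2_on Omega (e ^~ t)).
Hypothesis (e_init : forall x, closure Omega x -> e x 0 = 0).
Hypothesis (e_boundary : forall x t, boundary Omega x -> 0 < t -> t <= T -> e x t = 0).

Let D := closure Omega `*` `[0, T]%classic.

Let cptO : compact (closure Omega).
Proof. exact: compact_closurclosure_itv_bounded. Qed.

Let clO x : Omega x -> closure Omega x.
Proof. by move=> ?; exact: subset_closure. Qed.

Let e_near x t eps : closure Omega x -> 0 <= t -> t <= T -> 0 < eps ->
  \forall p \near (x, t), D p -> `|e x t - e p.1 p.2| < eps.
Proof.
move=> Ox t0 tT eps0.
have Dxt : D (x, t) by split => //=; rewrite in_itv/= t0.
move/subspace_continuousP: e_cont => /(_ (x, t) Dxt) /cvgrPdist_lt /(_ _ eps0).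
by [].
Qed.

Lemma closure_itv_bounded : exists2 M, 0 <= M & forall x t, closure Omega x -> 0 <= t -> t <= T -> `|e x t| <= M.
Proof.
have [x0 Ox0] := O0.
have D0 : D !=set0.
  by exists (x0, 0); split => /=; [exact: clO|rewrite in_itv/= lexx ltW].
have cD : compact D by apply: compact_setX => //; exact: segment_compact.
have ce : {within D, continuous (fun p => `|e p.1 p.2|)}.
  move=> p; apply: (@continuous_comp _ _ _ _ (@Num.norm R R)); first exact: e_cont.
  exact: norm_continuous.
have [p pD max_p] := compact_EVT_max D0 cD ce.
exists `|e p.1 p.2| => // x t Ox t0 tT.
apply: (max_p (x, t)); rewrite inE; split => //=.
by rewrite in_itv/= t0.
Qed.

Let N t := sup [set `|e x t| | x in Omega].

Let N_has_sup t : 0 <= t -> t <= T -> has_sup [set `|e x t| | x in Omega].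
Proof.
move=> t0 tT; split; first by have [x Ox] := O0; exists `|e x t|, x.
by have [M M0 eM] := closure_itv_bounded; exists M => _ [x Ox <-]; apply: eM => //; exact: clO.
Qed.

Let N_ge x t : 0 <= t -> t <= T -> Omega x -> `|e x t| <= N t.
Proof. by move=> t0 tT Ox; apply: sup_upper_bound; [exact: N_has_sup|exists x]. Qed.

Let N_le t M : (forall x, Omega x -> `|e x t| <= M) -> N t <= M.
Proof.
move=> eM; apply: ge_sup; first by have [x Ox] := O0; exists `|e x t|, x.
by move=> _ [x Ox <-]; exact: eM.
Qed.

Let N_ge0 t : 0 <= t -> t <= T -> 0 <= N t.
Proof.
move=> t0 tT; have [x Ox] := O0.
by apply: le_trans (N_ge t0 tT Ox).
Qed.

(** The maximum over the compact closure exists by continuity; on the boundary [e] vanishes, so a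
    positive maximum lies inside. *)
Let N_attained t : 0 < t -> t <= T -> 0 < N t -> exists2 x, Omega x & `|e x t| = N t.
Proof.
move=> t0 tT Nt.
have [x0 Ox0] := O0.
have cO0 : closure Omega !=set0 by exists x0; exact: clO.
have ce : {within closure Omega, continuous (fun x => `|e x t|)}.
  apply/subspace_continuousP => x Ox.
  apply: cvg_norm; apply/cvgrPdist_lt => eps eps0.
  have [[U V] [/= Ux Vt] UV] := e_near Ox (ltW t0) tT eps0.
  rewrite near_withinE; near=> y => Oy; apply: (UV (y, t)) => /=.
    by split; [near: y; exact: Ux|exact: nbhs_singleton Vt].
  by split => //=; rewrite in_itv/= ltW.
have [x /set_mem Ox max_x] := compact_EVT_max cO0 cptO ce.
have Nx : N t <= `|e x t| by apply: N_le => y Oy; apply: max_x; rewrite inE; exact: clO.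
suff Omx : Omega x by exists x => //; apply/eqP; rewrite eq_le Nx andbT; exact: N_ge (ltW t0) tT Omx.
apply: contrapT => nOx.
have /e_boundary/(_ t0 tT) ex0 : boundary Omega x.
  by split => // /interior_subset.
by move: (lt_le_trans Nt Nx); rewrite ex0 normr0 ltxx.
Unshelve. all: by end_near. Qed.

(** Compactness of the closure makes the continuity of [e] at the points (x, 0) uniform in [x]. *)
Let N_small delta : 0 < delta ->
  exists2 eta, 0 < eta & forall t, 0 <= t -> t < eta -> t <= T -> N t <= delta.
Proof.
move=> delta0.
have H : \forall t \near (0 : R), closure Omega `<=` (fun x => closure Omega x -> D (x, t) -> `|e x t| < delta).
  apply: ((compact_near_coveringP _).1 cptO _ (nbhs (0 : R))
    (fun t x => closure Omega x -> D (x, t) -> `|e x t| < delta)) => x Ox; have := e_near Ox (lexx 0) (ltW T0) delta0.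
  apply: filterS => -[y t] /= H Oy Dyt; have := H Dyt.
  by rewrite e_init// sub0r normrN.
have [eta /= eta0 Heta] := H.
exists eta => // t t0 teta tT; apply: N_le => x Ox; apply: ltW.
apply: (Heta t) => //=; [by rewrite sub0r normrN ger0_norm|exact: clO|exact: clO|].
by split => /=; [exact: clO|rewrite in_itv/= t0].
Qed.

Let N_class : caputo_class T N.
Proof.
split.
  have [M M0 eM] := closure_itv_bounded; exists M => t t0 tT.
  rewrite ger0_norm ?N_ge0//; apply: N_le => x Ox; apply: eM => //; exact: clO.
move=> eps eps0; have [K HK] := e_lip eps0; exists K.
have half s1 s2 : eps <= s1 -> s1 <= T -> eps <= s2 -> s2 <= T ->
    N s1 - N s2 <= K * `|s1 - s2|.
  move=> es1 s1T es2 s2T; rewrite lerBlDr; apply: N_le => x Ox.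
  have -> : e x s1 = (e x s1 - e x s2) + e x s2 by rewrite subrK.
  apply: le_trans (ler_normD _ _) _; apply: lerD; first exact: HK.
  by apply: N_ge => //; exact: le_trans (ltW eps0) es2.
move=> s1 s2 es1 s1T es2 s2T; rewrite ler_norml half// andbT.
by rewrite lerNl opprB distrC half.
Qed.

Lemma slice_caputo_class x : Omega x -> caputo_class T (e x).
Proof.
move=> Ox; split.
  by have [M M0 eM] := closure_itv_bounded; exists M => t t0 tT; apply: eM => //; exact: clO.
by move=> eps eps0; have [K HK] := e_lip eps0; exists K => *; exact: HK.
Qed.

Definition error_residual x t : R := caputo al (e x) t + elliptic a b c (e ^~ t) x.

(* Since [N t --> 0] as [t --> 0], lowering [N] by [delta] makes it vanish near 0,
   where [N] need not be Lipschitz. *)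
Let Nd delta t := Num.max 0 (N t - delta).

Let Nd_ge0 delta t : 0 <= Nd delta t.
Proof. by rewrite le_max lexx. Qed.

Let Nd_le delta t : 0 <= t -> t <= T -> 0 <= delta -> Nd delta t <= N t.
Proof. by move=> t0 tT delta0; rewrite ge_max N_ge0//= gerBl. Qed.

Let N_le_Nd delta t : N t <= Nd delta t + delta.
Proof. by rewrite -lerBlDr le_max lexx orbT. Qed.

Let Nd_gt0 delta t : 0 < Nd delta t -> Nd delta t = N t - delta.
Proof. by rewrite /Nd; case: (leP 0 (N t - delta)) => //; rewrite ltxx. Qed.

Let max_dist (x y : R) : `|Num.max 0 x - Num.max 0 y| <= `|x - y|.
Proof.
wlog xy : x y / x <= y => [hw|].
  by have [|/ltW] := leP x y => xy; [|rewrite distrC [leRHS]distrC]; exact: hw.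
by rewrite !ler0_norm; case: (leP 0 x) => ?; case: (leP 0 y) => ?; lra.
Qed.

Let Nd_class delta : 0 <= delta -> caputo_class T (Nd delta).
Proof.
move=> delta0; have [[M HM] HL] := N_class; split.
  exists M => t t0 tT; rewrite ger0_norm//; apply: le_trans (Nd_le t0 tT delta0) _.
  by apply: le_trans (ler_norm _) (HM t t0 tT).
move=> eps eps0; have [K HK] := HL eps eps0; exists K => s1 s2 ? ? ? ?.
apply: le_trans (max_dist _ _) _.
rewrite opprB addrA subrK; exact: HK.
Qed.

Let Nd_small delta : 0 < delta ->
  exists2 eta, 0 < eta & forall t, 0 <= t -> t < eta -> t <= T -> Nd delta t = 0.
Proof.
move=> delta0; have [eta eta0 H] := N_small delta0; exists eta => // t t0 teta tT.
by rewrite /Nd max_l// subr_le0; exact: H.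
Qed.

Let Nd_residual delta t : 0 <= delta -> 0 < t -> t <= T -> 0 < Nd delta t ->
  exists2 x, Omega x & caputo al (Nd delta) t + lam * Nd delta t <= `|error_residual x t|.
Proof.
move=> delta0 t0 tT Ndt; have NdE := Nd_gt0 Ndt.
have Nt : 0 < N t by apply: lt_le_trans Ndt (Nd_le (ltW t0) tT delta0).
have [x Ox ext] := N_attained t0 tT Nt; exists x => //.
have at_e := caputo_class_at (slice_caputo_class Ox) t0 tT.
have at_Nd := caputo_class_at (Nd_class delta0) t0 tT.
have lamN : lam * Nd delta t <= lam * N t.
  by apply: ler_wpM2l => //; exact: Nd_le (ltW t0) tT delta0.
(* At [t] the truncation is inactive, and at [s] it can only raise [Nd]; so truncating does not
   enlarge the increments that enter the Caputo derivative. *)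
have incr s (y : R) : 0 <= s -> s < t -> y <= N s -> Nd delta t - Nd delta s <= N t - y.
  move=> s0 st yN; have := N_le_Nd delta s; rewrite NdE.
  by move: (N t) (N s) (Nd delta s) yN => ? ? ? ? ?; lra.
have [e0|e0] := leP 0 (e x t).
  have exN : e x t = N t by rewrite -ext ger0_norm.
  apply: le_trans (ler_norm _); apply: lerD.
    apply: (le_caputo hal0 hal1 t0 at_Nd at_e) => s s0 st; rewrite exN.
    apply: incr => //; apply: le_trans (ler_norm _) (N_ge _ _ Ox) => //.
    exact: ltW (lt_le_trans st tT).
  apply: le_trans lamN _; rewrite -exN.
  apply: (@elliptic_at_max _ _ Omega a b c (e ^~ t) x lam oO (e_C2 t0 tT) Ox) => //.
  - by move=> y Oy; rewrite exN; apply: le_trans (ler_norm _) (N_ge (ltW t0) tT Oy).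
  - by move=> k; apply: a_gt0; exact: clO.
  - by apply: lam_c; exact: clO.
have exN : - e x t = N t by rewrite -ext ltr0_norm.
rewrite -normrN; apply: le_trans (ler_norm _); rewrite opprD; apply: lerD.
  rewrite -caputoN//.
  have at_eN : caputo_at (fun s => - e x s) t.
    have -> : (fun s => - e x s) = (fun s => (-2) * e x s + e x s).
      by apply/funext => s; ring.
    exact: caputo_at_lin.
  apply: (le_caputo hal0 hal1 t0 at_Nd at_eN) => s s0 st; rewrite exN.
  apply: incr => //; apply: le_trans (N_ge _ _ Ox) => //; first by rewrite -normrN ler_norm.
  exact: ltW (lt_le_trans st tT).
apply: le_trans lamN _; rewrite -exN -(ellipticN a b c oO (e_C2 t0 tT) Ox).
apply: (@elliptic_at_max _ _ Omega a b c (fun y => - e y t) x lam oO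
  (C2_onN oO (e_C2 t0 tT)) Ox) => //.
- by move=> y Oy; rewrite exN; apply: le_trans (N_ge (ltW t0) tT Oy); rewrite -normrN ler_norm.
- by move=> k; apply: a_gt0; exact: clO.
- by apply: lam_c; exact: clO.
- by rewrite oppr_ge0 ltW.
Qed.

(** The comparison principle is applied to [Nd delta - E]. Where this is positive, so is [Nd delta],
    because E >= 0, and [Nd_residual] applies. The final time [T'] is free because in (iii) the
    residual is controlled only up to the time considered. *)
Lemma error_le_barrier T' (E : R -> R) : 0 < T' -> T' <= T -> caputo_class T' E ->
  (forall t, 0 <= t -> t <= T' -> 0 <= E t) ->
  (forall x t, Omega x -> 0 < t -> t <= T' ->
     `|error_residual x t| <= caputo al E t + lam * E t) ->
  forall x t, Omega x -> 0 <= t -> t <= T' -> `|e x t| <= E t.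
Proof.
move=> T'0 T'T EC E0 rE x t Ox t0 tT'.
have tT := le_trans tT' T'T.
apply: le_trans (N_ge t0 tT Ox) _.
apply/ler_addgt0Pr => delta delta0.
apply: le_trans (N_le_Nd delta t) _; rewrite lerD2r.
have NC := caputo_classW T'T (Nd_class (ltW delta0)).
have [eta eta0 Heta] := Nd_small delta0.
have zC := caputo_class_lin (-1) EC NC.
suff : -1 * E t + Nd delta t <= 0 by rewrite mulN1r addrC subr_le0.
have m0 : 0 < Num.min eta T' by rewrite lt_min eta0.
apply: (caputo_comparison hal0 hal1 zC lam0 m0) => //.
  move=> s s0; rewrite lt_min => /andP[seta sT'].
  rewrite Heta ?addr0 ?mulN1r ?oppr_le0; first exact: E0 (ltW sT').
  - by [].
  - by [].
  - exact: ltW (lt_le_trans sT' T'T).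
move=> s s0 sT'; rewrite mulN1r addrC subr_gt0 => zs.
have sT := le_trans sT' T'T.
have Nds : 0 < Nd delta s by apply: le_lt_trans zs; exact: E0 (ltW s0) sT'.
have [y Oy Hy] := Nd_residual (ltW delta0) s0 sT Nds.
have := le_trans Hy (rE y s Oy s0 sT').
rewrite (caputo_lin hal0 hal1 (-1) s0)//; [|exact: caputo_class_at EC s0 sT'|exact: caputo_class_at NC s0 sT'].
move: (caputo _ _ _) (caputo _ _ _) => p q; lra.
Qed.

Lemma error_le_resolvent x t (h : R -> \bar R) : Omega x -> 0 < t -> t <= T ->
  (forall r, 0 < r -> r < t -> (0 <= h r)%E /\
     forall y, Omega y -> (`|error_residual y r|%:E <= h r)%E) ->
  (`|e x t|%:E <= \int[@lebesgue_measure R]_(r in `]0%R, t[)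
     ((res_kernel al lam (t - r))%:E * h r))%E.
Proof.
move=> Ox t0 tT Hh.
apply: (@le_trans _ _ (N t)%:E); first by rewrite lee_fin; exact: N_ge (ltW t0) tT Ox.
apply/lee_addgt0Pr => delta delta0.
apply: (@le_trans _ _ ((Nd delta t)%:E + delta%:E)%E).
  by rewrite -EFinD lee_fin N_le_Nd.
rewrite leeD2r//.
have [eta eta0 Heta] := Nd_small delta0.
have [_ NL] := Nd_class (ltW delta0).
(* [e0] lies strictly below [eta], so [Nd delta] vanishes on [0, e0]; clamping the time to [e0, T]
   thus changes nothing on [0, T] and yields a globally Lipschitz function. *)
pose e0 := Num.min (eta / 2) T.
have e00 : 0 < e0 by rewrite lt_min T0 divr_gt0.
have [K HK] := NL e0 e00.
pose v s := Nd delta (clamp e0 T s).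
have vE s : 0 <= s -> s <= T -> v s = Nd delta s.
  move=> s0 sT; have [se|es] := leP s e0; last by rewrite /v clamp_id// ltW.
  have e0eta : e0 < eta.
    apply: (@le_lt_trans _ _ (eta / 2)); first by rewrite ge_min lexx.
    by rewrite ltr_pdivrMr// mulr_natr mulr2n ltrDl.
  have -> : v s = Nd delta e0.
    by rewrite /v /clamp (min_r sT) max_l.
  have e0T : e0 <= T by rewrite ge_min lexx orbT.
  by rewrite !Heta ?(ltW e00)//; exact: le_lt_trans se e0eta.
have v0 : v 0 = 0 by rewrite vE ?(ltW T0)// Heta// ltW.
rewrite -(vE t (ltW t0) tT).
have e0T : e0 <= T by rewrite ge_min lexx orbT.
have K0 : 0 <= `|K| by [].
apply: (@le_resolvent _ _ _ hal0 hal1 lam0 v `|K| t h t0 _ v0).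
  move=> y z; apply: le_trans (HK _ _ _ _ _ _) _; rewrite ?clamp_ge ?clamp_le//.
  apply: (@le_trans _ _ (`|K| * `|clamp e0 T y - clamp e0 T z|)).
    by apply: ler_wpM2r => //; exact: ler_norm.
  by apply: ler_wpM2l => //; exact: clamp_dist.
move=> r r0 rt; have [h0 hr] := Hh r r0 rt; split => //.
have rT := ltW (lt_le_trans rt tT).
have cv : caputo al v r = caputo al (Nd delta) r.
  by apply: caputo_ext => // s s0 sr; apply: vE => //; exact: le_trans rT.
rewrite cv vE ?(ltW r0)//.
have [Ndr|Ndr] := ltP 0 (Nd delta r).
  have [y Oy Hy] := Nd_residual (ltW delta0) r0 rT Ndr.
  by apply: le_trans (hr y Oy); rewrite lee_fin.
(* Where [Nd delta] vanishes it is minimal, so its Caputo derivative is at most that of a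
   constant. *)
apply: le_trans h0.
have Ndr0 : Nd delta r = 0 by apply/eqP; rewrite eq_le Ndr Nd_ge0.
suff : caputo al (Nd delta) r <= caputo al (fun=> 0) r.
  by rewrite caputo_cst Ndr0 mulr0 addr0 lee_fin.
apply: (le_caputo hal0 hal1 r0).
- exact: caputo_class_at (Nd_class (ltW delta0)) r0 rT.
- exact: caputo_at_cst.
- by move=> s s0 sr; rewrite Ndr0 subrr sub0r oppr_le0.
Qed.

(** As y tends to x, the slice difference [e x - e y] becomes small uniformly on [0, t], by
    compactness of the time interval, while its Lipschitz bound at [t] does not depend on y. These
    are the two hypotheses of [caputo_small]. *)
Let continuous_caputo_error x t : closure Omega x -> Omega x -> 0 < t -> t <= T ->
  caputo al (e y) t @[y --> x] --> caputo al (e x) t.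
Proof.
move=> _ Ox t0 tT.
apply/(@cvgrPdist_le _ _ _ (nbhs x)) => eps eps0.
have [M M0 eM] := closure_itv_bounded.
have t20 : 0 < t / 2 by rewrite divr_gt0.
have [K HK] := e_lip t20.
(* Half of [L] serves each of the two slices: Lipschitz constant for s >= t/2, size bound for
   earlier times. *)
pose L := 2 * (Num.max `|K| (2 * M / (t / 2))).
have L0 : 0 <= L by rewrite mulr_ge0// le_max normr_ge0.
have e_L y s : Omega y -> 0 <= s -> s < t -> `|e y t - e y s| <= L / 2 * (t - s).
  move=> Oy s0 st; have ts : 0 < t - s by rewrite subr_gt0.
  have -> : L / 2 = Num.max `|K| (2 * M / (t / 2)) by rewrite /L [2 * Num.max _ _]mulrC mulfK.
  have [sh|hs] := leP (t / 2) s.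
    apply: le_trans (HK y t s Oy _ tT sh (ltW (lt_le_trans st tT))) _; first by lra.
    rewrite (ger0_norm (ltW ts)); apply: ler_wpM2r; first exact: ltW.
    by rewrite le_max ler_norm.
  apply: (@le_trans _ _ (2 * M / (t / 2) * (t / 2))).
    rewrite divfK ?gt_eqF// mulr2n mulrDl mul1r.
    apply: le_trans (ler_normB _ _) _; apply: lerD; apply: eM => //.
    - exact: clO.
    - exact: ltW.
    - exact: clO.
    - exact: ltW (lt_le_trans st tT).
  apply: ler_pM; rewrite ?(ltW t20)//.
  - by rewrite divr_ge0 ?mulr_ge0// ltW.
  - by rewrite le_max lexx orbT.
  - lra.
have [eta eta0 Heta] := caputo_small hal0 hal1 t0 L0 eps0.
have eta40 : 0 < eta / 4 by rewrite divr_gt0.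
have H : \forall y \near x, `[0, t]%classic `<=` (fun s => Omega y -> s \in `[0, t] -> `|e x s - e y s| < eta / 2).
  apply: ((compact_near_coveringP _).1 (@segment_compact R 0 t) _ (nbhs x)
    (fun y s => Omega y -> s \in `[0, t] -> `|e x s - e y s| < eta / 2)) => s; rewrite /= in_itv/= => /andP[s0 st].
  have sT := le_trans st tT.
  have [[U V] [/= Ux Vs] UV] := e_near (clO Ox) s0 sT eta40.
  exists (V, U) => //= -[s' y] [/= Vs' Uy] Oy; rewrite in_itv/= => /andP[s'0 s't].
  have Hd (z : 'rV[R]_d) : U z -> Omega z -> `|e x s - e z s'| < eta / 4.
    move=> Uz Oz; apply: (UV (z, s')) => //=; split => /=; first exact: clO.
    by rewrite in_itv/= s'0 (le_trans s't).
  have h1 := Hd y Uy Oy; have h2 := Hd x (nbhs_singleton Ux) Ox.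
  have -> : e x s' - e y s' = (e x s - e y s') - (e x s - e x s') by ring.
  apply: le_lt_trans (ler_normB _ _) _.
  have -> : eta / 2 = eta / 4 + eta / 4 by field.
  exact: ltrD.
near=> y.
have Oy : Omega y by near: y; exact: open_nbhs_nbhs.
have Hy s : 0 <= s -> s <= t -> `|e x s - e y s| < eta / 2.
  have Hn : `[0, t]%classic `<=` (fun s => Omega y -> s \in `[0, t] -> `|e x s - e y s| < eta / 2).
    by near: y.
  by move=> s0 st; apply: Hn => //=; rewrite in_itv/= s0.
have at_x := caputo_class_at (slice_caputo_class Ox) t0 tT.
have at_y := caputo_class_at (slice_caputo_class Oy) t0 tT.
rewrite -caputoB//; apply: Heta.
  by apply: measurable_realfun.measurable_funB; [case: at_x|case: at_y].
move=> s s0 st; split.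
  apply: le_trans (ler_normB _ _) _.
  have := Hy t (ltW t0) (lexx t); have := Hy s s0 (ltW st); lra.
have -> : e x t - e y t - (e x s - e y s) = (e x t - e x s) - (e y t - e y s) by ring.
apply: le_trans (ler_normB _ _) _.
have := e_L x s Ox s0 st; have := e_L y s Oy s0 st; lra.
Unshelve. all: by end_near. Qed.

(** Continuity lets the essential supremum of the residual bound its value at the maximum point of
    the error. *)
Lemma continuous_error_residual x t : Omega x -> 0 < t -> t <= T ->
  {for x, continuous (error_residual ^~ t)}.
Proof.
move=> Ox t0 tT.
exact: (cvgD (continuous_caputo_error (clO Ox) Ox t0 tT)
  (continuous_elliptic oO (e_C2 t0 tT) Ox a_cont b_cont c_cont)).
Qed.

End ErrorFunction.

(** * Explicit barriers *)

Section Barriers.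
Context {R : realType}.
Local Notation mu := (@lebesgue_measure R).
Variables (al tau : R) (hal0 : 0 < al) (hal1 : al < 1) (tau0 : 0 < tau).
Implicit Types (s t x y p S : R).

Lemma powR_subr1 x p : 0 < x -> x `^ (p - 1) = x `^ p / x.
Proof. by move=> x0; rewrite powRB ?(gt_eqF x0) ?implybT// powRr1 ?ltW. Qed.

(** Factor out x^(al-1): with r = x/y <= 1 the claim is r^(1-al) >= r. *)
Let powRBl x y : 0 < x -> x <= y ->
  x `^ (al - 1) - y `^ (al - 1) <= x `^ (al - 1) / y * (y - x).
Proof.
move=> x0 xy; have y0 := lt_le_trans x0 xy.
have r0 : 0 < x / y by rewrite divr_gt0.
have r1 : x / y <= 1 by rewrite ler_pdivrMr// mul1r.
have -> : y `^ (al - 1) = x `^ (al - 1) * (x / y) `^ (1 - al).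
  rewrite -{1}[y](_ : x * (x / y)^-1 = y); last by field; rewrite !gt_eqF.
  rewrite powRM ?invr_ge0 ?(ltW x0) ?(ltW r0)//; congr (_ * _).
  by rewrite -powR_inv1 ?(ltW r0)// -powRrM; congr (_ `^ _); ring.
have -> : x `^ (al - 1) / y * (y - x) = x `^ (al - 1) * (1 - x / y).
  by field; rewrite gt_eqF.
rewrite -{1}[x `^ _]mulr1 -mulrBr; apply: ler_wpM2l; first exact: powR_ge0.
rewrite lerD2l lerN2 -{1}[x / y]powRr1 ?(ltW r0)//.
by apply: ger_powR; [rewrite r0|have := hal0; lra].
Qed.

Lemma powR_alN1_nincr x y : 0 < x -> x <= y -> y `^ (al - 1) <= x `^ (al - 1).
Proof.
move=> x0 xy; have y0 := lt_le_trans x0 xy.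
rewrite -[al - 1]opprB !powRN lef_pV2 ?posrE ?powR_gt0//.
by apply: ge0_ler_powR; rewrite ?nnegrE ?(ltW x0) ?(ltW y0)// subr_ge0 ltW.
Qed.

Lemma barrier1_gt0 t : 0 < barrier1 al tau t.
Proof. by rewrite powR_gt0// lt_max tau0. Qed.

Lemma barrier1_le t : 0 < t -> barrier1 al tau t <= t `^ (al - 1).
Proof. by move=> t0; apply: powR_alN1_nincr => //; rewrite le_max lexx orbT. Qed.

Let barrier1_nincr s t : s <= t -> barrier1 al tau t <= barrier1 al tau s.
Proof.
by move=> st; apply: powR_alN1_nincr; rewrite ?lt_max ?tau0// ge_max !le_max lexx st orbT.
Qed.

Let barrier1_lip s t :
  `|barrier1 al tau s - barrier1 al tau t| <= tau `^ (al - 1) / tau * `|s - t|.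
Proof.
wlog st : s t / s <= t => [hw|].
  by have [|/ltW] := leP s t => st; [|rewrite distrC [`|s - t|]distrC]; exact: hw.
rewrite ger0_norm ?subr_ge0; last exact: barrier1_nincr.
rewrite ler0_norm ?subr_le0// opprB /barrier1.
have m0 : 0 < Num.max tau s by rewrite lt_max tau0.
have mst : Num.max tau s <= Num.max tau t by rewrite ge_max !le_max lexx st orbT.
apply: le_trans (powRBl m0 mst) _.
have n0 := lt_le_trans m0 mst.
apply: ler_pM.
- by rewrite divr_ge0 ?powR_ge0 ?ltW.
- by rewrite subr_ge0.
- apply: ler_pM; rewrite ?powR_ge0 ?invr_ge0 ?(ltW n0)//.
    by apply: powR_alN1_nincr; rewrite ?le_max ?lexx.
  by rewrite lef_pV2 ?posrE// le_max lexx.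
- by case: (leP tau s) => ?; case: (leP tau t) => ?; lra.
Qed.

(* The jump at 0 contributes the term [t^(-al) v(t) / Gamma (1 - al)]. *)
Definition from_zero (v : R -> R) s : R := if 0 < s then v s else 0.

Lemma from_zero_class T (v : R -> R) : (exists M, forall t, 0 < t -> `|v t| <= M) ->
  (exists K, forall s t, `|v s - v t| <= K * `|s - t|) ->
  caputo_class T (from_zero v).
Proof.
move=> [M HM] [K HK]; split.
  exists `|M| => t _ _; rewrite /from_zero; case: ifP => t0; last by rewrite normr0.
  by apply: le_trans (HM t t0) (ler_norm _).
move=> eps eps0; exists K => s1 s2 es1 _ es2 _.
by rewrite /from_zero (lt_le_trans eps0 es1) (lt_le_trans eps0 es2).
Qed.

Lemma caputo_from_zero (v : R -> R) t : 0 < t ->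
  caputo al (from_zero v) t =
  (Gamma (1 - al))^-1 * (t `^ (- al) * v t +
    \int[mu]_(s in `]0, t[) (al * (t - s) `^ (- al - 1) * (v t - v s))).
Proof.
move=> t0; rewrite /caputo /from_zero t0 ltxx subr0; congr (_ * (_ + _)).
by apply: eq_Rintegral => s /set_mem/=; rewrite in_itv/= => /andP[-> _].
Qed.

Lemma caputo_step S t : 0 < t ->
  caputo al (from_zero (fun=> S)) t = S * ((Gamma (1 - al))^-1 * t `^ (- al)).
Proof.
move=> t0; rewrite caputo_from_zero//.
have -> : \int[mu]_(s in `]0, t[) (al * (t - s) `^ (- al - 1) * (S - S)) = 0.
  transitivity (\int[mu]_(s in `]0, t[) (0 : R)).
    by apply: eq_Rintegral => s _; rewrite subrr mulr0.
  by rewrite Rintegral_cst// mul0r.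
by rewrite addr0; move: (Gamma _) (t `^ _) => ? ?; ring.
Qed.

(* [d/ds (s^al (t-s)^(-al)) = al t s^(al-1) (t-s)^(-al-1)]. *)
Let F t s : R := (t^-1 * s `^ al - t `^ (al - 1)) * (t - s) `^ (- al).

(** The first factor of [F] vanishes to first order at s = t, which beats (t-s)^(-al): [F] is
    squeezed between a multiple of (t-s)^(1-al) and 0. *)
Let F_lim t : 0 < t -> F t s @[s --> t^'-] --> 0.
Proof.
move=> t0.
have H0 : - (t `^ (al - 1) / t) * (t - s) `^ (1 - al) @[s --> t^'-] --> 0.
  rewrite -[X in _ --> X](mulr0 (- (t `^ (al - 1) / t))).
  by apply: cvgM; [exact: cvg_cst|apply: cvg_powR_subr_at_left; rewrite subr_gt0].
apply: (squeeze_cvgr _ H0 (cvg_cst 0)).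
near=> s.
have st : s < t by near: s; exact: nbhs_left_lt.
have s0 : 0 < s by near: s; exact: nbhs_left_gt.
have ts : 0 < t - s by rewrite subr_gt0.
have sE : s `^ al = s * s `^ (al - 1).
  by rewrite powR_subr1//; field; rewrite gt_eqF.
have tE : (t - s) `^ (1 - al) = (t - s) * (t - s) `^ (- al).
  by rewrite powRD ?(gt_eqF ts) ?implybT// powRr1 ?(ltW ts).
have p0 : 0 <= (t - s) `^ (- al) by exact: powR_ge0.
have q0 : 0 <= t `^ (al - 1) by exact: powR_ge0.
have H : t `^ (al - 1) <= s `^ (al - 1) by apply: powR_alN1_nincr => //; exact: ltW.
have t1 : 0 < t^-1 by rewrite invr_gt0.
have lo : - (t `^ (al - 1) / t) * (t - s) <= t^-1 * s `^ al - t `^ (al - 1).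
  have -> : - (t `^ (al - 1) / t) * (t - s) = t^-1 * (s * t `^ (al - 1)) - t `^ (al - 1).
    by move: (t `^ _) => ?; field; rewrite gt_eqF.
  rewrite lerD2r sE; apply: ler_wpM2l; first exact: ltW.
  by apply: ler_wpM2l => //; exact: ltW.
apply/andP; split; first by rewrite /F tE mulrA; apply: ler_wpM2r.
rewrite /F mulr_le0_ge0// subr_le0.
rewrite powR_subr1// mulrC; apply: ler_wpM2r; first exact: ltW.
by apply: ge0_ler_powR; rewrite ?nnegrE ?ltW.
Unshelve. all: by end_near. Qed.

Let F_derive t s : 0 < s -> s < t ->
  is_derive s 1 (F t) (al * (t - s) `^ (- al - 1) * (s `^ (al - 1) - t `^ (al - 1))).
Proof.
move=> s0 st; have ts : 0 < t - s by rewrite subr_gt0.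
have t0 := lt_trans s0 st.
have D1 := is_derive1_powR al s0.
have D2 := is_derive_powR_subr (- al) st.
have D3 : is_derive s 1 (fun s => t^-1 * s `^ al) (t^-1 * (al * s `^ (al - 1))).
  have D := is_deriveM (is_derive_cst t^-1 s 1) D1.
  by apply: is_derive_eq D _; rewrite scaler0 addr0.
have D4 : is_derive s 1 (fun s => t^-1 * s `^ al - t `^ (al - 1))
    (t^-1 * (al * s `^ (al - 1)) - 0).
  exact: is_deriveB.
have D5 := is_deriveM D4 D2.
apply: is_derive_eq D5 _.
rewrite /GRing.scale/=.
have sE : s `^ al = s * s `^ (al - 1).
  by rewrite powR_subr1//; field; rewrite gt_eqF.
have tE : (t - s) `^ (- al) = (t - s) * (t - s) `^ (- al - 1).
  by rewrite [in RHS]powR_subr1//; field; rewrite gt_eqF.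
rewrite sE tE; move: (s `^ _) ((t - s) `^ _) (t `^ _) => p q m.
by field; rewrite gt_eqF.
Qed.

(** Split at [tau]: before it the barrier is constant and only the kernel is integrated; after it
    [F t] is a primitive, with limit 0 at [t]. *)
Let integral_barrier1 t : tau < t ->
  (\int[mu]_(s in `]0%R, t[)
     (al * (t - s) `^ (- al - 1) * (barrier1 al tau s - barrier1 al tau t))%:E =
   ((tau `^ (al - 1) - t `^ (al - 1)) * ((t - tau) `^ (- al) - t `^ (- al)) +
    (t `^ (al - 1) - t^-1 * tau `^ al) * (t - tau) `^ (- al))%:E)%E.
Proof.
move=> taut; have t0 := lt_trans tau0 taut.
have Bt : barrier1 al tau t = t `^ (al - 1) by rewrite /barrier1 max_r// ltW.
have cB : continuous (barrier1 al tau) by exact: lipschitz_continuous barrier1_lip.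
have mf (D : set R) : measurable_fun D (fun s : R =>
    (al * (t - s) `^ (- al - 1) * (barrier1 al tau s - barrier1 al tau t))%:E).
  apply/measurable_EFinP; apply: measurable_realfun.measurable_funM.
    by apply: measurable_realfun.measurable_funM => //; exact: measurable_powR_subr.
  apply: measurable_realfun.measurable_funB => //.
  by apply: measurable_funTS; exact: continuous_measurable_fun.
have f0 s : s <= t ->
    0 <= al * (t - s) `^ (- al - 1) * (barrier1 al tau s - barrier1 al tau t).
  move=> st; apply: mulr_ge0; first by rewrite mulr_ge0 ?powR_ge0// ltW.
  by rewrite subr_ge0; exact: barrier1_nincr.
have -> : `]0, t[%classic = (`]0, tau] `|` `]tau, t[)%classic.
  apply/seteqP; split => s /=; rewrite !in_itv/=.
    by move=> /andP[s0 st]; case: (leP s tau) => ?; [left|right]; apply/andP.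
  by move=> [/andP[s0 st]|/andP[s0 st]]; apply/andP; split => //;
    [exact: le_lt_trans taut|exact: lt_trans s0].
rewrite ge0_integral_setU//=; last 3 first.
- exact: mf.
- move=> s /=; rewrite !in_itv/= lee_fin => -[/andP[s0 st]|/andP[s0 st]]; apply: f0.
    by apply: le_trans st _; exact: ltW.
  exact: ltW.
- apply/disj_setPS => s [] /=; rewrite !in_itv/= => /andP[_ s1] /andP[s2 _].
  by have := le_lt_trans s1 s2; rewrite ltxx.
rewrite EFinD; congr (_ + _)%E.
  rewrite -integral_itv_bndo_bndc//.
  transitivity ((al * (tau `^ (al - 1) - t `^ (al - 1)))%:E *
      \int[mu]_(s in `]0%R, tau[) ((t - s) `^ (- al - 1))%:E)%E.
    rewrite -ge0_integralZl//=.
    - apply: eq_integral => s /set_mem/=; rewrite in_itv/= => /andP[s0 st].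
      rewrite -EFinM Bt /barrier1 max_l ?(ltW st)//; congr EFin; ring.
    - by apply/measurable_EFinP; exact: measurable_powR_subr.
    - by move=> s _; rewrite lee_fin powR_ge0.
    - rewrite lee_fin mulr_ge0 ?(ltW hal0)// subr_ge0.
      by apply: powR_alN1_nincr => //; exact: ltW.
  rewrite integral_powR_subr_itv ?oppr_eq0 ?gt_eqF// -EFinM subr0; congr EFin.
  move: (t `^ (- al)) ((t - tau) `^ _) (t `^ _) (tau `^ _) => p q m n.
  by field; rewrite gt_eqF.
have -> : (t `^ (al - 1) - t^-1 * tau `^ al) * (t - tau) `^ (- al) = 0 - F t tau.
  by rewrite /F; move: (t `^ _) (tau `^ _) ((t - tau) `^ _) => ? ? ?; ring.
have HF s : s \in `]tau, t[ -> derivable (F t) s 1 /\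
    'D_1 (F t) s = al * (t - s) `^ (- al - 1) * (barrier1 al tau s - barrier1 al tau t).
  rewrite in_itv/= => /andP[taus st].
  have D := F_derive (lt_trans tau0 taus) st.
  split; first exact: ex_derive.
  by rewrite derive_val Bt /barrier1 max_r// ltW.
apply: (ge0_integral_itvoo_FTC taut _ _ HF _ (F_lim t0)).
- by move=> s; rewrite in_itv/= => /andP[_ st]; exact: f0 (ltW st).
- move=> s; rewrite in_itv/= => /andP[taus st]; apply: cvgM.
    by apply: cvgM; [exact: cvg_cst|exact: continuous_powR_subr].
  by apply: cvgB; [exact: cB|exact: cvg_cst].
- apply: cvg_at_right_filter.
  have D := F_derive tau0 taut.
  by apply: differentiable_continuous; apply/derivable1_diffP; exact: ex_derive.
Qed.

(** This computation explains [rho]. For t <= tau the barrier has been constant and only the jump at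
    0 contributes, which matches the vanishing positive part; for t > tau the two pieces of the
    integral combine with the jump. *)
Lemma caputo_barrier1 t : 0 < t ->
  caputo al (from_zero (barrier1 al tau)) t =
  (Gamma (1 - al))^-1 * t^-1 * rho al (tau / t).
Proof.
move=> t0; rewrite caputo_from_zero// -mulrA; congr (_ * _).
have talE : t `^ (- al) = t^-1 * (t `^ (al - 1))^-1.
  by rewrite -powRN -powR_inv1 ?(ltW t0)// -powRD ?(gt_eqF t0) ?implybT//; congr (_ `^ _); ring.
have q0 : 0 < t `^ (al - 1) by exact: powR_gt0.
have ttau : (tau / t) `^ (- (1 - al)) = tau `^ (al - 1) / t `^ (al - 1).
  rewrite opprB powRM ?invr_ge0 ?ltW//; congr (_ * _).
  by rewrite -powR_inv1 ?ltW// -powRrM -powRN; congr (_ `^ _); ring.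
have [ttau_le|taut] := leP t tau.
  have -> : \int[mu]_(s in `]0, t[)
      (al * (t - s) `^ (- al - 1) * (barrier1 al tau t - barrier1 al tau s)) = 0.
    transitivity (\int[mu]_(s in `]0, t[) (0 : R)); last by rewrite Rintegral_cst// mul0r.
    apply: eq_Rintegral => s /set_mem/=; rewrite in_itv/= => /andP[s0 st].
    by rewrite /barrier1 !max_l ?subrr ?mulr0//; exact: ltW (lt_le_trans st ttau_le).
  rewrite /rho /pospart max_l; last by rewrite subr_le0 ler_pdivlMr// mul1r.
  rewrite powR0; last by rewrite gt_eqF// subr_gt0.
  rewrite ttau /barrier1 max_l// talE addr0 subr0 mulr1.
  by move: (tau `^ _) (t `^ _) => ? ?; ring.
have -> : \int[mu]_(s in `]0, t[)
    (al * (t - s) `^ (- al - 1) * (barrier1 al tau t - barrier1 al tau s)) =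
    - ((tau `^ (al - 1) - t `^ (al - 1)) * ((t - tau) `^ (- al) - t `^ (- al)) +
    (t `^ (al - 1) - t^-1 * tau `^ al) * (t - tau) `^ (- al)).
  transitivity (- \int[mu]_(s in `]0, t[)
      (al * (t - s) `^ (- al - 1) * (barrier1 al tau s - barrier1 al tau t))); last first.
    by rewrite /Rintegral integral_barrier1.
  rewrite -[LHS]opprK; congr (- _); rewrite -[LHS]mulN1r -RintegralZl//.
    by apply: eq_Rintegral => s _; ring.
  apply: caputo_integrable => //; split.
    by apply: measurable_funTS; apply: continuous_measurable_fun; exact: lipschitz_continuous barrier1_lip.
  exists (tau `^ (al - 1) / tau) => s s0 st; apply: le_trans (barrier1_lip _ _) _.
  by rewrite ger0_norm// subr_ge0 ltW.
have ty : 0 < t - tau by rewrite subr_gt0.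
have r1 : 0 < 1 - tau / t by rewrite subr_gt0 ltr_pdivrMr// mul1r.
rewrite /rho /pospart max_r ?(ltW r1)// ttau /barrier1 max_r ?(ltW taut)//.
have -> : (1 - tau / t) `^ (1 - al) =
    (t - tau) * (t - tau) `^ (- al) * t `^ (al - 1).
  have -> : 1 - tau / t = (t - tau) * t^-1 by field; rewrite gt_eqF.
  rewrite powRM ?invr_ge0 ?ltW//; congr (_ * _).
    by rewrite powRD ?(gt_eqF ty) ?implybT// powRr1 ?(ltW ty).
  by rewrite -powR_inv1 ?ltW// -powRrM; congr (_ `^ _); ring.
have -> : tau `^ al = tau * tau `^ (al - 1).
  by rewrite powR_subr1//; field; rewrite gt_eqF.
rewrite talE; move: (t `^ (al - 1)) q0 ((t - tau) `^ _) (tau `^ _) => q q0 p n.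
by field; rewrite !gt_eqF.
Qed.

Lemma rho_gt0 s : 0 < s -> 0 < rho al s.
Proof.
move=> s0; rewrite /rho mulr_gt0 ?powR_gt0// subr_gt0.
have b0 : 0 < 1 - al by rewrite subr_gt0.
have p0 : 0 <= pospart (1 - s) by rewrite le_max lexx.
have p1 : pospart (1 - s) < 1 by rewrite gt_max ltr01 gtrBl.
have e1 : (1 : R) `^ (1 - al) = 1 by rewrite powR1.
by rewrite -[ltRHS]e1; apply: gt0_ltr_powR; rewrite ?nnegrE.
Qed.

Lemma residual0_gt0 lam t : 0 <= lam -> 0 < t -> 0 < residual0 al lam t.
Proof.
move=> lam0 t0; apply: ltr_wpDr => //.
by rewrite mulr_gt0 ?powR_gt0// invr_gt0 Gamma_gt0// subr_gt0.
Qed.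

Lemma residual1_gt0 lam t : 0 <= lam -> 0 < t -> 0 < residual1 al lam tau t.
Proof.
move=> lam0 t0; apply: ltr_wpDr.
  by apply: mulr_ge0 => //; exact: ltW (barrier1_gt0 _).
apply: mulr_gt0; last by apply: rho_gt0; exact: divr_gt0.
by apply: divr_gt0 => //; rewrite invr_gt0 Gamma_gt0// subr_gt0.
Qed.

Lemma step_barrier lam S T t : 0 <= S -> 0 < t ->
  let E := from_zero (fun=> S) in
  [/\ caputo_class T E, forall s, 0 <= E s, E t = S &
      caputo al E t + lam * E t = S * residual0 al lam t].
Proof.
move=> S0 t0 E; have Et : E t = S by rewrite /E /from_zero t0.
split => //.
- apply: from_zero_class; first by exists S => s _; rewrite ger0_norm.
  by exists 0 => s s'; rewrite subrr normr0 mul0r.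
- by move=> s; rewrite /E /from_zero; case: ifP.
- by rewrite Et caputo_step// /residual0; move: (Gamma _) (t `^ _) => ? ?; ring.
Qed.

Lemma scaled_barrier1 lam S T t : 0 <= S -> 0 < t ->
  let E := from_zero (fun s => S * barrier1 al tau s) in
  [/\ caputo_class T E, forall s, 0 <= E s, E t = S * barrier1 al tau t &
      caputo al E t + lam * E t = S * residual1 al lam tau t].
Proof.
move=> S0 t0 E; have Et : E t = S * barrier1 al tau t by rewrite /E /from_zero t0.
have SK s s' : `|S * barrier1 al tau s - S * barrier1 al tau s'| <=
    S * (tau `^ (al - 1) / tau) * `|s - s'|.
  by rewrite -mulrBr normrM (ger0_norm S0) -mulrA; exact: ler_wpM2l.
split => //.
- apply: from_zero_class; last by exists (S * (tau `^ (al - 1) / tau)).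
  exists (S * tau `^ (al - 1)) => s _; rewrite ger0_norm; last first.
    by apply: mulr_ge0 => //; exact: ltW (barrier1_gt0 _).
  by apply: ler_wpM2l => //; apply: powR_alN1_nincr; rewrite ?le_max ?lexx.
- move=> s; rewrite /E /from_zero; case: ifP => // _.
  by apply: mulr_ge0 => //; exact: ltW (barrier1_gt0 _).
- rewrite Et.
  have -> : caputo al E t = S * caputo al (from_zero (barrier1 al tau)) t.
    rewrite /E !caputo_from_zero//.
    transitivity (S * ((Gamma (1 - al))^-1 * (t `^ (- al) * barrier1 al tau t)) +
       (Gamma (1 - al))^-1 * (S * \int[mu]_(s in `]0, t[)
       (al * (t - s) `^ (- al - 1) * (barrier1 al tau t - barrier1 al tau s)))); last first.
      by move: (Rintegral _ _ _) (Gamma _) (t `^ _) => ? ? ?; ring.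
    rewrite -RintegralZl//; last first.
      apply: caputo_integrable => //; split.
        by apply: measurable_funTS; apply: continuous_measurable_fun; exact: lipschitz_continuous barrier1_lip.
      exists (tau `^ (al - 1) / tau) => s s0 st; apply: le_trans (barrier1_lip _ _) _.
      by rewrite ger0_norm// subr_ge0 ltW.
    have -> : \int[mu]_(s in `]0, t[) (al * (t - s) `^ (- al - 1) *
        (S * barrier1 al tau t - S * barrier1 al tau s)) =
      \int[mu]_(s in `]0, t[) (S * (al * (t - s) `^ (- al - 1) *
        (barrier1 al tau t - barrier1 al tau s))).
      by apply: eq_Rintegral => s _; ring.
    by move: (Rintegral _ _ _) (Gamma _) (t `^ _) => ? ? ?; ring.
  by rewrite caputo_barrier1// /residual1; move: (Gamma _) (rho _ _) (barrier1 _ _ _) => ? ? ?; ring.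
Qed.

End Barriers.

(** * The error bounds *)

Section Assembly.
Context {R : realType} {d : nat}.
Implicit Types (Omega : set 'rV[R]_d) (v : 'rV[R]_d -> R).

Lemma eq_Linfty Omega v1 v2 : (forall x, Omega x -> v1 x = v2 x) ->
  Linfty Omega v1 = Linfty Omega v2.
Proof.
move=> v12; rewrite /Linfty.
suff -> : [set M : R | 0 <= M /\ lebesgue_outer [set x | Omega x /\ M < `|v1 x|] = 0%E] =
    [set M : R | 0 <= M /\ lebesgue_outer [set x | Omega x /\ M < `|v2 x|] = 0%E] by [].
apply/seteqP; split => M /= [M0 <-]; split => //; congr lebesgue_outer;
  apply/seteqP; split => x /= [Ox]; rewrite v12//.
Qed.

Lemma Linfty_le_ereal Omega v (M : \bar R) : (0 < d)%N -> Omega !=set0 ->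
  (forall x, Omega x -> (`|v x|%:E <= M)%E) -> (Linfty Omega v <= M)%E.
Proof.
move=> d0 [x0 Ox0] vM; case: M vM => [r| |] vM; last 2 first.
- exact: leey.
- by have := vM x0 Ox0.
apply: Linfty_le d0 _ _; first by have := vM x0 Ox0; rewrite lee_fin; exact: le_trans.
by move=> x Ox; rewrite -lee_fin; exact: vM.
Qed.

(** The bound in L_oo becomes pointwise because [u] is continuous in space at each positive time. *)
Lemma regularity_lipschitz Omega T (u : 'rV[R]_d -> R -> R) : open Omega -> 0 < T ->
  regularity Omega T u -> forall eps, 0 < eps -> exists K, forall x s1 s2, Omega x ->
    eps <= s1 -> s1 <= T -> eps <= s2 -> s2 <= T -> `|u x s1 - u x s2| <= K * `|s1 - s2|.
Proof.
move=> oO T0 [reg C2u] eps eps0; have [epsT|Teps] := ltP eps T; last first.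
  exists 0 => x s1 s2 _ es1 s1T es2 s2T.
  have -> : s1 = T by apply/eqP; rewrite eq_le s1T (le_trans Teps).
  have -> : s2 = T by apply/eqP; rewrite eq_le s2T (le_trans Teps).
  by rewrite subrr normr0 mul0r.
have [_ [K HK]] := reg eps T eps0 epsT (lexx T).
exists K => x s1 s2 Ox es1 s1T es2 s2T; rewrite -lee_fin.
apply: le_trans (HK s1 s2 _ _); rewrite ?in_itv/= ?es1 ?es2//.
apply: (norm_le_Linfty (v := fun x => u x s1 - u x s2)) => // y Oy.
have [c1 _] := C2u s1 (lt_le_trans eps0 es1) s1T y Oy.
have [c2 _] := C2u s2 (lt_le_trans eps0 es2) s2T y Oy.
exact: cvgB c1 c2.
Qed.

Lemma regularity_continuous Omega T (u : 'rV[R]_d -> R -> R) : 0 < T ->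
  regularity Omega T u -> {within closure Omega `*` `[0, T]%classic,
    continuous (fun p : 'rV[R]_d * R => u p.1 p.2)}.
Proof.
move=> T0 [reg _].
have T2 : 0 < T / 2 by rewrite divr_gt0.
have T2T : T / 2 < T by rewrite ltr_pdivrMr// mulr_natr mulr2n ltrDl.
by have [] := reg (T / 2) T T2 T2T (lexx T).
Qed.

Lemma barrier_caputo_class T (E : R -> R) : barrier_class T E -> caputo_class T E.
Proof.
move=> [[M [_ HM]] HL]; split.
  (* Boundedness is stated near infinity, so it speaks of constants strictly above [M]; the
     Lipschitz constant below is treated alike. *)
  exists (M + 1) => t t0 tT; apply: (HM (M + 1)); first by rewrite ltrDl.
  by rewrite /= in_itv/= t0.
move=> eps eps0; have [K [_ HK]] := HL eps eps0.
exists (K + 1) => s1 s2 es1 s1T es2 s2T.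
apply: (HK (K + 1) _ (s1, s2)); first by rewrite ltrDl.
by split; rewrite /= in_itv/= ?es1 ?es2.
Qed.

End Assembly.

(** An infinite supremum leaves nothing to prove. A finite one, [S], forces r s <= S q s, which
    makes S times the unit barrier admissible; [B] is the value of that barrier at [t]. *)
Lemma le_mul_ereal_sup (R : realType) (B t : R) (err : \bar R) (r : R -> \bar R)
  (q : R -> R) : 0 < B -> 0 < t ->
  (forall s, 0 < s -> s <= t -> (0 <= r s)%E /\ 0 < q s) ->
  (forall S, 0 <= S -> (forall s, 0 < s -> s <= t -> (r s <= (S * q s)%:E)%E) ->
    (err <= (S * B)%:E)%E) ->
  (err <= B%:E * ereal_sup [set (r s * ((q s)^-1)%:E)%E | s in `]0%R, t]])%E.
Proof.
move=> B0 t0 rq H.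
have ub s : 0 < s -> s <= t ->
    (r s * ((q s)^-1)%:E <= ereal_sup [set (r s * ((q s)^-1)%:E)%E | s in `]0%R, t]])%E.
  move=> s0 st; apply: ereal_sup_ubound; exists s => //.
  by rewrite /= in_itv/= s0.
have tt : (0 <= r t * ((q t)^-1)%:E)%E.
  by have [r0 q0] := rq t t0 (lexx t); rewrite mule_ge0// lee_fin invr_ge0 ltW.
move: (ereal_sup _) ub => sup ub.
have sup0 := le_trans tt (ub t t0 (lexx t)).
case: sup ub sup0 => [S| |] ub sup0 //; last by rewrite gt0_muley ?leey// lte_fin.
rewrite -EFinM mulrC; apply: H => // s s0 st.
have [r0 q0] := rq s s0 st.
have := ub s s0 st; case: (r s) r0 => [p| |] //= _.
  by rewrite -EFinM !lee_fin ler_pdivrMr.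
by rewrite gt0_mulye// lte_fin invr_gt0.
Qed.

Theorem theorem3p2 (R : realType) (d : nat) (hd : (1 <= d <= 3)%N)
  (al T lam : R) (hal0 : 0 < al) (hal1 : al < 1) (hT : 0 < T)
  (Omega : set 'rV[R]_d) (hOmega : bounded_lipschitz_domain Omega)
  (a b : 'I_d -> 'rV[R]_d -> R) (c : 'rV[R]_d -> R)
  (ha : forall k, {within closure Omega, continuous (a k)})
  (hb : forall k, {within closure Omega, continuous (b k)})
  (hc : {within closure Omega, continuous c})
  (ha0 : forall k x, closure Omega x -> 0 < a k x)
  (hlam : 0 <= lam) (hclam : forall x, closure Omega x -> lam <= c x)
  (f : 'rV[R]_d -> R -> R) (u0 : 'rV[R]_d -> R) (u uh : 'rV[R]_d -> R -> R)
  (hu : is_unique_solution al T Omega a b c f u0 u)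
  (huh : regularity Omega T uh)
  (huh0 : forall x, Omega x -> uh x 0 = u0 x)
  (huhb : forall x t, boundary Omega x -> 0 < t -> t <= T -> uh x t = u x t) :
  let err (t : R) := Linfty Omega (fun x => uh x t - u x t) in
  let res (t : R) := Linfty Omega (fun x => residual al a b c f uh x t) in
  [/\ (* (i) *)
      forall t : R, 0 < t -> t <= T ->
        (err t <= caputo_resolvent al lam res t)%E,
      (* (ii) *)
      forall E : R -> R, barrier_class T E ->
        (forall t : R, 0 <= t -> t <= T -> 0 <= E t) ->
        (forall t : R, 0 < t -> t <= T ->
           (res t <= (caputo al E t + lam * E t)%:E)%E) ->
        forall t : R, 0 <= t -> t <= T -> (err t <= (E t)%:E)%E
    & (* (iii) *)
      forall tau t : R, 0 < tau -> 0 < t -> t <= T ->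
        let sup0 := ereal_sup [set (res s * ((residual0 al lam s)^-1)%:E)%E
                                | s in `]0, t]] in
        let sup1 := ereal_sup [set (res s * ((residual1 al lam tau s)^-1)%:E)%E
                                | s in `]0, t]] in
        [/\ (err t <= sup0)%E,
            (err t <= (t `^ (al - 1))%:E * sup1)%E &
            (err t <= (barrier1 al tau t)%:E * sup1)%E]].
Proof.
move=> err res.
have d0 : (0 < d)%N by case/andP: hd.
case: (hOmega) => O0 oO _ bO _.
have [regu [solu u_init u_bd] _] := hu.
have clO x : Omega x -> closure Omega x by move=> ?; exact: subset_closure.
pose e x t := uh x t - u x t.
have cont_u := regularity_continuous hT regu.
have cont_uh := regularity_continuous hT huh.
have lip_u := regularity_lipschitz oO hT regu.
have lip_uh := regularity_lipschitz oO hT huh.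
have e_cont : {within closure Omega `*` `[0, T]%classic,
    continuous (fun p : 'rV[R]_d * R => e p.1 p.2)}.
  by move=> p; exact: cvgB (cont_uh p) (cont_u p).
have e_lip eps : 0 < eps -> exists K, forall x s1 s2, Omega x ->
    eps <= s1 -> s1 <= T -> eps <= s2 -> s2 <= T -> `|e x s1 - e x s2| <= K * `|s1 - s2|.
  move=> eps0; have [K HK] := lip_u eps eps0; have [L HL] := lip_uh eps eps0.
  exists (L + K) => x s1 s2 Ox es1 s1T es2 s2T.
  have -> : e x s1 - e x s2 = (uh x s1 - uh x s2) - (u x s1 - u x s2).
    by rewrite /e; ring.
  by apply: le_trans (ler_normB _ _) _; rewrite mulrDl; apply: lerD; [exact: HL|exact: HK].
have e_C2 t : 0 < t -> t <= T -> C2_on Omega (e ^~ t).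
  by move=> t0 tT; apply: C2_onB => //; [exact: huh.2|exact: regu.2].
have e_initO x : Omega x -> e x 0 = 0.
  by move=> Ox; rewrite /e huh0// u_init// subrr.
(* The initial condition is given in [Omega] only and reaches its closure by continuity. *)
have e_init x : closure Omega x -> e x 0 = 0.
  move=> Ox; apply/eqP; rewrite -normr_eq0; apply/negP => /negP ne0.
  have e0 : 0 < `|e x 0| by rewrite lt_def ne0 normr_ge0.
  have Dx : (closure Omega `*` `[0, T]%classic) (x, (0 : R)).
    by split => //=; rewrite in_itv/= lexx ltW.
  move/subspace_continuousP : (e_cont) => /(_ (x, 0) Dx) /cvgrPdist_lt /(_ _ e0).
  rewrite /= => -[[U V] [/= Ux V0] UV].
  have [y [Oy Uy]] := Ox U Ux.
  have : `|e x 0 - e y 0| < `|e x 0|.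
    apply: (UV (y, 0) (conj Uy (nbhs_singleton V0))).
    by split => /=; [exact: clO|rewrite in_itv/= lexx ltW].
  by rewrite (e_initO y Oy) subr0 ltxx.
have e_bd x t : boundary Omega x -> 0 < t -> t <= T -> e x t = 0.
  by move=> bx t0 tT; rewrite /e huhb// subrr.
(* The equation for [u] eliminates [f], so the residual is the operator applied to the error. *)
have resE x t : Omega x -> 0 < t -> t <= T ->
    residual al a b c f uh x t = error_residual al a b c e x t.
  move=> Ox t0 tT; rewrite /residual /error_residual -(solu x t Ox t0 tT) /e.
  have cu := slice_caputo_class hT O0 bO cont_u lip_u Ox.
  have cuh := slice_caputo_class hT O0 bO cont_uh lip_uh Ox.
  rewrite caputoB ?(ellipticB a b c oO)//.
  - by move: (elliptic _ _ _ _ _) (elliptic _ _ _ _ _) (caputo _ _ _) (caputo _ _ _) => *; ring.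
  - exact: huh.2.
  - exact: regu.2.
  - exact: caputo_class_at cuh t0 tT.
  - exact: caputo_class_at cu t0 tT.
have le_res x t : Omega x -> 0 < t -> t <= T ->
    (`|error_residual al a b c e x t|%:E <= res t)%E.
  move=> Ox t0 tT.
  have -> : res t = Linfty Omega (error_residual al a b c e ^~ t).
    by apply: eq_Linfty => y Oy; exact: resE.
  apply: (norm_le_Linfty (v := error_residual al a b c e ^~ t)) => // y Oy.
  exact: (continuous_error_residual hal0 hal1 hT O0 oO bO ha hb hc e_cont e_lip e_C2 Oy t0 tT).
have res_ge0 t : (0 <= res t)%E by exact: Linfty_ge0.
have key := error_le_barrier (b := b) hal0 hal1 hT O0 oO bO ha0 hlam hclam e_cont e_lip e_C2 e_init e_bd.
have barrier T' E : 0 < T' -> T' <= T -> caputo_class T' E ->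
    (forall t, 0 <= t -> t <= T' -> 0 <= E t) ->
    (forall t, 0 < t -> t <= T' -> (res t <= (caputo al E t + lam * E t)%:E)%E) ->
    forall t, 0 <= t -> t <= T' -> (err t <= (E t)%:E)%E.
  move=> T'0 T'T EC E0 rE t t0 tT'.
  apply: Linfty_le_ereal => // x Ox; rewrite lee_fin.
  apply: (key T' E) => // y s Oy s0 sT'; rewrite -lee_fin.
  by apply: le_trans (le_res y s Oy s0 (le_trans sT' T'T)) _; exact: rE.
split.
- move=> t t0 tT; apply: Linfty_le_ereal => // x Ox.
  apply: (error_le_resolvent hal0 hal1 hT O0 oO bO ha0 hlam hclam e_cont e_lip e_C2 e_init e_bd Ox t0 tT).
  move=> r r0 rt; split => // y Oy; apply: le_res => //.
  exact: ltW (lt_le_trans rt tT).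
- move=> E EC E0 rE t t0 tT.
  by apply: (barrier T E hT (lexx T) (barrier_caputo_class EC)).
move=> tau t tau0 t0 tT sup0 sup1.
have B0 : 0 < barrier1 al tau t by exact: barrier1_gt0.
(* The sharper bound comes first; the one with t^(al-1) follows from [barrier1_le]. *)
have Bsup : (err t <= (barrier1 al tau t)%:E * sup1)%E.
  apply: le_mul_ereal_sup => //.
    by move=> s s0 st; split => //; exact: residual1_gt0.
  move=> S S0 HS.
  pose E := from_zero (fun s => S * barrier1 al tau s).
  have HE s (s0 : 0 < s) := scaled_barrier1 hal0 hal1 tau0 lam t S0 s0.
  have [EC E0 Et _] := HE t t0.
  rewrite -Et; apply: (barrier t) => //; last exact: ltW.
  by move=> s s0 st; have [_ _ _ ->] := HE s s0; exact: HS.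
split => //.
- rewrite -[sup0]mul1e; apply: le_mul_ereal_sup => //.
    by move=> s s0 st; split => //; exact: residual0_gt0.
  move=> S S0 HS.
  have HE s (s0 : 0 < s) := step_barrier al lam t S0 s0.
  have [EC E0 Et _] := HE t t0.
  rewrite mulr1 -Et; apply: (barrier t) => //; last exact: ltW.
  by move=> s s0 st; have [_ _ _ ->] := HE s s0; exact: HS.
- apply: le_trans Bsup _; apply: lee_wpmul2r; last by rewrite lee_fin barrier1_le.
  apply: (@le_trans _ _ (res t * ((residual1 al lam tau t)^-1)%:E)%E).
    by rewrite mule_ge0// lee_fin invr_ge0 ltW// residual1_gt0.
  by apply: ereal_sup_ubound; exists t => //; rewrite /= in_itv/= t0 lexx.
Qed.
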